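(* Let $n\ge 1$ and $f\in C^3(\mathbb{R}^n\times\mathbb{R},\mathbb{R}^n)$ with $f(0,0)=0$. Let $f_0(x):=f(x,0)$, $f_1(x):=\partial_uf(x,0)$, let $\hat f_0$ be the second-order Taylor polynomial of $f_0$ at $0$ and $\hat f_1$ the first-order Taylor polynomial of $f_1$ at $0$. Let $\mathcal{S}_1,\mathcal{S}_2$ be the Lie spaces associated with $(\hat f_0,\hat f_1)$, $d:=\dim\mathcal{S}_1$ and $d_0:=\partial_u^2f(0,0)$. There exists a map $G\in C^\infty(\mathcal{S}_1,\mathcal{S}_1^\perp)$ with $G(0)=0$ and $G'(0)=0$ such that the following alternative holds. (1) When $\mathcal{S}_2+\mathbb{R}d_0=\mathcal{S}_1$: for every $T>0$ there exist $C,\eta>0$ such that, for any trajectory $(x,u)\in C^0([0,T],\mathbb{R}^n)\times L^\infty((0,T),\mathbb{R})$ of $\dot x=f(x,u)$ with $x(0)=0$ and $\|u\|_{L^\infty}\le\eta$, $$\forall t\in[0,T],\quad \left|\mathbb{P}^\perp x(t)-G(\mathbb{P}x(t))\right|\le C\|u\|_{L^3(0,T)}^3 .$$ (2) When $d_0\notin\mathcal{S}_1$: the system $\dot x=f(x,u)$ is not $L^\infty$ small-time locally controllable; and there exists $T^*>0$ such that, for any $\mathcal{T}\in(0,T^* )$, there exists $\eta>0$ such that, for any $T\in(0,\mathcal{T}]$ and any trajectory $(x,u)\in C^0([0,T],\mathbb{R}^n)\times L^\infty((0,T),\mathbb{R})$ with $x(0)=0$ and $\|u\|_{L^\infty}\le\eta$,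 one has $\langle \mathbb{P}^\perp x(t)-G(\mathbb{P}x(t)),d_0\rangle\ge0$ for all $t\in[0,T]$. (3) When $d_0\in\mathcal{S}_1$ and $\mathcal{S}_2\not\subset\mathcal{S}_1$: there exists $k\in\{1,\dots,d\}$ such that $[\mathrm{ad}_{\hat f_0}^{j-1}(\hat f_1),\mathrm{ad}_{\hat f_0}^{j}(\hat f_1)](0)\in\mathcal{S}_1$ for all $1\le j<k$ and $[\mathrm{ad}_{\hat f_0}^{k-1}(\hat f_1),\mathrm{ad}_{\hat f_0}^{k}(\hat f_1)](0)\notin\mathcal{S}_1$; the system $\dot x=f(x,u)$ is not $W^{2k,\infty}$ small-time locally controllable; and there exists $T^*>0$ such that, for any $\mathcal{T}\in(0,T^* )$, there exists $\eta>0$ such that, for any $T\in(0,\mathcal{T}]$ and any trajectory $(x,u)\in C^0([0,T],\mathbb{R}^n)\times L^\infty((0,T),\mathbb{R})$ with $x(0)=0$, $u\in W^{2k,\infty}_0(0,T)$ and $\|u\|_{W^{2k,\infty}}\le\eta$, one has $\langle \mathbb{P}^\perp x(t)-G(\mathbb{P}x(t)),d_k\rangle\ge0$ for all $t\in[0,T]$, where $d_k:=-\mathbb{P}^\perp[\mathrm{ad}_{\hat f_0}^{k-1}(\hat f_1),\mathrm{ad}_{\hat f_0}^{k}(\hat f_1)](0)\neq 0$.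
   Context: Trajectory: $(x,u)\in C^0([0,T],\mathbb{R}^n)\times L^\infty((0,T),\mathbb{R})$ is a trajectory of $\dot x=f(x,u)$ with $x(0)=x^*$ if $x(t)=x^*+\int_0^t f(x(s),u(s))\,\mathrm{d}s$ for all $t\in[0,T]$. Lie brackets: $[X,Y](x):=Y'(x)X(x)-X'(x)Y(x)$; $\mathrm{ad}_X^0(Y):=Y$, $\mathrm{ad}_X^{k+1}(Y):=[X,\mathrm{ad}_X^k(Y)]$. Since $f_0,f_1$ are not smooth, Lie brackets are defined through the smooth regularized fields $\hat f_0,\hat f_1$: for $k\ge1$, $\mathcal{S}_k\subset\mathbb{R}^n$ is the linear span of the values at $0$ of all iterated Lie brackets of $\hat f_0$ and $\hat f_1$ (any nesting structure) containing $\hat f_1$ at most $k$ times. $\mathbb{P}$ and $\mathbb{P}^\perp=\mathrm{Id}-\mathbb{P}$ are the orthogonal projections of $\mathbb{R}^n$ onto $\mathcal{S}_1$ and $\mathcal{S}_1^\perp$ for the Euclidean scalar product $\langle\cdot,\cdot\rangle$. Function spaces: $W^{m,\infty}(0,T)$ is the usual Sobolev space with its natural norm; $W^{m,\infty}_0(0,T)$ is the set of $\varphi\in W^{m,\infty}(0,T)$ with $\varphi(0)=\dots=\varphi^{(m-1)}(0)=0$ (no condition at $T$). Small-time local controllability: given a family $(E_T,\|\cdot\|_{E_T})_{T>0}$ of normed spaces of scalar functions on $[0,T]$, the system is $E$ small-time locally controllable if for any $T>0$ and $\eta>0$ there exists $\delta>0$ such that, for all $x^*,x^\dagger\in\mathbb{R}^n$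 with $|x^*|+|x^\dagger|\le\delta$, there is a trajectory $(x,u)$ on $[0,T]$ with $u\in E_T$, $\|u\|_{E_T}\le\eta$, $x(0)=x^*$ and $x(T)=x^\dagger$. *)

(* Defs.v *)
From HB Require Import structures.
From mathcomp Require Import all_boot all_order all_algebra.
From mathcomp Require Import all_classical all_reals all_analysis.

Set Implicit Arguments.
Unset Strict Implicit.
Unset Printing Implicit Defensive.

Import Order.TTheory GRing.Theory Num.Theory.
Import numFieldNormedType.Exports.

Local Open Scope classical_set_scope.
Local Open Scope ring_scope.

Section Smoothness.
Context {R : realType} {V W : normedModType R}.

(* In finite dimension, F is C^(k+1) iff it is differentiable and all the maps
   x |-> F'(x) v are C^k.  Only used between finite-dimensional spaces. *)
Fixpoint Ck (k : nat) (F : V -> W) : Prop :=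
  if k is k'.+1 then
    (forall x, differentiable F x) /\ (forall v, Ck k' (fun x => 'd F x v))
  else continuous F.

Definition smooth (F : V -> W) : Prop := forall k, Ck k F.

End Smoothness.

Section Euclidean.
Context {R : realType} {n : nat}.
Implicit Types (x y v w : 'rV[R]_n) (A : set 'rV[R]_n) (U : {vspace 'rV[R]_n}).

Definition dot x y : R := \sum_(i < n) x 0 i * y 0 i.

(* The norm `|x| of the library on 'rV[R]_n is the sup norm. *)
Definition enorm x : R := Num.sqrt (dot x x).

(* vspan is characterized by vspanP, which shows that the default value
   of xget plays no role. *)
Definition vspan A : {vspace 'rV[R]_n} :=
  xget 0%VS [set U : {vspace 'rV[R]_n} |
    (forall v, A v -> v \in U) /\
    forall U' : {vspace 'rV[R]_n}, (forall v, A v -> v \in U') -> (U <= U')%VS].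

Lemma vspan_fin A : exists2 e : seq 'rV[R]_n,
  (forall v, v \in e -> A v) & (forall v, A v -> v \in <<e>>%VS).
Proof.
pose P k := `[< exists2 e : seq 'rV[R]_n,
  (forall v, v \in e -> A v) & \dim <<e>>%VS = k >].
have P0 : exists k, P k by exists 0%N; apply/asboolP; exists [::]; rewrite // span_nil dimv0.
have Pub k : P k -> (k <= \dim {:'rV[R]_n})%N.
  by move=> /asboolP[e _ <-]; apply/dimvS/subvf.
case: (ex_maxnP P0 Pub) => k /asboolP[e sA dk] kmax.
exists e => // v Av; apply: contraT => vs.
have /kmax : P (\dim <<v :: e>>%VS).
  by apply/asboolP; exists (v :: e) => // w; rewrite inE => /orP[/eqP->//|/sA].
rewrite leqNgt -dk; case/negP; rewrite ltnNge; apply: contra vs => le_dim.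
have sub : (<<e>> <= <<v :: e>>)%VS by rewrite span_cons addvSr.
have /eqP -> : (<<e>>%VS == <<v :: e>>%VS) by rewrite eqEdim sub le_dim.
by apply: memv_span; rewrite mem_head.
Qed.

Lemma vspanP A : (forall v, A v -> v \in vspan A) /\
  forall U, (forall v, A v -> v \in U) -> (vspan A <= U)%VS.
Proof.
rewrite /vspan; case: xgetP => [//|nex].
have [e sA As] := vspan_fin A.
case: (nex <<e>>%VS); split => // U AU.
by apply/span_subvP => v /sA /AU.
Qed.

Definition ortho_compl U : {vspace 'rV[R]_n} :=
  vspan [set v | forall w, w \in U -> dot v w = 0].

Lemma dotDl x y z : dot (x + y) z = dot x z + dot y z.
Proof. by rewrite /dot -big_split/=; apply: eq_bigr => i _; rewrite mxE mulrDl. Qed.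

Lemma dotZl a x z : dot (a *: x) z = a * dot x z.
Proof. by rewrite /dot mulr_sumr; apply: eq_bigr => i _; rewrite mxE mulrA. Qed.

Lemma mem_ortho_compl U v :
  v \in ortho_compl U <-> (forall w, w \in U -> dot v w = 0).
Proof.
split; last by apply: (vspanP _).1.
have [s sA As] := vspan_fin [set v | forall w, w \in U -> dot v w = 0].
move=> /(subvP ((vspanP _).2 _ As)) vs w wU.
rewrite (@coord_span _ _ _ (in_tuple s) v vs).
elim/big_ind: _ => [|x y hx hy|i _].
- by rewrite -(scale0r (0 : 'rV[R]_n)) dotZl mul0r.
- by rewrite dotDl hx hy addr0.
- by rewrite dotZl (sA _ _ w wU) ?mulr0// mem_nth.
Qed.

Definition orthoproj U x : 'rV[R]_n := daddv_pi U (ortho_compl U) x.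

Lemma dot_eq0 x : dot x x = 0 -> x = 0.
Proof.
move=> /psumr_eq0P x0; apply/rowP => i; rewrite mxE; apply/eqP.
by rewrite -sqrf_eq0 expr2 x0// => j _; rewrite -expr2 sqr_ge0.
Qed.

Lemma ortho_compl_direct U :
  (U :&: ortho_compl U = 0)%VS /\ (U + ortho_compl U = fullv)%VS.
Proof.
have cap0 : (U :&: ortho_compl U = 0)%VS.
  apply/eqP; rewrite -subv0; apply/subvP => v /memv_capP[vU /mem_ortho_compl vU'].
  by rewrite memv0; apply/eqP/dot_eq0/vU'.
split=> //; apply/eqP; rewrite eqEdim subvf/= dimv_disjoint_sum//.
pose B : 'M[R]_(n, \dim U) := \matrix_(i, j) (vbasis U)`_j 0 i.
pose h : 'Hom('rV[R]_n, 'rV[R]_(\dim U)) := linfun (mulmxr B).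
have kerh : (lker h <= ortho_compl U)%VS.
  apply/subvP => v; rewrite memv_ker lfunE/= => /eqP/rowP vB.
  apply/mem_ortho_compl => w /coord_vbasis ->.
  rewrite /dot; under eq_bigr do rewrite summxE mulr_sumr.
  rewrite exchange_big big1// => j _.
  transitivity (coord (vbasis U) j w * (v *m B) 0 j); last by rewrite vB mxE mulr0.
  rewrite !mxE mulr_sumr; apply: eq_bigr => i _.
  by rewrite !mxE mulrCA.
rewrite -(limg_ker_dim h fullv) capfv addnC leq_add//; last exact: dimvS.
by rewrite (leq_trans (dimvS (subvf _)))// dimvf /dim/= mul1n.
Qed.

Lemma orthoprojP U x :
  orthoproj U x \in U /\ x - orthoproj U x \in ortho_compl U.
Proof.
have [cap0 full] := ortho_compl_direct U; split; first exact: memv_pi.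
have /(daddv_pi_add cap0) {1}<- : x \in (U + ortho_compl U)%VS.
  by rewrite full memvf.
by rewrite addrC addKr memv_pi.
Qed.

End Euclidean.

Section LieBrackets.
Context {R : realType} {n : nat}.
Implicit Types X Y : 'rV[R]_n -> 'rV[R]_n.

Definition lie X Y : 'rV[R]_n -> 'rV[R]_n :=
  fun x => 'd Y x (X x) - 'd X x (Y x).

Definition ad X (k : nat) Y : 'rV[R]_n -> 'rV[R]_n := iter k (lie X) Y.

Inductive bracket : Type := B0 | B1 | Br of bracket & bracket.

Fixpoint bracket_eval X0 X1 (b : bracket) : 'rV[R]_n -> 'rV[R]_n :=
  match b with
  | B0 => X0
  | B1 => X1
  | Br b1 b2 => lie (bracket_eval X0 X1 b1) (bracket_eval X0 X1 b2)
  end.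

Fixpoint bracket_count1 (b : bracket) : nat :=
  match b with
  | B0 => 0
  | B1 => 1
  | Br b1 b2 => bracket_count1 b1 + bracket_count1 b2
  end.

Definition lie_space X0 X1 (k : nat) : {vspace 'rV[R]_n} :=
  vspan [set v | exists2 b, (bracket_count1 b <= k)%N &
                            v = bracket_eval X0 X1 b 0].

End LieBrackets.

Section System.
Context {R : realType} {n : nat}.
Variable f : 'rV[R]_n * R -> 'rV[R]_n.

Definition drift (x : 'rV[R]_n) : 'rV[R]_n := f (x, 0).

Definition ctrl_field (x : 'rV[R]_n) : 'rV[R]_n := derive1 (fun u : R => f (x, u)) 0.

Definition ctrl_second : 'rV[R]_n := derive1n 2 (fun u : R => f (0, u)) 0.

Definition drift_hat (x : 'rV[R]_n) : 'rV[R]_n :=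
  drift 0 + 'd drift 0 x + 2^-1 *: 'd (fun y => 'd drift y x) 0 x.

Definition ctrl_hat (x : 'rV[R]_n) : 'rV[R]_n :=
  ctrl_field 0 + 'd ctrl_field 0 x.

Definition Slie (k : nat) : {vspace 'rV[R]_n} := lie_space drift_hat ctrl_hat k.

Definition ad_hat (k : nat) : 'rV[R]_n -> 'rV[R]_n := ad drift_hat k ctrl_hat.

End System.

(* A scalar function on (0, T) is represented by a total function u : R -> R of
   which only the restriction to ]0, T[ matters. *)
Section FunctionSpaces.
Context {R : realType}.
Implicit Types (T : R) (u v phi : R -> R).

Notation mu := (@lebesgue_measure R).

Definition Lpnorm (p : \bar R) T u : \bar R :=
  'N[mu]_p [EFin \o (u \_ `]0, T[)].

Definition Linfty T : set (R -> R) :=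
  [set u | measurable_fun `]0, T[ u /\ (Lpnorm +oo T u < +oo)%E].

Definition test_function T : set (R -> R) :=
  [set phi | smooth phi /\ exists a b : R,
    [/\ 0 < a, b < T & forall t, t \notin `[a, b] -> phi t = 0]].

Definition is_weak_derivative T (j : nat) u v : Prop :=
  forall phi, test_function T phi ->
    \int[mu]_(t in `]0, T[) (u t * derive1n j phi t) =
    (-1) ^+ j * \int[mu]_(t in `]0, T[) (v t * phi t).

(* Unique up to a null set when u is in Sobolev T m with j <= m. *)
Definition weak_derivative T (j : nat) u : R -> R :=
  get [set v | Linfty T v /\ is_weak_derivative T j u v].

Definition Sobolev (m : nat) T : set (R -> R) :=
  [set u | Linfty T u /\ forall j, (j <= m)%N ->
    exists2 v, Linfty T v & is_weak_derivative T j u v].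

Definition Sobolev_norm (m : nat) T u : \bar R :=
  (\sum_(j < m.+1) Lpnorm +oo T (weak_derivative T j u))%E.

(* phi^(j)(0) = 0 refers to the continuous representative w of phi^(j). *)
Definition Sobolev0 (m : nat) T : set (R -> R) :=
  [set u | Sobolev m T u /\ forall j, (j < m)%N ->
    exists w : R -> R, [/\ {within `[0, T], continuous w},
      {ae mu, forall t, t \in `]0, T[ -> w t = weak_derivative T j u t} &
      w 0 = 0]].

End FunctionSpaces.

Section Control.
Context {R : realType} {n : nat}.
Variable f : 'rV[R]_n * R -> 'rV[R]_n.

Definition trajectory (T : R) (x0 : 'rV[R]_n) (x : R -> 'rV[R]_n) (u : R -> R)
    : Prop :=
  [/\ {within `[0, T], continuous x}, Linfty T u &
      forall t, t \in `[0, T] ->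
        x t = x0 + \row_(i < n)
                \int[@lebesgue_measure R]_(s in `]0, t[) (f (x s, u s) 0 i)].

(* E T is the set of controls on (0, T), with norm N T. *)
Definition stlc (E : R -> set (R -> R)) (N : R -> (R -> R) -> \bar R) : Prop :=
  forall T eta : R, 0 < T -> 0 < eta ->
  exists2 delta : R, 0 < delta &
  forall x0 x1 : 'rV[R]_n, enorm x0 + enorm x1 <= delta ->
  exists x u, [/\ trajectory T x0 x u, E T u, (N T u <= eta%:E)%E & x T = x1].

End Control.

Section Graphs.
Context {R : realType} {n : nat} {U : {vspace 'rV[R]_n}}.
Variable G : subvs_of U -> subvs_of (ortho_compl U).

(* Subspaces carry no norm in the library.  vsproj U is a linear map
   onto U that is the identity on U, so that G is C^oo iff this composition is,
   and the differential of the latter at 0 is G'(0) \o vsproj U. *)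
Definition ambient (y : 'rV[R]_n) : 'rV[R]_n := vsval (G (vsproj U y)).

(* P^perp y - G(P y) *)
Definition gap (y : 'rV[R]_n) : 'rV[R]_n :=
  (y - orthoproj U y) - vsval (G (vsproj U (orthoproj U y))).

End Graphs.

(* Main.v *)
Require Import Defs.
From HB Require Import structures.
From mathcomp Require Import all_boot all_order all_algebra.
From mathcomp Require Import all_classical all_reals all_analysis.
From mathcomp Require Import measurable_realfun.
From mathcomp Require Import ring lra zify.
Set Implicit Arguments.
Unset Strict Implicit.
Unset Printing Implicit Defensive.
Import Order.TTheory GRing.Theory Num.Theory.
Import numFieldNormedType.Exports.
Local Open Scope classical_set_scope.
Local Open Scope ring_scope.

(* Let S1 be spanned by the Krylov vectors H^i b (H = f_0'(0), b = f_1(0)), with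
   coordinates xi_i, and let P, Pp be the projections onto S1 and its orthogonal.
   Along a trajectory issued from 0, Pp x is of second order in u.  A bilinear map
   nfG from S1 to its orthogonal, built by recursion along the Krylov basis, is such
   that the gap w = Pp x - nfG (P x) (P x) solves
     w' = Pp H w + (u^2 / 2) Pp d_0 + \sum_i xi_i(P x)^2 gam_i + E,
   where the integral of |E| is at most C \int |u|^3.  Up to a factor -2, the first
   nonzero gam_i is the value modulo S1 of [ad^i f_1, ad^(i+1) f_1], and S_2 is
   contained in S1 when all the gam_i vanish.

   In case (1) no quadratic term remains and Gronwall's lemma concludes.  In case (2)
   the term u^2 d_0 dominates for small times and controls.  In case (3), if
   gam_(k-1) is the first nonzero coefficient, then xi_(k-1)(P x) is the k-th
   primitive u_k of u up to an error controlled by \int u_k^2 and \int |u|^3, so that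
   <w, gam_(k-1)> >= c \int u_k^2 - C \int |u|^3.  The interpolation inequality
   \int |u|^3 <= C K \int u_k^2, where K bounds the derivative of order 3k of u_k,
   that is of order 2k of u, gives the sign.  It needs |u_k| <= K T^(3k): this follows
   from the vanishing of the derivatives of u at 0, or, at a fixed time T (the only
   case needed against controllability), from a larger constant in K. *)

(** * Integrals of bounded measurable functions *)

(** The orders of derivation are dictated by scaling. On an interval of length l, a function phi
    whose derivative of order 3k has size K may have size K l^(3k), and its derivative of order k
    size K l^(2k); then \int |phi^(k)|^3 and K \int phi^2 both have size K^3 l^(6k+1). A bilinear
    [nfG] is enough because errors cubic in u are allowed. The map nfG(b, .) is forced: the
    derivative of nfG(P x, P x) contains 2 u nfG(b, P x), which has to cancel u Pp(L x), where L =
    f_1'(0). The recursion then prescribes nfG(H^(i+1) b, .) so as to cancel the products xi_i xi_j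
    with i <> j. Symmetry of [nfG] leaves no freedom on the diagonal, whence the squares xi_i^2.
    Brackets are read on the same object: [jet_defect] measures how far a field is from being
    tangent to the graph of [nfG] at 0 to first order, [f_0, .] preserves tangency up to the gam_i,
    and two tangent fields have a bracket with value in S1. Controls are merely bounded and
    measurable, so evolution equations are written as integral identities ([prim]), never as
    pointwise derivatives. *)

Section BoundedIntegral.
Context {R : realType}.
Implicit Types (T a b c t s : R) (g h : R -> R).
Notation mu := (@lebesgue_measure R).

(** The integral is not oriented: it is 0 when b <= a. *)
Definition intg (a b : R) (g : R -> R) : R := \int[mu]_(s in `]a, b[) g s.

(** The bound holds everywhere on the open interval and not just almost everywhere, so that later
    estimates are pointwise; essentially bounded controls are brought to this form by
    [clamp_exists]. *)
Definition bmf (T : R) (g : R -> R) : Prop :=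
  measurable_fun `]0, T[ g /\ exists M : R, forall s, 0 < s < T -> `|g s| <= M.

Lemma bmfS T T' g : T' <= T -> bmf T g -> bmf T' g.
Proof.
move=> TT [mg [M gM]]; split.
  apply: measurable_funS mg => // x /=; rewrite !in_itv/= => /andP[-> xT].
  exact: lt_le_trans TT.
by exists M => s /andP[s0 sT]; apply: gM; rewrite s0 (lt_le_trans sT).
Qed.

Lemma bmf_integrable T g a b : bmf T g -> 0 <= a -> b <= T ->
  mu.-integrable `]a, b[ (EFin \o g).
Proof.
move=> [mg [M gM]] a0 bT; have sub : `]a, b[%classic `<=` `]0, T[%classic.
  move=> x /=; rewrite !in_itv/= => /andP[ax xb].
  by rewrite (le_lt_trans a0 ax) (lt_le_trans xb).
apply: measurable_bounded_integrable => //.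
- by rewrite /= lebesgue_measure_itv/=; case: ifP => _; rewrite ?ltry// -EFinB ltry.
- exact: measurable_funS mg.
- exists M; split; first exact: num_real.
  move=> y My x xab; apply: le_trans (ltW My); apply: gM.
  by have := sub _ xab; rewrite /= in_itv.
Qed.

Lemma bmf_cst T c : bmf T (fun=> c).
Proof. by split; [exact: measurable_cst|exists `|c|]. Qed.

Lemma bmfD T g h : bmf T g -> bmf T h -> bmf T (fun s => g s + h s).
Proof.
move=> [mg [M gM]] [mh [N hN]]; split; first exact: measurable_funD.
by exists (M + N) => s /[dup] /gM ? /hN ?; rewrite (le_trans (ler_normD _ _))// lerD.
Qed.

Lemma bmfM T g h : bmf T g -> bmf T h -> bmf T (fun s => g s * h s).
Proof.
move=> [mg [M gM]] [mh [N hN]]; split; first exact: measurable_funM.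
exists (M * N) => s /[dup] /gM ? /hN ?; rewrite normrM ler_pM//.
Qed.

Lemma bmfZ T c g : bmf T g -> bmf T (fun s => c * g s).
Proof. by move=> ?; apply: bmfM => //; exact: bmf_cst. Qed.

Lemma bmfN T g : bmf T g -> bmf T (fun s => - g s).
Proof. by move=> /(bmfZ (-1)); under [X in bmf T X]eq_fun do rewrite mulN1r. Qed.

Lemma bmfB T g h : bmf T g -> bmf T h -> bmf T (fun s => g s - h s).
Proof. by move=> ? ?; apply: bmfD => //; exact: bmfN. Qed.

Lemma bmfX T g k : bmf T g -> bmf T (fun s => g s ^+ k).
Proof.
move=> bg; elim: k => [|k IH].
  under [X in bmf T X]eq_fun do rewrite expr0; exact: bmf_cst.
by under [X in bmf T X]eq_fun do rewrite exprS; exact: bmfM.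
Qed.

Lemma bmf_norm T g : bmf T g -> bmf T (fun s => `|g s|).
Proof.
move=> [mg [M gM]]; split; first exact/measurableT_comp.
by exists M => s /gM; rewrite normr_id.
Qed.

Lemma bmf_sum T (I : Type) (r : seq I) (P : pred I) (F : I -> R -> R) :
  (forall i, P i -> bmf T (F i)) -> bmf T (fun s => \sum_(i <- r | P i) F i s).
Proof.
move=> bF; elim: r => [|i r IH].
  under [X in bmf T X]eq_fun do rewrite big_nil; exact: bmf_cst.
under [X in bmf T X]eq_fun do rewrite big_cons.
by have [Pi|//] := boolP (P i); apply: bmfD => //; exact: bF.
Qed.

Lemma bmf_continuous T g : {within `[0, T], continuous g} -> bmf T g.
Proof.
move=> cg; have [T0|T0] := leP 0 T; last first.
  split; last by exists 0 => s /andP[s0 sT]; move: (lt_trans s0 sT); lra.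
  rewrite set_itv_ge ?bnd_simp -?leNgt; [exact: measurable_fun_set0|exact: ltW].
split.
  apply: (@measurable_funS _ _ _ _ `[0, T]%classic) => //.
    by apply: subset_itv; rewrite bnd_simp.
  exact: subspace_continuous_measurable_fun.
have [x xT xM] := EVT_max T0 cg.
have [y yT yM] := EVT_min T0 cg.
exists (`|g x| + `|g y|) => s /andP[s0 sT].
have sI : s \in `[0, T] by rewrite in_itv/= !ltW.
rewrite ler_norml; move: (xM _ sI) (yM _ sI) (ler_norm (g x)) (ler_norm (- g y)).
by rewrite normrN; move: (normr_ge0 (g x)) (normr_ge0 (g y)); lra.
Qed.

Section Properties.
Variables (T : R) (a b : R).
Hypotheses (a0 : 0 <= a) (bT : b <= T).

Let itg g (bg : bmf T g) := bmf_integrable bg a0 bT.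

Lemma intgD g h : bmf T g -> bmf T h ->
  intg a b (fun s => g s + h s) = intg a b g + intg a b h.
Proof. by move=> bg bh; rewrite /intg RintegralD//; exact: itg. Qed.

Lemma intgZ c g : bmf T g -> intg a b (fun s => c * g s) = c * intg a b g.
Proof. by move=> bg; rewrite /intg RintegralZl//; exact: itg. Qed.

Lemma intgN g : bmf T g -> intg a b (fun s => - g s) = - intg a b g.
Proof.
move=> bg; rewrite -mulN1r -intgZ//; congr intg.
by apply/funext => s; rewrite mulN1r.
Qed.

Lemma intgB g h : bmf T g -> bmf T h ->
  intg a b (fun s => g s - h s) = intg a b g - intg a b h.
Proof. by move=> bg bh; rewrite intgD ?intgN//; exact: bmfN. Qed.

Lemma intg_sum (I : Type) (r : seq I) (P : pred I) (F : I -> R -> R) :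
  (forall i, P i -> bmf T (F i)) ->
  intg a b (fun s => \sum_(i <- r | P i) F i s) =
  \sum_(i <- r | P i) intg a b (F i).
Proof.
move=> bF; elim: r => [|i r IH].
  rewrite big_nil /intg; under eq_Rintegral do rewrite big_nil.
  by rewrite Rintegral_cst ?mul0r.
rewrite big_cons /intg; under eq_Rintegral do rewrite big_cons.
have [Pi|//] := boolP (P i); rewrite -[LHS]/(intg _ _ _) intgD; first by rewrite IH.
- exact: bF.
- exact: bmf_sum.
Qed.

Lemma intg_le g h : bmf T g -> bmf T h ->
  (forall s, a < s < b -> g s <= h s) -> intg a b g <= intg a b h.
Proof.
move=> bg bh gh; apply: (le_Rintegral _ (itg bg) (itg bh)) => //.
Qed.

Lemma intg_norm g : bmf T g -> `|intg a b g| <= intg a b (fun s => `|g s|).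
Proof. by move=> bg; apply: le_normr_Rintegral => //; exact: itg. Qed.

End Properties.

Lemma intg_cst a b c : a <= b -> intg a b (fun=> c) = c * (b - a).
Proof.
move=> ab; rewrite /intg Rintegral_cst//= lebesgue_measure_itv/= lte_fin.
have [ab'|ba] := ltP a b; first by rewrite -EFinB.
have -> : b - a = 0 by lra.
by [].
Qed.

Lemma intg_eq a b g h : (forall s, a < s < b -> g s = h s) ->
  intg a b g = intg a b h.
Proof.
by move=> gh; apply: eq_Rintegral => s; rewrite inE/= in_itv/=; apply: gh.
Qed.

Lemma intg_ge0 a b g : (forall s, a < s < b -> 0 <= g s) -> 0 <= intg a b g.
Proof.
by move=> gh; apply: Rintegral_ge0 => s; rewrite /= in_itv/=; apply: gh.
Qed.

Lemma intgaa a g : intg a a g = 0.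
Proof. by rewrite /intg set_itv_ge ?bnd_simp ?ltxx// Rintegral_set0. Qed.

Lemma intg_split T g a b c : bmf T g -> 0 <= a -> a <= b -> b <= c -> c <= T ->
  intg a c g = intg a b g + intg b c g.
Proof.
move=> bg a0 ab bc cT; have [->|ab'] := eqVneq a b; first by rewrite intgaa add0r.
have [->|bc'] := eqVneq b c; first by rewrite intgaa addr0.
have ltab : a < b by rewrite lt_neqAle ab'.
have ltbc : b < c by rewrite lt_neqAle bc'.
apply/eqP; rewrite addrC -subr_eq /intg.
rewrite (Rintegral_itv_bndo_bndc (r := b)); last exact: bmf_integrable (le_trans bc cT).
by rewrite Rintegral_itvB//; exact: bmf_integrable bg a0 cT.
Qed.

Lemma intg_bound T g a b M : bmf T g -> 0 <= a -> a <= b -> b <= T ->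
  (forall s, a < s < b -> `|g s| <= M) -> `|intg a b g| <= M * (b - a).
Proof.
move=> bg a0 ab bT gM; apply: le_trans (intg_norm a0 bT bg) _.
rewrite -(intg_cst M ab); apply: (intg_le a0 bT) => //; [exact: bmf_norm|exact: bmf_cst].
Qed.

Lemma intg_le_sub T g a b c d : bmf T g -> 0 <= a -> a <= b -> b <= c -> c <= d ->
  d <= T -> (forall s, a < s < d -> 0 <= g s) -> intg b c g <= intg a d g.
Proof.
move=> bg a0 ab bc cd dT g0.
rewrite (intg_split bg a0 (le_trans ab bc) cd dT).
rewrite (intg_split bg a0 ab bc (le_trans cd dT)) addrAC lerDr.
apply: addr_ge0; apply: intg_ge0 => s /andP[? ?]; apply: g0; lra.
Qed.

End BoundedIntegral.

(** * Primitives of bounded measurable functions *)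

Section Primitives.
Context {R : realType}.
Implicit Types (T a b c t s : R) (g h F G : R -> R).

(** Cutting [0, T] into N + 1 equal pieces bounds the total increment by K T^2 / (N + 1). This
    replaces the argument that a function with zero derivative is constant, for functions
    differentiable only almost everywhere. *)
Lemma small_sqr_const T K F : 0 <= T ->
  (forall s t, 0 <= s -> s <= t -> t <= T -> `|F t - F s| <= K * (t - s) ^+ 2) ->
  F T = F 0.
Proof.
move=> T0 FK; apply/eqP; rewrite -subr_eq0 -normr_eq0; apply/eqP.
have step (N : nat) : `|F T - F 0| <= K * T ^+ 2 / N.+1%:R.
  have N0 : (0 : R) < N.+1%:R by rewrite ltr0n.
  pose p (j : nat) : R := j%:R * (T / N.+1%:R).
  have pS j : p j.+1 - p j = T / N.+1%:R by rewrite /p -mulrBl -natrB// subSnn mul1r.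
  have pge j : 0 <= p j by rewrite /p mulr_ge0// divr_ge0// ltW.
  have pN : p N.+1 = T by rewrite /p mulrCA divff ?mulr1// gt_eqF.
  have ind j : (j <= N.+1)%N -> `|F (p j) - F 0| <= j%:R * (K * (T / N.+1%:R) ^+ 2).
    elim: j => [_|j IH jN]; first by rewrite /p !mul0r subrr normr0.
    have -> : F (p j.+1) - F 0 = (F (p j.+1) - F (p j)) + (F (p j) - F 0).
      by rewrite addrA subrK.
    apply: le_trans (ler_normD _ _) _.
    rewrite -[j.+1]add1n natrD mulrDl mul1r lerD ?IH 1?ltnW//.
    rewrite -(pS j); apply: FK => //; first by rewrite -subr_ge0 pS divr_ge0// ltW.
    by rewrite -pN /p ler_wpM2r ?ler_nat// divr_ge0// ltW.
  have := ind _ (leqnn _); rewrite pN => /le_trans; apply.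
  rewrite le_eqVlt; apply/orP; left; apply/eqP; field; lra.
apply/eqP; rewrite eq_le normr_ge0 andbT; apply/ler_addgt0Pl => e e0; rewrite addr0.
have [N HN] : exists N : nat, (K * T ^+ 2) / e < N.+1%:R.
  by exists (Num.truncn (K * T ^+ 2 / e)); exact: truncnS_gt.
apply: le_trans (step N) _.
by rewrite ler_pdivrMr ?ltr0n// [e * _]mulrC -ler_pdivrMr// ltW.
Qed.

(** F is Lipschitz on [0, T] and g is one bounded representative of its derivative. *)
Definition prim T F g : Prop :=
  bmf T g /\ forall t, 0 <= t <= T -> F t = F 0 + intg 0 t g.

Lemma primB T F g s t : prim T F g -> 0 <= s -> s <= t -> t <= T ->
  F t - F s = intg s t g.
Proof.
move=> [bg Fg] s0 st tT; rewrite (Fg t) ?(le_trans s0)// (Fg s) ?s0 ?(le_trans st)//.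
by rewrite (intg_split bg (lexx 0) s0 st tT); lra.
Qed.

Lemma prim_lip T F g : prim T F g -> exists2 M : R, 0 <= M &
  forall s t, 0 <= s <= T -> 0 <= t <= T -> `|F t - F s| <= M * `|t - s|.
Proof.
move=> [bg Fg]; have [_ [M gM]] := bg.
exists `|M| => // s t /andP[s0 sT] /andP[t0 tT].
have H a b : 0 <= a -> a <= b -> b <= T -> `|F b - F a| <= `|M| * `|b - a|.
  move=> a0 ab bT; rewrite (primB (conj bg Fg) a0 ab bT) (ger0_norm (_ : 0 <= b - a)) ?subr_ge0//.
  apply: (intg_bound bg a0 ab bT) => r /andP[ar rb].
  by apply: le_trans (ler_norm M); apply: gM; rewrite (le_lt_trans a0 ar) (lt_le_trans rb bT).
have [st|/ltW ts] := leP s t; first exact: H.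
by rewrite distrC [`|t - s|]distrC; apply: H.
Qed.

Lemma lip_continuous T M F :
  (forall s t, 0 <= s <= T -> 0 <= t <= T -> `|F t - F s| <= M * `|t - s|) ->
  {within `[0, T], continuous F}.
Proof.
move=> FM; apply/subspace_continuousP => x /=; rewrite in_itv/= => xT.
apply/cvgrPdist_le => e e0; rewrite near_withinE.
near=> y => /=; rewrite in_itv/= => yT.
apply: le_trans (FM _ _ yT xT) _.
apply: (@le_trans _ _ ((`|M| + 1) * `|x - y|)).
  rewrite ler_wpM2r//; move: (ler_norm M); lra.
rewrite mulrC -ler_pdivlMr; last by move: (normr_ge0 M); lra.
near: y; apply/nbhs_normP; exists (e / (`|M| + 1)) => /=; last by move=> z /ltW.
by rewrite divr_gt0//; move: (normr_ge0 M); lra.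
Unshelve. all: by end_near. Qed.

Lemma prim_continuous T F g : prim T F g -> {within `[0, T], continuous F}.
Proof. by move=> /prim_lip[M _ /lip_continuous]. Qed.

Lemma prim_bmf T F g : prim T F g -> bmf T F.
Proof. by move=> /prim_continuous/bmf_continuous. Qed.

Lemma prim_cst T c : prim T (fun=> c) (fun=> 0).
Proof.
by split=> [|t /andP[t0 _]]; [exact: bmf_cst|rewrite intg_cst// mul0r addr0].
Qed.

Lemma primD T F g G h : prim T F g -> prim T G h ->
  prim T (fun s => F s + G s) (fun s => g s + h s).
Proof.
move=> [bg Fg] [bh Gh]; split; first exact: bmfD.
by move=> t tT; rewrite Fg// Gh// (intgD (lexx 0) (andP tT).2)//; lra.
Qed.

Lemma primZ T F g c : prim T F g -> prim T (fun s => c * F s) (fun s => c * g s).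
Proof.
move=> [bg Fg]; split; first exact: bmfZ.
by move=> t tT; rewrite Fg// (intgZ (lexx 0) (andP tT).2)//; lra.
Qed.

Lemma primB' T F g G h : prim T F g -> prim T G h ->
  prim T (fun s => F s - G s) (fun s => g s - h s).
Proof.
move=> [bg Fg] [bh Gh]; split; first exact: bmfB.
by move=> t tT; rewrite Fg// Gh// (intgB (lexx 0) (andP tT).2)//; lra.
Qed.

Lemma prim_sum T (I : Type) (r : seq I) (P : pred I) (F g : I -> R -> R) :
  (forall i, P i -> prim T (F i) (g i)) ->
  prim T (fun s => \sum_(i <- r | P i) F i s) (fun s => \sum_(i <- r | P i) g i s).
Proof.
move=> Fg; split; first by apply: bmf_sum => i /Fg[].
move=> t tT; rewrite (intg_sum (lexx 0) (andP tT).2); last by move=> i /Fg[].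
by rewrite -big_split/=; apply: eq_bigr => i /Fg[_ ->].
Qed.

Lemma prim_eq T F g F' g' : prim T F g ->
  (forall t, 0 <= t <= T -> F' t = F t) -> (forall t, g' t = g t) -> prim T F' g'.
Proof.
move=> [bg Fg] FF gg; have -> : g' = g by apply/funext.
split=> // t tT; have t0 : 0 <= (0 : R) <= T by case/andP: tT => ? /(le_trans _) ->; rewrite ?lexx.
by rewrite (FF t tT) (FF 0 t0) (Fg t tT).
Qed.

(** Over [a, b], the increment of F G minus the integral of g G + F h equals the integral of g (G b
    - G) + (F a - F) h, which is O((b - a)^2) because F and G are Lipschitz; [small_sqr_const]
    concludes. *)
Lemma primM T F g G h : prim T F g -> prim T G h ->
  prim T (fun s => F s * G s) (fun s => g s * G s + F s * h s).
Proof.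
move=> Fg Gh; have [bg _] := Fg; have [bh _] := Gh.
have bF := prim_bmf Fg; have bG := prim_bmf Gh.
have bk : bmf T (fun s => g s * G s + F s * h s) by apply: bmfD; exact: bmfM.
split=> // t /andP[t0 tT].
have [M M0 FM] := prim_lip Fg; have [N N0 GN] := prim_lip Gh.
have [_ [B gB]] := bg; have [_ [C hC]] := bh.
suff : F t * G t - intg 0 t (fun s => g s * G s + F s * h s) =
       F 0 * G 0 - intg 0 0 (fun s => g s * G s + F s * h s).
  by rewrite intgaa; lra.
apply: (@small_sqr_const t (`|B| * N + M * `|C|)
  (fun t => F t * G t - intg 0 t (fun s => g s * G s + F s * h s))) => // a b a0 ab bt.
have bT := le_trans bt tT.
rewrite (intg_split bk (lexx 0) a0 ab bT).
have -> : F b * G b - (intg 0 a (fun s => g s * G s + F s * h s) +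
   intg a b (fun s => g s * G s + F s * h s)) - (F a * G a -
   intg 0 a (fun s => g s * G s + F s * h s)) =
   intg a b (fun s => g s * (G b - G s) + (F a - F s) * h s).
  have -> : (fun s => g s * (G b - G s) + (F a - F s) * h s) =
    (fun s => (G b * g s + F a * h s) - (g s * G s + F s * h s)).
    by apply/funext => s; ring.
  have b1 : bmf T (fun s => G b * g s) by exact: bmfZ.
  have b2 : bmf T (fun s => F a * h s) by exact: bmfZ.
  rewrite (intgB a0 bT) ?(intgD a0 bT) ?(intgZ a0 bT)//; last exact: bmfD.
  + rewrite -!(primB Fg a0 ab bT) -!(primB Gh a0 ab bT); ring.
  + by apply: bmfM.
  + by apply: bmfM.
have bk' : bmf T (fun s => g s * (G b - G s) + (F a - F s) * h s).
  by apply: bmfD; apply: bmfM => //; apply: bmfB => //; exact: bmf_cst.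
rewrite expr2 mulrA; apply: (intg_bound bk' a0 ab bT) => s /andP[sa sb].
have sT : 0 < s < T by rewrite (le_lt_trans a0 sa) (lt_le_trans sb bT).
have sT' : 0 <= s <= T by case/andP: sT => /ltW-> /ltW->.
have aT : 0 <= a <= T by rewrite a0 (le_trans ab).
have bT' : 0 <= b <= T by rewrite bT (le_trans a0).
have H1 : `|G b - G s| <= N * (b - a).
  apply: le_trans (GN _ _ sT' bT') _; rewrite ler_wpM2l// ger0_norm; lra.
have H2 : `|F a - F s| <= M * (b - a).
  apply: le_trans (FM _ _ sT' aT) _; rewrite ler_wpM2l// distrC ger0_norm; lra.
apply: le_trans (ler_normD _ _) _; rewrite !normrM mulrDl lerD//.
  rewrite -mulrA; apply: ler_pM => //; exact: le_trans (gB _ sT) (ler_norm B).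
rewrite [M * _ * _]mulrAC; apply: ler_pM => //; exact: le_trans (hC _ sT) (ler_norm C).
Qed.

Lemma prim0 T g : 0 <= T -> bmf T g -> prim T (fun t => intg 0 t g) g.
Proof. by move=> T0 bg; split=> // t tT; rewrite intgaa add0r. Qed.

End Primitives.

(** * Moment inequalities and Gronwall's lemma *)

Section Inequalities.
Context {R : realType}.
Implicit Types (T a b c t s : R) (g h F G v : R -> R).

(* Integrate (v - c)^2 >= 0, with c the mean of v. *)
Lemma intg_sqr_le T t v : bmf T v -> 0 <= t <= T ->
  (intg 0 t v) ^+ 2 <= t * intg 0 t (fun s => v s ^+ 2).
Proof.
move=> bv /andP[t0 tT]; have [->|tn0] := eqVneq t 0.
  by rewrite !intgaa expr0n/= mul0r.
have tp : 0 < t by rewrite lt_neqAle eq_sym tn0.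
set U1 := intg 0 t v; set U2 := intg 0 t _; pose c := U1 / t.
have b2 : bmf T (fun s => v s ^+ 2) by exact: bmfX.
have : 0 <= intg 0 t (fun s => (v s - c) ^+ 2) by apply: intg_ge0 => s _; exact: sqr_ge0.
have -> : (fun s => (v s - c) ^+ 2) = (fun s => (v s ^+ 2 + (- 2 * c) * v s) + c ^+ 2).
  by apply/funext => s; ring.
have b3 : bmf T (fun s => (- 2 * c) * v s) by exact: bmfZ.
rewrite (intgD (lexx 0) tT); [|exact: bmfD|exact: bmf_cst].
rewrite (intgD (lexx 0) tT)// (intgZ (lexx 0) tT)// intg_cst// subr0 -/U1 -/U2.
move=> H; have -> : U1 ^+ 2 = t * (- (-2 * c * U1 + c ^+ 2 * t)).
  by rewrite /c; field.
by rewrite ler_wpM2l//; lra.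
Qed.

(* Chebyshev's sum inequality: integrate (v - c) (v ^ 2 - c ^ 2) >= 0,
   with c the mean of v. *)
Lemma intg_cube_ge T t v : bmf T v -> 0 <= t <= T ->
  (forall s, 0 <= v s) ->
  intg 0 t v * intg 0 t (fun s => v s ^+ 2) <= t * intg 0 t (fun s => v s ^+ 3).
Proof.
move=> bv /andP[t0 tT] v0; have [->|tn0] := eqVneq t 0.
  by rewrite !intgaa !mul0r.
have tp : 0 < t by rewrite lt_neqAle eq_sym tn0.
set U1 := intg 0 t v; set U2 := intg 0 t _; set U3 := intg 0 t _; pose c := U1 / t.
have c0 : 0 <= c by rewrite divr_ge0// intg_ge0.
have b2 : bmf T (fun s => v s ^+ 2) by exact: bmfX.
have b3 : bmf T (fun s => v s ^+ 3) by exact: bmfX.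
have : 0 <= intg 0 t (fun s => (v s - c) ^+ 2 * (v s + c)).
  by apply: intg_ge0 => s _; rewrite mulr_ge0 ?sqr_ge0// addr_ge0.
have -> : (fun s => (v s - c) ^+ 2 * (v s + c)) =
  (fun s => (v s ^+ 3 + (- c) * v s ^+ 2) + (- c ^+ 2 * v s + c ^+ 3)).
  by apply/funext => s; ring.
have b4 : bmf T (fun s => - c * v s ^+ 2) by exact: bmfZ.
have b5 : bmf T (fun s => - c ^+ 2 * v s) by exact: bmfZ.
have bc : bmf T (fun s => c ^+ 3) by exact: bmf_cst.
rewrite (intgD (lexx 0) tT); [|exact: bmfD|exact: bmfD].
rewrite !(intgD (lexx 0) tT)// (intg_cst _ t0) !(intgZ (lexx 0) tT)// subr0 -/U1 -/U2 -/U3.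
move=> H; have -> : U1 * U2 = t * (c * U2) by rewrite /c; field.
have cc : c ^+ 3 * t = c ^+ 2 * U1 by rewrite /c; field.
by rewrite ler_wpM2l//; move: H; rewrite cc; lra.
Qed.

(* The interval is cut into pieces of length less than 1/(2L), on each of which
   the integral is absorbed. *)
Lemma gronwall (L Tmax : R) : 0 < L -> 0 < Tmax -> exists2 C : R, 0 < C &
  forall (T : R) g (alpha : R), 0 <= T <= Tmax -> 0 <= alpha -> {within `[0, T], continuous g} ->
  (forall t, 0 <= t <= T -> 0 <= g t) ->
  (forall t, 0 <= t <= T -> g t <= alpha + L * intg 0 t g) ->
  forall t, 0 <= t <= T -> g t <= C * alpha.
Proof.
move=> L0 Tm0; pose h := (2 * L)^-1.
have h0 : 0 < h by rewrite invr_gt0 mulr_gt0.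
have Lh : L * h = 2^-1 by rewrite /h; field; lra.
clearbody h.
suff ind (j : nat) : exists2 C : R, 0 < C & forall (T : R) g (alpha : R), 0 <= T <= Tmax ->
    T <= j%:R * h -> 0 <= alpha -> {within `[0, T], continuous g} ->
    (forall t, 0 <= t <= T -> 0 <= g t) ->
    (forall t, 0 <= t <= T -> g t <= alpha + L * intg 0 t g) ->
    forall t, 0 <= t <= T -> g t <= C * alpha.
  have [C C0 HC] := ind (Num.truncn (Tmax / h)).+1.
  exists C => // T g alpha TT; apply: HC => //.
  rewrite -ler_pdivrMr//; apply: le_trans (ltW (truncnS_gt _)).
  by have /andP[_ ?] := TT; rewrite ler_pM2r ?invr_gt0.
elim: j => [|j [C C0 IH]].
  exists 1 => // T g alpha /andP[T0 _]; rewrite mul0r => T0' a0 cg g0 gL t /andP[t0 tT].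
  have t00 : t = 0 by lra.
  have tT' : 0 <= t <= T by rewrite t0 tT.
  by have := gL t tT'; rewrite t00 intgaa; lra.
exists (2 * (1 + L * Tmax * C)); first by rewrite mulr_gt0// addr_gt0// !mulr_gt0.
move=> T g alpha /andP[T0 TT] Tj a0 cg g0 gL.
have [x /[!in_itv]/= /andP[x0 xT] xM] := EVT_max T0 cg.
have xT' : 0 <= x <= T by rewrite x0.
suff gx : g x <= 2 * (1 + L * Tmax * C) * alpha.
  by move=> t tT; apply: le_trans gx; apply: xM; rewrite in_itv.
pose y := Num.min x (j%:R * h).
have y0 : 0 <= y by rewrite /y le_min x0 mulr_ge0// ltW.
have yx : y <= x by rewrite /y ge_min lexx.
have yj : y <= j%:R * h by rewrite /y ge_min lexx orbT.
have xy : x - y <= h.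
  rewrite /y minEle; case: ifP => _; first by rewrite subrr ltW.
  by rewrite lerBlDr; apply: le_trans xT _; apply: le_trans Tj _; rewrite -natr1; lra.
have yT : y <= T by exact: le_trans xT.
have bg := bmf_continuous cg.
have gy s : 0 < s < y -> g s <= C * alpha.
  move=> /andP[s0 sy]; apply: (IH y) => //; last by rewrite !ltW.
  + by rewrite y0 (le_trans yT).
  + by apply: continuous_subspaceW cg; apply: subset_itv; rewrite bnd_simp.
  + by move=> t /andP[t0 ty]; apply: g0; rewrite t0 (le_trans ty).
  + by move=> t /andP[t0 ty]; apply: gL; rewrite t0 (le_trans ty).
have I1 : intg 0 y g <= C * alpha * y.
  rewrite -[X in _ * X]subr0 -intg_cst//; apply: (intg_le (lexx 0) yT) => //.
  exact: bmf_cst.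
have I2 : intg y x g <= g x * (x - y).
  rewrite -intg_cst//; apply: (intg_le y0 xT) => //; first exact: bmf_cst.
  move=> s /andP[ys sx]; apply: xM; rewrite in_itv/= (le_trans y0 (ltW ys)).
  by rewrite (le_trans (ltW sx)).
have := gL _ xT'; rewrite (intg_split bg (lexx 0) y0 yx xT) => H.
have gx0 := g0 _ xT'.
have I3 : g x * (x - y) <= g x * h by rewrite ler_wpM2l.
have I4 : C * alpha * y <= C * alpha * Tmax.
  by rewrite ler_wpM2l ?(le_trans yT)// mulr_ge0// ltW.
have : g x <= alpha + L * (C * alpha * Tmax + g x * h).
  apply: le_trans H _; rewrite lerD2l; apply: ler_wpM2l; first exact: ltW.
  by apply: lerD; [exact: le_trans I1 I4|exact: le_trans I2 I3].
rewrite mulrDr [L * (g x * h)]mulrCA Lh; lra.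
Qed.

End Inequalities.

(** * Gagliardo-Nirenberg interpolation *)

Section Interpolation.
Context {R : realType}.
Implicit Types (T a b c t s K A : R) (g h : R -> R) (phi : nat -> R -> R).

Lemma mean_value_intg T a b h : 0 <= a -> a < b -> b <= T ->
  {within `[0, T], continuous h} ->
  exists2 c, a <= c <= b & intg a b h = h c * (b - a).
Proof.
move=> a0 ab bT ch; have bh := bmf_continuous ch.
have ch' : {within `[a, b], continuous h}.
  by apply: continuous_subspaceW ch; apply: subset_itv; rewrite bnd_simp.
have [x xI xM] := EVT_max (ltW ab) ch'.
have [y yI yM] := EVT_min (ltW ab) ch'.
have ba : 0 < b - a by rewrite subr_gt0.
pose v := intg a b h / (b - a).
have vx : v <= h x.
  rewrite ler_pdivrMr// -(intg_cst _ (ltW ab)); apply: (intg_le a0 bT) => //.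
    exact: bmf_cst.
  by move=> s /andP[? ?]; apply: xM; rewrite in_itv/= !ltW.
have vy : h y <= v.
  rewrite ler_pdivlMr// -(intg_cst _ (ltW ab)); apply: (intg_le a0 bT) => //.
    exact: bmf_cst.
  by move=> s /andP[? ?]; apply: yM; rewrite in_itv/= !ltW.
suff [c cI hc] : exists2 c, c \in `[a, b] & h c = v.
  by exists c; [move: cI; rewrite in_itv|rewrite hc /v divfK// gt_eqF].
move: xI yI; rewrite !in_itv/= => /andP[ax xb] /andP[ay yb].
have sub u w : a <= u -> w <= b -> {within `[u, w], continuous h}.
  by move=> ? ?; apply: continuous_subspaceW ch'; apply: subset_itv; rewrite bnd_simp.
have [xy|/ltW yx] := leP x y.
  have [|c cI hc] := IVT xy (sub _ _ ax yb) (v := v).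
    by rewrite ge_min le_max vx vy !orbT.
  exists c => //; move: cI; rewrite !in_itv/= => /andP[xc cy].
  by rewrite (le_trans ax xc) (le_trans cy yb).
have [|c cI hc] := IVT yx (sub _ _ ay xb) (v := v).
  by rewrite ge_min le_max vx vy !orbT.
exists c => //; move: cI; rewrite !in_itv/= => /andP[yc cx].
by rewrite (le_trans ay yc) (le_trans cx xb).
Qed.

(** Indices count derivatives: [phi 0] is the most integrated function and [phi N] the top
    derivative, known only as a bounded function. *)
Definition prim_chain T (N : nat) phi : Prop :=
  forall j, (j < N)%N -> prim T (phi j) (phi j.+1).

(** By induction, [phi j] is small at some point of the first third of [a, b] and at some point of
    the last third. These points are at least (b - a) / 3 apart, so the mean value of [phi j.+1]
    between them is small, and it is attained. *)
Lemma chain_point (N j : nat) : (j < N)%N -> exists2 c : R, 0 < c &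
  forall T phi a b A, prim_chain T N phi -> 0 <= a -> a < b -> b <= T -> 0 <= A ->
  intg a b (fun s => phi 0 s ^+ 2) <= A ^+ 2 * (b - a) ->
  exists2 s, a <= s <= b & `|phi j s| * (b - a) ^+ j <= c * A.
Proof.
elim: j => [N0|j IH jN].
  exists 1 => // T phi a b A chain a0 ab bT A0 intA.
  have cphi := prim_continuous (primM (chain _ N0) (chain _ N0)).
  have [s sI sE] := mean_value_intg a0 ab bT cphi.
  exists s => //; rewrite expr0 mulr1 mul1r -(ger0_norm A0) -ler_sqr ?nnegrE//.
  rewrite -!normrX !ger0_norm ?sqr_ge0// -(ler_pM2r (_ : 0 < b - a)) ?subr_gt0//.
  by apply: le_trans intA; rewrite -[in X in X <= _]sE.
have [c c0 HC] := IH (ltnW jN).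
exists (3 ^+ j.+1 * 4 * c); first by rewrite !mulr_gt0// exprn_gt0.
move=> T phi a b A chain a0 ab bT A0 intA.
pose l := (b - a) / 3; have l0 : 0 < l by rewrite /l; lra.
have bE : b - a = 3 * l by rewrite /l; field.
clearbody l.
have bphi : bmf T (fun s => phi 0 s ^+ 2).
  by apply/bmfX/prim_bmf/(chain 0%N); apply: leq_ltn_trans jN.
have A20 : 0 <= 2 * A by lra.
(* On a third of length l the hypothesis only gives 3 A^2 l, which is at most (2 A)^2 l: the
   induction hypothesis is used with 2 A. *)
have part u w : a <= u -> w <= b -> w - u = l -> exists2 s, u <= s <= w &
    `|phi j s| * l ^+ j <= c * (2 * A).
  move=> au wb wu; rewrite -wu; apply: (HC T) => //; [lra|lra|lra|].
  apply: (@le_trans _ _ (intg a b (fun s => phi 0 s ^+ 2))).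
    by apply: (intg_le_sub bphi a0 au _ wb bT) => [|s _]; [lra|exact: sqr_ge0].
  apply: le_trans intA _; rewrite bE wu; have := sqr_ge0 A; nra.
have [|||s1 /andP[as1 s1l] H1] := part a (a + l); [lra..|].
have [|||s2 /andP[as2 s2l] H2] := part (b - l) b; [lra..|].
have s12 : s1 < s2 by lra.
have [|||s /andP[s1s ss2] sE] := @mean_value_intg T s1 s2 (phi j.+1) _ s12.
- lra.
- lra.
- exact: prim_continuous (chain _ jN).
exists s; first by lra.
move: sE; rewrite -(primB (chain _ (ltnW jN))) ?(ltW s12)//; [|lra|lra].
move=> sE; have {}sE : `|phi j.+1 s| * (s2 - s1) <= `|phi j s1| + `|phi j s2|.
  rewrite -[s2 - s1]gtr0_norm ?subr_gt0// -normrM -sE [leRHS]addrC.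
  exact: ler_normB.
rewrite bE exprMn mulrCA -!mulrA; apply: ler_wpM2l; first exact: exprn_ge0.
rewrite exprS [leLHS]mulrA; apply: (@le_trans _ _ ((`|phi j s1| + `|phi j s2|) * l ^+ j)).
  apply: ler_wpM2r; first by rewrite exprn_ge0// ltW.
  by apply: le_trans sE; apply: ler_wpM2l => //; lra.
rewrite mulrDl; lra.
Qed.

(** Descending induction on the order N - i, starting from the bound K on [phi N]: [phi j] at s
    differs from its value at the point given by [chain_point] by an integral of [phi j.+1], already
    bounded. *)
Lemma chain_sup (N i : nat) : (i <= N)%N -> exists2 c : R, 0 < c &
  forall T phi K a b A, prim_chain T N phi -> 0 <= a -> a < b -> b <= T -> 0 <= A ->
  0 <= K -> (forall s, 0 < s < T -> `|phi N s| <= K) ->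
  intg a b (fun s => phi 0 s ^+ 2) <= A ^+ 2 * (b - a) ->
  forall s, a < s < b -> `|phi (N - i)%N s| * (b - a) ^+ (N - i) <= c * (A + K * (b - a) ^+ N).
Proof.
elim: i => [_|i IH iN].
  exists 1 => // T phi K a b A _ a0 ab bT A0 K0 phiK _ s /andP[sa sb].
  rewrite subn0 mul1r (@le_trans _ _ (K * (b - a) ^+ N))//; last by rewrite lerDr.
  rewrite ler_wpM2r ?exprn_ge0 ?subr_ge0 ?(ltW ab)//; apply: phiK.
  by rewrite (le_lt_trans a0 sa) (lt_le_trans sb bT).
have jN : (N - i.+1 < N)%N by rewrite ltn_subrL (leq_trans _ iN).
have [c c0 HC] := IH (ltnW iN); have [c' c'0 HC'] := chain_point jN.
exists (c + c'); first exact: addr_gt0.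
move=> T phi K a b A chain a0 ab bT A0 K0 phiK intA s sI.
have [s0 s0I H0] := HC' _ _ _ _ _ chain a0 ab bT A0 intA.
have := HC _ _ _ _ _ _ chain a0 ab bT A0 K0 phiK intA.
set j := (N - i.+1)%N in H0 jN *; have -> : (N - i)%N = j.+1 by rewrite /j subnSK.
set B := c * _ => HB; have p := chain _ jN.
have ba : 0 < b - a by rewrite subr_gt0.
have key u w : a <= u -> u <= w -> w <= b ->
    `|phi j w - phi j u| * (b - a) ^+ j <= B.
  move=> au uw wb.
  rewrite (primB p (le_trans a0 au) uw (le_trans wb bT)).
  have -> : B = (B / (b - a) ^+ j.+1 * (b - a)) * (b - a) ^+ j.
    by rewrite -mulrA -exprS divfK// gt_eqF// exprn_gt0.
  rewrite ler_pM2r ?exprn_gt0//.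
  apply: le_trans (intg_bound p.1 (le_trans a0 au) uw (le_trans wb bT) (M := B / (b - a) ^+ j.+1) _) _.
    move=> r /andP[ur rw]; rewrite ler_pdivlMr ?exprn_gt0//; apply: HB.
    by rewrite (le_lt_trans au ur) (lt_le_trans rw wb).
  apply: ler_wpM2l; last by lra.
  apply: divr_ge0; last by rewrite exprn_ge0// ltW.
  by rewrite /B mulr_ge0 ?(ltW c0)// addr_ge0// mulr_ge0// exprn_ge0// ltW.
have {}key : `|phi j s - phi j s0| * (b - a) ^+ j <= B.
  case/andP: sI => sa sb; case/andP: s0I => s0a s0b.
  have [ss|/ltW ss] := leP s0 s; first by apply: key => //; exact: ltW.
  by rewrite distrC; apply: key => //; exact: ltW.
have -> : phi j s = (phi j s - phi j s0) + phi j s0 by rewrite subrK.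
apply: le_trans (ler_wpM2r _ (ler_normD _ _)) _; first by rewrite exprn_ge0// ltW.
rewrite mulrDl mulrDl -/B lerD//; apply: le_trans H0 _.
by rewrite ler_wpM2l ?(ltW c'0)// lerDl mulr_ge0// exprn_ge0// ltW.
Qed.

(* Bisect [a, b] until psi = int phi^2 + rho (b - a) is comparable to
   K^2 (b - a)^(6k + 1), where chain_sup with A = C K (b - a)^(3k) applies; the
   term rho (b - a) makes the bisection stop. *)
Lemma chain_cube_rho (k : nat) : (0 < k)%N -> exists2 C : R, 0 < C &
  forall T phi K (rho l0 : R), prim_chain T (3 * k) phi -> 0 < K ->
  (forall s, 0 < s < T -> `|phi (3 * k)%N s| <= K) ->
  0 < rho -> 0 < l0 -> K ^+ 2 * l0 ^+ (6 * k) <= rho ->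
  forall (n : nat) a b, 0 <= a -> a < b -> b <= T -> b - a <= 2 ^+ n * l0 ->
  let psi := intg a b (fun s => phi 0 s ^+ 2) + rho * (b - a) in
  psi <= 2 ^+ (6 * k).+1 * (K ^+ 2 * (b - a) ^+ (6 * k).+1) ->
  intg a b (fun s => `|phi k s| ^+ 3) <= C * K * psi.
Proof.
have e1 : (3 * k * 2 = 6 * k)%N by lia.
have e2 : (2 * k * 3 = 6 * k)%N by lia.
have e3 : (3 * k - 2 * k = k)%N by lia.
have e4 : (3 * k = 2 * k + k)%N by lia.
move=> k0; have [|c c0 HC] := @chain_sup (3 * k) (2 * k); first by rewrite leq_mul2r orbT.
set M : R := 2 ^+ (6 * k).+1.
have M1 : 1 <= M by rewrite exprn_ege1//; lra.
have ME : M = 2 ^+ (6 * k).+1 by [].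
clearbody M.
exists ((c * (M + 1)) ^+ 3); first by rewrite exprn_gt0// mulr_gt0//; lra.
move=> T phi K rho l0 chain K0 phiK rho0 l00 Kl0.
have K0' := ltW K0.
have bphi : bmf T (fun s => phi 0 s ^+ 2).
  by apply/bmfX/prim_bmf/(chain 0%N); rewrite muln_gt0.
have bphik : bmf T (fun s => `|phi k s| ^+ 3).
  by apply/bmfX/bmf_norm/prim_bmf/(chain k); rewrite ltn_Pmull.
have direct a b : 0 <= a -> a < b -> b <= T ->
  let psi := intg a b (fun s => phi 0 s ^+ 2) + rho * (b - a) in
  psi <= M * (K ^+ 2 * (b - a) ^+ (6 * k).+1) ->
  K ^+ 2 * (b - a) ^+ (6 * k).+1 <= psi ->
  intg a b (fun s => `|phi k s| ^+ 3) <= (c * (M + 1)) ^+ 3 * K * psi.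
  move=> a0 ab bT psi psiM psi_ge.
  have ba : 0 < b - a by rewrite subr_gt0.
  pose l := b - a; rewrite -/l in psiM psi_ge ba.
  have lX m : 0 <= l ^+ m by rewrite exprn_ge0// ltW.
  have A0 : 0 <= M * K * l ^+ (3 * k) by rewrite !mulr_ge0//; lra.
  have intA : intg a b (fun s => phi 0 s ^+ 2) <= (M * K * l ^+ (3 * k)) ^+ 2 * (b - a).
    apply: (@le_trans _ _ psi); first by rewrite lerDl mulr_ge0// ltW.
    apply: le_trans psiM _; rewrite -/l.
    have -> : (M * K * l ^+ (3 * k)) ^+ 2 * l = M ^+ 2 * (K ^+ 2 * l ^+ (6 * k).+1).
      rewrite [l ^+ (6 * k).+1]exprS !exprMn -exprM e1; ring.
    rewrite ler_wpM2r//; first by rewrite mulr_ge0 ?sqr_ge0.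
    by rewrite expr2 ler_peMl//; lra.
  have := HC _ _ _ _ _ _ chain a0 ab bT A0 K0' phiK intA.
  rewrite e3 -/l => Hs; have {}Hs s : a < s < b -> `|phi k s| <= c * (M + 1) * K * l ^+ (2 * k).
    move=> /Hs; have -> : c * (M * K * l ^+ (3 * k) + K * l ^+ (3 * k)) =
        (c * (M + 1) * K * l ^+ (2 * k)) * l ^+ k.
      rewrite e4 exprD; ring.
    by rewrite ler_pM2r// exprn_gt0.
  have B0 : 0 <= c * (M + 1) * K * l ^+ (2 * k) by rewrite !mulr_ge0 ?(ltW c0)//; lra.
  apply: (@le_trans _ _ ((c * (M + 1) * K * l ^+ (2 * k)) ^+ 3 * l)).
    rewrite -(intg_cst _ (ltW ab)); apply: (intg_le a0 bT) => //; first exact: bmf_cst.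
    by move=> s /Hs sB; rewrite lerXn2r ?nnegrE.
  have -> : (c * (M + 1) * K * l ^+ (2 * k)) ^+ 3 * l =
      (c * (M + 1)) ^+ 3 * K * (K ^+ 2 * l ^+ (6 * k).+1).
    rewrite [l ^+ (6 * k).+1]exprS !exprMn -(exprM l) e2.
    ring.
  apply: ler_wpM2l => //; rewrite mulr_ge0// exprn_ge0// mulr_ge0 ?(ltW c0)//; lra.
elim=> [|n IH] a b a0 ab bT ban psi psiM.
  (* On a piece of length at most l0 the term rho (b - a) alone exceeds K^2 (b - a)^(6k + 1), by the
     hypothesis on l0. *)
  apply: direct => //; rewrite /psi (@le_trans _ _ (rho * (b - a)))//; last first.
    by rewrite lerDr; apply: intg_ge0 => s _; exact: sqr_ge0.
  rewrite [_ ^+ (6 * k).+1]exprSr mulrA ler_wpM2r ?subr_ge0 ?(ltW ab)//.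
  apply: le_trans Kl0; rewrite ler_wpM2l ?sqr_ge0// lerXn2r ?nnegrE ?subr_ge0 ?(ltW ab) ?(ltW l00)//.
  by move: ban; rewrite expr0 mul1r.
have [psi_ge|psi_lt] := leP (K ^+ 2 * (b - a) ^+ (6 * k).+1) psi; first exact: direct.
pose c' := (a + b) / 2.
have ac : a < c' by rewrite /c'; lra.
have cb : c' < b by rewrite /c'; lra.
have ca : c' - a = (b - a) / 2 by rewrite /c'; field.
have bc : b - c' = (b - a) / 2 by rewrite /c'; field.
have c'0 : 0 <= c' by lra.
have c'T : c' <= T by lra.
have len : (b - a) / 2 <= 2 ^+ n * l0 by move: ban; rewrite exprS; lra.
(* Origin of the factor 2^(6k + 1): when psi is below K^2 (b - a)^(6k + 1), each half of the
   interval satisfies the hypothesis again, because halving the length divides the right-hand side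
   by exactly this factor. *)
have half : M * (K ^+ 2 * ((b - a) / 2) ^+ (6 * k).+1) = K ^+ 2 * (b - a) ^+ (6 * k).+1.
  rewrite exprMn exprVn -ME mulrCA [M * _]mulrC divfK// gt_eqF//; lra.
have psiE : psi = (intg a c' (fun s => phi 0 s ^+ 2) + rho * (c' - a)) +
                  (intg c' b (fun s => phi 0 s ^+ 2) + rho * (b - c')).
  by rewrite /psi (intg_split bphi a0 (ltW ac) (ltW cb) bT); ring.
have g0 u w : 0 <= intg u w (fun s => phi 0 s ^+ 2).
  by apply: intg_ge0 => s _; exact: sqr_ge0.
have r1 : 0 <= rho * (c' - a) by rewrite mulr_ge0 ?(ltW rho0)//; lra.
have r2 : 0 <= rho * (b - c') by rewrite mulr_ge0 ?(ltW rho0)//; lra.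
rewrite (intg_split bphik a0 (ltW ac) (ltW cb) bT) psiE mulrDr.
have := g0 a c'; have := g0 c' b => G1 G2.
clearbody psi c'; clear HC direct.
apply: lerD; apply: IH => //; rewrite ?ca ?bc// half -?ca -?bc; lra.
Qed.

(** The bound on [phi 0] lets the bisection start at [0, T] itself. It cannot be dropped: for phi 0
    = t^k the top derivative vanishes, K may tend to 0, and the left-hand side does not. The
    auxiliary rho is then sent to 0. *)
Lemma chain_cube (k : nat) : (0 < k)%N -> exists2 C : R, 0 < C &
  forall T phi K, 0 < T -> prim_chain T (3 * k) phi -> 0 < K ->
  (forall s, 0 < s < T -> `|phi (3 * k)%N s| <= K) ->
  (forall s, 0 <= s <= T -> `|phi 0%N s| <= K * T ^+ (3 * k)) ->
  intg 0 T (fun s => `|phi k s| ^+ 3) <= C * K * intg 0 T (fun s => phi 0 s ^+ 2).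
Proof.
have e1 : (3 * k * 2 = 6 * k)%N by lia.
have e2 : (2 * k * 3 = 6 * k)%N by lia.
have e3 : (3 * k - 2 * k = k)%N by lia.
have e4 : (3 * k = 2 * k + k)%N by lia.
move=> k0; have [C C0 HC] := chain_cube_rho k0; exists C => // T phi K T0 chain K0 phiK phi0.
have bphi : bmf T (fun s => phi 0 s ^+ 2).
  by apply/bmfX/prim_bmf/(chain 0%N); rewrite muln_gt0.
apply/ler_addgt0Pl => e e0.
(* The first term makes the contribution C K rho T at most e; the second one gives the starting
   hypothesis on psi over [0, T]. *)
pose rho := Num.min (e / (C * K * T)) (K ^+ 2 * T ^+ (6 * k)).
have rho0 : 0 < rho by rewrite /rho lt_min divr_gt0 ?mulr_gt0 ?exprn_gt0.
have rho1 : rho * (C * K * T) <= e.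
  by rewrite -ler_pdivlMr ?mulr_gt0// /rho ge_min lexx.
have rho2 : rho <= K ^+ 2 * T ^+ (6 * k) by rewrite /rho ge_min lexx orbT.
(* Since 2^n >= n + 1 > K^2 T^(6k) / rho, the length T / 2^n is small enough to serve as l0. *)
pose n := (Num.truncn (K ^+ 2 * T ^+ (6 * k) / rho)).
have nn : (n.+1%:R : R) <= 2 ^+ n.
  elim: n => [|m IHm]; first by rewrite expr0.
  by rewrite exprS -natr1; move: IHm; have : (0 : R) <= m%:R by []; rewrite -natr1; lra.
have p2 : (0 : R) < 2 ^+ n by rewrite exprn_gt0.
have Kl0 : K ^+ 2 * (T / 2 ^+ n) ^+ (6 * k) <= rho.
  rewrite exprMn exprVn mulrA ler_pdivrMr ?exprn_gt0// [rho * _]mulrC -ler_pdivrMr//.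
  apply: (@le_trans _ _ (2 ^+ n)); first exact: le_trans (ltW (truncnS_gt _)) nn.
  rewrite -{1}[2 ^+ n]expr1; apply: ler_weXn2l; first by rewrite exprn_ege1//; lra.
  by rewrite muln_gt0.
have := HC T phi K rho (T / 2 ^+ n) chain K0 phiK rho0 (divr_gt0 T0 p2) Kl0 n 0 T
  (lexx 0) T0 (lexx T).
rewrite subr0 [2 ^+ n * _]mulrC divfK ?gt_eqF// => /(_ (lexx _)) H.
apply: le_trans (H _) _; last first.
  by rewrite mulrDr addrC lerD2r mulrC -mulrA [T * _]mulrC.
have psi0 : intg 0 T (fun s => phi 0 s ^+ 2) <= K ^+ 2 * T ^+ (6 * k).+1.
  rewrite -[T in leRHS]subr0.
  have -> : K ^+ 2 * (T - 0) ^+ (6 * k).+1 = (K * T ^+ (3 * k)) ^+ 2 * (T - 0).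
    rewrite subr0 exprMn -exprM [_ ^+ (6 * k).+1]exprSr e1.
    by rewrite mulrA.
  rewrite -(intg_cst _ (ltW T0)); apply: (intg_le (lexx 0) (lexx T)) => //.
    exact: bmf_cst.
  move=> s /andP[s0 sT]; rewrite -[phi 0%N s ^+ 2]ger0_norm ?sqr_ge0// normrX.
  by rewrite lerXn2r ?nnegrE ?phi0 ?(ltW s0) ?(ltW sT)// mulr_ge0 ?exprn_ge0// ltW.
have psi1 : rho * T <= K ^+ 2 * T ^+ (6 * k).+1.
  by rewrite [_ ^+ (6 * k).+1]exprSr mulrA ler_wpM2r// ltW.
have M2 : 2 <= 2 ^+ (6 * k).+1 :> R.
  by rewrite exprS ler_peMr// exprn_ege1//; lra.
have X0 : 0 <= K ^+ 2 * T ^+ (6 * k).+1 by rewrite mulr_ge0 ?sqr_ge0// exprn_ge0// ltW.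
move: psi0 psi1 X0; set X := K ^+ 2 * _ => psi0 psi1 X0.
apply: (@le_trans _ _ (2 * X)); first by lra.
by rewrite ler_wpM2r.
Qed.
End Interpolation.

(** * Calculus of maps of class C^k *)

Section CkCalculus.
Context {R : realType}.

Lemma Ck_continuous (V W : normedModType R) k (F : V -> W) : Ck k F -> continuous F.
Proof.
by case: k => // k [dF _] x; apply: differentiable_continuous.
Qed.

Lemma CkS (V W : normedModType R) k (F : V -> W) : Ck k.+1 F -> Ck k F.
Proof.
elim: k F => [F|k IH F [dF dF']]; first exact: Ck_continuous.
by split=> // v; apply/IH/dF'.
Qed.

Lemma CkW (V W : normedModType R) k l (F : V -> W) : (l <= k)%N -> Ck k F -> Ck l F.
Proof.
move=> /subnK <-; elim: (k - l)%N => // m IH; rewrite addSn => /CkS; exact: IH.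
Qed.

Lemma Ck_cst (V W : normedModType R) k (w : W) : Ck k (fun _ : V => w).
Proof.
elim: k w => [|k IH] w; first exact: cst_continuous.
split=> [x|v]; first exact: differentiable_cst.
by under [X in Ck k X]eq_fun do rewrite (diff_cst w); exact: IH.
Qed.

Lemma CkD (V W : normedModType R) k (F G : V -> W) :
  Ck k F -> Ck k G -> Ck k (fun x => F x + G x).
Proof.
elim: k F G => [F G cF cG x|k IH F G [dF dF'] [dG dG']].
  by apply: cvgD; [exact: cF|exact: cG].
split=> [x|v]; first exact: differentiableD.
under [X in Ck k X]eq_fun do rewrite (diffD (dF _) (dG _)) /=.
by apply: IH; [exact: dF'|exact: dG'].
Qed.

Lemma Ck_lincomp (V W W' : normedModType R) (L : {linear W -> W'}) k (F : V -> W) :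
  continuous L -> Ck k F -> Ck k (fun x => L (F x)).
Proof.
move=> cL; elim: k F => [F cF x|k IH F [dF dF']].
  by apply: continuous_comp; [exact: cF|exact: cL].
have dL w : differentiable L w by exact: linear_differentiable.
split=> [x|v]; first exact: (differentiable_comp (dF x) (dL _)).
under [X in Ck k X]eq_fun do rewrite (diff_comp (dF _) (dL _)) diff_lin//=.
exact/IH/dF'.
Qed.

(** For an inner map with constant differential L, the derivative of F \o A along v is the
    derivative of F along L v, composed with A: it has the same form and the induction closes. *)
Lemma Ck_compaff (U V W : normedModType R) (A L : U -> V) k (F : V -> W) :
  (forall x, is_diff x A L) -> Ck k F -> Ck k (fun x => F (A x)).
Proof.
move=> dA.
have dA' x : differentiable A x by have := dA x; case.
have dE x : 'd A x = L :> (U -> V) by have := dA x; case.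
have cA : continuous A by move=> x; exact: differentiable_continuous.
elim: k F => [F cF x|k IH F [dF dF']].
  by apply: continuous_comp; [exact: cA|exact: cF].
split=> [x|v]; first exact: (differentiable_comp (dA' x) (dF _)).
under [X in Ck k X]eq_fun do rewrite (diff_comp (dA' _) (dF _)) /= dE.
exact: (IH (fun y => 'd F y (L v)) (dF' (L v))).
Qed.

Lemma CkM (V : normedModType R) k (F G : V -> R) :
  Ck k F -> Ck k G -> Ck k (fun x => F x * G x).
Proof.
elim: k F G => [F G cF cG x|k IH F G CF CG].
  by apply: cvgM; [exact: cF|exact: cG].
have [dF dF'] := CF; have [dG dG'] := CG.
split=> [x|v]; first exact: differentiableM.
under [X in Ck k X]eq_fun do rewrite (diffM (dF _) (dG _)) /=.
apply: (@CkD _ _ _ (fun x => F x * 'd G x v) (fun x => G x * 'd F x v)).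
  exact: (IH F (fun x => 'd G x v) (CkS CF) (dG' v)).
exact: (IH G (fun x => 'd F x v) (CkS CG) (dF' v)).
Qed.

Lemma Ck_sum (V W : normedModType R) k (I : Type) (r : seq I) (F : I -> V -> W) :
  (forall i, Ck k (F i)) -> Ck k (fun x => \sum_(i <- r) F i x).
Proof.
move=> CF; elim: r => [|i r IH].
  under [X in Ck k X]eq_fun do rewrite big_nil; exact: Ck_cst.
by under [X in Ck k X]eq_fun do rewrite big_cons; exact: CkD.
Qed.

Lemma Ck_coord (V : normedModType R) n k (F : V -> 'rV[R]_n) i :
  Ck k F -> Ck k (fun x => F x 0 i).
Proof.
pose L (M : 'rV[R]_n) := M 0 i.
have lL : linear L by move=> a u v; rewrite /L !mxE.
pose LL : {linear 'rV[R]_n -> R} := HB.pack L (GRing.isLinear.Build _ _ _ _ L lL).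
move=> CF; apply: (@Ck_lincomp _ _ _ LL) => //.
exact: coord_continuous.
Qed.

Lemma Ck_scalel (V W : normedModType R) k (F : V -> R) (w : W) :
  Ck k F -> Ck k (fun x => F x *: w).
Proof.
pose L (a : R) := a *: w.
have lL : linear L by move=> a u v; rewrite /L scalerDl -scalerA.
pose LL : {linear R -> W} := HB.pack L (GRing.isLinear.Build _ _ _ _ L lL).
move=> CF; apply: (@Ck_lincomp _ _ _ LL) => // a.
exact: scalel_continuous.
Qed.

Lemma Ck_row (V : normedModType R) n k (F : V -> 'rV[R]_n) :
  (forall i, Ck k (fun x => F x 0 i)) -> Ck k F.
Proof.
move=> CF; have -> : F = fun x => \sum_i F x 0 i *: delta_mx 0 i.
  by apply/funext => x; rewrite -row_sum_delta.
by apply: Ck_sum => i; exact: Ck_scalel.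
Qed.

Lemma Ck_derive1 k (F G : R -> R) :
  (forall x : R, is_derive x (1 : R) F (G x)) -> Ck k G -> Ck k.+1 F.
Proof.
move=> dF CG.
have df x : derivable F x 1 by have [] := dF x.
split=> [x|v]; first exact/derivable1_diffP.
have -> : (fun x => 'd F x v) = (fun x => G x *: v).
  apply/funext => x; rewrite deriv1E// derive1E; have -> := @derive_val _ _ _ _ _ _ _ (dF x).
  by rewrite /GRing.scale/= mulrC.
exact: Ck_scalel.
Qed.

Lemma smooth_derivable (F : R -> R) x : smooth F -> derivable F x 1.
Proof. by move=> /(_ 1%N)[dF _]; apply/derivable1_diffP. Qed.

Lemma smooth_derive (F : R -> R) : smooth F -> smooth (derive1 F).
Proof.
move=> sF k; have [_ /(_ 1)] := sF k.+1.
have -> // : (fun x => 'd F x 1) = derive1 F.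
apply/funext => x; rewrite deriv1E ?scale1r//; exact: smooth_derivable.
Qed.

End CkCalculus.

(** * Weak derivatives and chains of primitives *)

Section Bump.
Context {R : realType}.
Implicit Types (c x e t : R).

Lemma is_derive_quad (F : R -> R) x l (K : R) :
  (forall h, `|F (x + h) - F x - l * h| <= K * h ^+ 2) -> is_derive x (1 : R) F l.
Proof.
move=> FK; have H : h^-1 *: (F (h *: 1 + x) - F x) @[h --> (0 : R)^'] --> l.
  apply/cvgrPdist_le => e e0; near=> h.
  have h0 : h != 0 by near: h; exact: nbhs_dnbhs_neq.
  rewrite /GRing.scale/= mulr1 [h + x]addrC distrC.
  have -> : h^-1 * (F (x + h) - F x) - l = (F (x + h) - F x - l * h) / h by field.
  rewrite normrM normfV ler_pdivrMr ?normr_gt0//.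
  apply: le_trans (FK h) _; rewrite -(real_normK (num_real h)) expr2 mulrA.
  apply: ler_wpM2r => //; apply: (@le_trans _ _ ((`|K| + 1) * `|h|)).
    by apply: ler_wpM2r => //; move: (ler_norm K); lra.
  rewrite mulrC -ler_pdivlMr; last by move: (normr_ge0 K); lra.
  near: h; apply: (@nbhs_dnbhs _ (0 : R)); apply/nbhs_normP; exists (e / (`|K| + 1)) => /=.
    by rewrite divr_gt0//; move: (normr_ge0 K); lra.
  by move=> z; rewrite /= sub0r normrN => /ltW.
by apply: DeriveDef; [exact: cvgP H|exact: cvg_lim H].
Unshelve. all: by end_near. Qed.

(** The factor x^-i is there because differentiating exp(-c/x) produces such factors: the family is
    stable under differentiation, up to linear combinations, and smoothness follows by induction on
    the class. *)
Definition flat (i : nat) (c x : R) : R :=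
  if 0 < x then x ^- i * expR (- (c / x)) else 0.

Lemma flat_ge0 i c x : 0 <= flat i c x.
Proof.
by rewrite /flat; case: ifP => // x0; rewrite mulr_ge0 ?expR_ge0// invr_ge0 exprn_ge0// ltW.
Qed.

(** With y = c / x, the inequality exp(y) >= y^(i+2) / (i+2)! absorbs x^-i and leaves x^2. Vanishing
    to second order at 0 is what makes 0 a point of differentiability. *)
Lemma flat_small i c x : 0 < c ->
  flat i c x <= (i.+2)`!%:R / c ^+ i.+2 * x ^+ 2.
Proof.
move=> c0; have f0 : (0 : R) < (i.+2)`!%:R by rewrite ltr0n fact_gt0.
have ci : 0 < c ^+ i.+2 by rewrite exprn_gt0.
rewrite /flat; case: ifP => [x0|_]; last first.
  by rewrite mulr_ge0 ?sqr_ge0// divr_ge0// ltW.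
have xi n : 0 < x ^+ n by rewrite exprn_gt0.
have cx : 0 <= c / x by rewrite divr_ge0 ?ltW.
have := expR_ge1Dxn i.+1 cx; rewrite expRN; set E := expR _ => HE.
have {}HE : (c / x) ^+ i.+2 / (i.+2)`!%:R <= E by lra.
have q0 : 0 < (c / x) ^+ i.+2 / (i.+2)`!%:R by rewrite divr_gt0// exprn_gt0// divr_gt0.
have : E^-1 <= ((c / x) ^+ i.+2 / (i.+2)`!%:R)^-1 by rewrite lef_pV2 ?posrE ?expR_gt0.
rewrite invfM invrK exprMn exprVn invfM invrK => {}HE.
apply: (@le_trans _ _ (x ^- i * (c ^- i.+2 * x ^+ i.+2 * (i.+2)`!%:R))).
  by apply: ler_wpM2l => //; rewrite invr_ge0 ltW.
rewrite -[in x ^+ i.+2]addn2 exprD le_eqVlt; apply/orP; left; apply/eqP.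
field; rewrite ?gt_eqF// ?exprn_gt0//.
Qed.

Lemma is_derive_flat i c x : 0 < c ->
  is_derive x (1 : R) (flat i c) (c * flat i.+2 c x - i%:R * flat i.+1 c x).
Proof.
move=> c0; have [x0|x0|->] := ltgtP x 0.
- rewrite /flat !ifF ?ltNge ?(ltW x0)// !mulr0 subrr.
  apply: (near_eq_is_derive (f := cst 0)).
    by near=> y; rewrite /= ifF// ltNge; apply/negbTE; rewrite negbK; near: y; exact: lt_le_nbhsl.
- rewrite /flat x0.
  apply: (@near_eq_is_derive R R R (fun y : R => y ^- i * expR (- (c / y)))).
    by near=> y; rewrite ifT//; near: y; exact: lt_nbhsr.
  have xn0 : x != 0 by rewrite gt_eqF.
  have dV := is_deriveV xn0 (is_derive_id x (1 : R)).
  have d1 := is_deriveX i dV.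
  have d2 : is_derive x (1 : R) (fun y => - (c / y)) (c * x ^- 2).
    have := is_deriveZ (- c) dV; rewrite (_ : (- c) \*: _ = (fun y => - (c / y))); last first.
      by apply/funext => y; rewrite /= /GRing.scale/= mulNr.
    by move/is_derive_eq; apply; rewrite /GRing.scale/=; ring.
  have d3 := @is_derive1_comp R expR (fun y : R => - (c / y)) x _ _ (is_derive_expR (- (c / x))) d2.
  have := is_deriveM d1 d3.
  rewrite (_ : _ * _ = (fun y => y ^- i * expR (- (c / y)))); last first.
    by apply/funext => y; rewrite !fctE /= exprVn.
  move/is_derive_eq; apply; rewrite !fctE /GRing.scale/= !exprVn.
  case: i {d1} => [|i]; first by field.
  rewrite [i.+1.-1]/= !exprS.
  have : x ^+ i != 0 by rewrite expf_neq0.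
  move: (x ^+ i) (expR _) (i.+1%:R) => X E I X0; field; by rewrite X0 xn0.
- have -> : c * flat i.+2 c 0 - i%:R * flat i.+1 c 0 = 0.
    by rewrite /flat ltxx !mulr0 subrr.
  apply: (@is_derive_quad _ _ _ ((i.+2)`!%:R / c ^+ i.+2)) => h.
  rewrite add0r mul0r subr0 {2}/flat ltxx subr0 ger0_norm ?flat_ge0//.
  exact: flat_small.
Unshelve. all: by end_near. Qed.

Lemma flat_smooth i c : 0 < c -> smooth (flat i c).
Proof.
move=> c0 k; elim: k i => [|k IH] i.
  by move=> x; apply/differentiable_continuous/derivable1_diffP; have [] := is_derive_flat i x c0.
apply: (Ck_derive1 (fun x => is_derive_flat i x c0)).
apply: CkD; first by apply: CkM; [exact: Ck_cst|exact: IH].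
have -> : (fun x => - (i%:R * flat i.+1 c x)) = (fun x => (- i%:R) * flat i.+1 c x).
  by apply/funext => x; rewrite mulNr.
by apply: CkM; [exact: Ck_cst|exact: IH].
Qed.

(* As c decreases to 0 this tends to the indicator function of ]0, e[. *)
Definition flat_bump (e c t : R) : R := flat 0 c t * flat 0 c (e - t).

Lemma bump_smooth e c : 0 < c -> smooth (flat_bump e c).
Proof.
move=> c0 k; apply: CkM; first exact: flat_smooth.
have D (x : R) : is_diff x (fun t : R => e - t) (fun t : R => - t).
  have H := is_diffB (is_diff_cst (e : R) x) (is_diff_id x).
  have E : (0 : R -> R) - id = (fun t => - t) by apply/funext => y; rewrite !fctE sub0r.
  exact: (is_diff_eq H E).
exact: (@Ck_compaff R R R R _ _ k (flat 0 c) D (flat_smooth 0 c0 k)).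
Qed.

Lemma flat0_le1 c x : 0 < c -> flat 0 c x <= 1.
Proof.
move=> c0; rewrite /flat; case: ifP => // x0.
by rewrite expr0 invr1 mul1r expR_le1 oppr_le0 divr_ge0// ltW.
Qed.

Lemma bump_ge0 e c t : 0 <= flat_bump e c t.
Proof. by rewrite mulr_ge0 ?flat_ge0. Qed.

Lemma bump_le1 e c t : 0 < c -> flat_bump e c t <= 1.
Proof. by move=> c0; rewrite mulr_ile1 ?flat_ge0 ?flat0_le1. Qed.

Lemma bump_out e c t : ~~ (0 < t < e) -> flat_bump e c t = 0.
Proof.
rewrite negb_and /flat_bump /flat => /orP[/negbTE ->|te]; first by rewrite mul0r.
by rewrite subr_gt0 (negbTE te) mulr0.
Qed.

Lemma bump_cvg e t : flat_bump e n.+1%:R^-1 t @[n --> \oo] --> (\1_`]0, e[ t : R).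
Proof.
have fl (x : R) : 0 < x -> flat 0 n.+1%:R^-1 x @[n --> \oo] --> (1 : R).
  move=> x0; rewrite /flat x0.
  have -> : (fun n => x ^- 0 * expR (- (n.+1%:R^-1 / x))) =
            (fun n => expR ((- x^-1) * harmonic n)).
    by apply/funext => n; rewrite expr0 invr1 mul1r mulrC mulNr.
  rewrite -[X in _ --> X]expR0 -(mulr0 (- x^-1)).
  apply: continuous_cvg; first exact: continuous_expR.
  by apply: cvgM; [exact: cvg_cst|exact: cvg_harmonic].
rewrite indicE; have [|] := boolP (t \in _).
  rewrite inE/= in_itv/= => /andP[t0 te]; rewrite -[X in _ --> X]mulr1.
  by apply: cvgM; apply: fl => //; rewrite subr_gt0.
rewrite notin_setE/= in_itv/= => /negP tn.
under eq_cvg do rewrite bump_out//; exact: cvg_cst.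
Qed.
End Bump.

(** * The Du Bois-Reymond lemma *)

Section DuBoisReymond.
Context {R : realType}.
Implicit Types (T a b c e t s : R) (w u v F g phi : R -> R).
Notation mu := (@lebesgue_measure R).

Lemma prim_C1 T F g : (forall x : R, is_derive x (1 : R) F (g x)) -> continuous g ->
  prim T F g.
Proof.
move=> dF cg; have cgw A : {within A, continuous g} by exact: continuous_subspaceT.
have cF : continuous F.
  by move=> x; apply/differentiable_continuous/derivable1_diffP; have [] := dF x.
split; first exact: bmf_continuous.
move=> t /andP[t0 tT]; have [->|tn0] := eqVneq t 0; first by rewrite intgaa addr0.
have tp : 0 < t by rewrite lt_neqAle eq_sym tn0.
have H : (\int[mu]_(x in `[0%R, t]) (g x)%:E)%E = ((F t)%:E - (F 0)%:E)%E.
  apply: continuous_FTC2 => //.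
    split.
    - by move=> x _; have [] := dF x.
    - by apply: cvg_at_right_filter; exact: cF.
    - by apply: cvg_at_left_filter; exact: cF.
  by move=> x _; rewrite derive1E; have -> := @derive_val _ _ _ _ _ _ _ (dF x).
have bg : bmf t g by exact: bmf_continuous.
have ic : mu.-integrable `[0, t] (EFin \o g).
  by apply: continuous_compact_integrable => //; exact: segment_compact.
have sub (b : bool) : [set` Interval (BRight (0 : R)) (BSide b t)] `<=` `[0, t]%classic.
  by apply: subset_itv; rewrite bnd_simp//; case: b; rewrite bnd_simp.
rewrite /intg Rintegral_itv_bndo_bndc; last exact: integrableS ic.
rewrite Rintegral_itv_obnd_cbnd; last exact: integrableS ic.
by rewrite /Rintegral H -EFinB/= addrC subrK.
Qed.

Lemma prim_smooth T F : smooth F -> prim T F (derive1 F).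
Proof.
move=> sF; apply: prim_C1; last exact: Ck_continuous (smooth_derive sF 0%N).
move=> x; apply: DeriveDef; first exact: smooth_derivable.
by rewrite derive1E.
Qed.

Lemma smooth_step e c : 0 < e -> 0 < c -> exists H : R -> R,
  [/\ forall x : R, is_derive x (1 : R) H (flat_bump e c x),
      forall x, x <= 0 -> H x = 0 & forall x, e <= x -> H x = H e].
Proof.
move=> e0 c0; have cb : continuous (flat_bump e c) by exact: Ck_continuous (bump_smooth e c0 0%N).
have ib (a b : R) : mu.-integrable `[a, b] (EFin \o flat_bump e c).
  by apply: continuous_compact_integrable; [exact: segment_compact|exact: continuous_subspaceT].
(* Starting the integral at -1 instead of 0 makes the fundamental theorem of calculus available
   around 0 too. *)
pose H (x : R) := \int[mu]_(s in `[-1, x]) flat_bump e c s.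
have H0 x : x <= 0 -> H x = 0.
  move=> x0; rewrite /H (_ : \int[mu]_(s in _) _ = \int[mu]_(s in `[-1, x]) 0).
    by rewrite Rintegral_cst// mul0r.
  apply: eq_Rintegral => s; rewrite inE/= in_itv/= => /andP[_ sx].
  by rewrite bump_out// negb_and -leNgt (le_trans sx).
exists H; split => //.
- move=> x; have [xm|xm] := leP x (-1).
    rewrite bump_out; last by rewrite negb_and -leNgt (le_trans xm).
    apply: (near_eq_is_derive (f := cst 0)).
    near=> y; rewrite /= H0//; near: y; apply: lt_le_nbhsl; lra.
  have xx : x < x + 1 by rewrite ltrDl.
  have [d1 d2] : derivable H x 1 /\ derive1 H x = flat_bump e c x.
    by apply: (continuous_FTC1 xx (ib _ _) _ (cb x)); rewrite /= lte_fin.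
  apply: DeriveDef; [exact: d1|rewrite -derive1E; exact: d2].
- move=> x ex; have e1 : -1 <= e by lra.
  apply/eqP; rewrite -subr_eq0 /H Rintegral_itvB ?bnd_simp//.
  rewrite (_ : \int[mu]_(s in _) _ = \int[mu]_(s in `]e, x]) 0).
    by rewrite Rintegral_cst// mul0r.
  apply: eq_Rintegral => s; rewrite inE/= in_itv/= => /andP[es _].
  by rewrite bump_out// negb_and orbC -leNgt ltW.
Unshelve. all: by end_near. Qed.

Lemma test_function_derive T phi : test_function T phi -> test_function T (derive1 phi).
Proof.
move=> [sphi [a [b [a0 bT ab]]]]; split; first exact: smooth_derive.
exists a, b; split=> // t tab; rewrite derive1E.
have E : \forall y \near t, cst 0 y = phi y.
  have : t < a \/ b < t.
    by move: tab; rewrite in_itv/= negb_and -!ltNge => /orP.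
  move=> [ta|bt]; near=> y; rewrite /= ab// in_itv/= negb_and -!ltNge.
    by apply/orP; left; near: y; exact: lt_nbhsl.
  by apply/orP; right; near: y; exact: lt_nbhsr.
rewrite -(near_eq_derive _ E) ?oner_neq0//.
exact: derive_cst.
Unshelve. all: by end_near. Qed.

Lemma test_function_ends T phi : 0 < T -> test_function T phi -> phi 0 = 0 /\ phi T = 0.
Proof.
move=> T0 [_ [a [b [a0 bT ab]]]].
by split; apply: ab; rewrite in_itv/= negb_and -!ltNge ?a0 ?bT ?orbT.
Qed.

Lemma bump_test T e c a : 0 < e -> 0 < c -> 0 < a -> a + e < T ->
  test_function T (fun t => flat_bump e c (t - a)).
Proof.
move=> e0 c0 a0 aT; split.
  move=> k; have D (x : R) : is_diff x (fun t : R => t - a) (fun t : R => t).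
    have H := is_diffB (is_diff_id x) (is_diff_cst (a : R) x).
    have E : id - (0 : R -> R) = (fun t => t) by apply/funext => y; rewrite !fctE subr0.
    exact: (is_diff_eq H E).
  exact: (@Ck_compaff R R R R _ _ k (flat_bump e c) D (bump_smooth e c0 k)).
exists a, (a + e); split=> // t.
rewrite in_itv/= negb_and -!ltNge => ta; apply: bump_out.
by rewrite negb_and -!leNgt subr_le0 lerBrDr [e + a]addrC; case/orP: ta => /ltW ->; rewrite ?orbT.
Qed.

(** The difference of two translates of the same smooth step vanishes on both sides, hence is a test
    function. Testing against its derivative compares the means of a function over two intervals of
    the same length. *)
Lemma step_test T e c a b : 0 < e -> 0 < c -> 0 < a -> a + e < T -> 0 < b -> b + e < T ->
  exists2 phi, test_function T phi &
    derive1 phi = (fun t => flat_bump e c (t - a) - flat_bump e c (t - b)).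
Proof.
move=> e0 c0 a0 aT b0 bT; have [H [dH H0 He]] := smooth_step e0 c0.
have dHs x d : is_derive x (1 : R) (fun t => H (t - d)) (flat_bump e c (x - d)).
  have D : is_derive x (1 : R) (fun t : R => t - d) 1.
    have D := is_deriveB (is_derive_id x (1 : R)) (is_derive_cst (d : R) x (1 : R)).
    by apply: (is_derive_eq D); rewrite subr0.
  have := @is_derive1_comp R H (fun t : R => t - d) x _ _ (dH (x - d)) D.
  by rewrite mulr1.
pose phi t := H (t - a) - H (t - b).
have dphi x : is_derive x (1 : R) phi (flat_bump e c (x - a) - flat_bump e c (x - b)).
  exact: is_deriveB.
exists phi.
  split.
    move=> k; apply: CkS; apply: (Ck_derive1 dphi).
    have [sa _] := bump_test e0 c0 a0 aT; have [sb _] := bump_test e0 c0 b0 bT.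
    apply: CkD; first exact: sa.
    have -> : (fun t => - flat_bump e c (t - b)) = (fun t => (- 1) * flat_bump e c (t - b)).
      by apply/funext => t; rewrite mulN1r.
    by apply: CkM; [exact: Ck_cst|exact: sb].
  exists (Num.min a b), (Num.max a b + e); split.
  - by rewrite lt_min a0.
  - by rewrite -ltrBrDr gt_max !ltrBrDr aT.
  move=> t; rewrite in_itv/= negb_and -!ltNge => /orP[].
    by rewrite lt_min => /andP[ta tb]; rewrite /phi !H0 ?subr0// subr_le0 ltW.
  rewrite -ltrBrDr gt_max => /andP[ta tb].
  by rewrite /phi [H (t - a)]He ?[H (t - b)]He ?subrr//; lra.
by apply/funext => t; rewrite derive1E; have -> := @derive_val _ _ _ _ _ _ _ (dphi t).
Qed.

Lemma bmf_smooth T phi : smooth phi -> bmf T phi.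
Proof.
move=> sp; apply/bmf_continuous/continuous_subspaceT; exact: Ck_continuous (sp 0%N).
Qed.

Lemma intg_eq0 (a b : R) g : (forall s, a < s < b -> g s = 0) -> intg a b g = 0.
Proof.
move=> g0; transitivity (intg a b (fun=> 0)); first exact: intg_eq.
by rewrite /intg Rintegral_cst// mul0r.
Qed.

(** Dominated convergence, the bumps being at most 1: integrals over intervals are limits of
    integrals against test functions. *)
Lemma bump_limit T w e a : 0 < e -> 0 < a -> a + e < T -> bmf T w ->
  intg 0 T (fun t => w t * flat_bump e n.+1%:R^-1 (t - a)) @[n --> \oo] --> intg a (a + e) w.
Proof.
move=> e0 a0 aT bw; have [mw [M wM]] := bw.
have T0 : 0 < T by lra.
have n0 (n : nat) : (0 : R) < n.+1%:R^-1 by rewrite invr_gt0 ltr0n.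
have bb n : bmf T (fun t => flat_bump e n.+1%:R^-1 (t - a)).
  by apply: bmf_smooth; have [] := bump_test e0 (n0 n) a0 aT.
pose f t : R := w t * \1_`]a, (a + e)[ t.
have bf : bmf T f.
  split; first by apply: measurable_funM => //; apply: measurable_indic; exact: measurable_itv.
  exists `|M| => t tT; rewrite normrM -[leRHS]mulr1; apply: ler_pM => //.
    by apply: le_trans (ler_norm M); exact: wM.
  by rewrite indicE; case: (_ \in _); rewrite ?normr0 ?normr1.
have fE : intg 0 T f = intg a (a + e) w.
  have ae : a <= a + e by lra.
  rewrite (intg_split bf (lexx 0) (ltW a0) _ (lexx T)); last lra.
  rewrite (intg_split bf (ltW a0) ae (ltW aT) (lexx T)).
  have -> : intg 0 a f = 0.
    apply: intg_eq0 => s /andP[_ sa].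
    by rewrite /f indicE memNset ?mulr0//= in_itv/= ltNge (ltW sa).
  have -> : intg (a + e) T f = 0.
    apply: intg_eq0 => s /andP[sa _].
    by rewrite /f indicE memNset ?mulr0//= in_itv/= [X in _ && X]ltNge (ltW sa) andbF.
  rewrite add0r addr0; apply: intg_eq => s sae.
  by rewrite /f indicE mem_set ?mulr1//= in_itv.
have itvT : mu `]0, T[%classic = T%:E.
  by rewrite /= lebesgue_measure_itv/= lte_fin T0 -EFinB subr0.
have [||||| _ _ H] := @dominated_convergence _ _ _ mu `]0, T[%classic (measurable_itv _)
  (fun n t => (w t * flat_bump e n.+1%:R^-1 (t - a))%:E) (EFin \o f) (cst `|M|%:E).
- by move=> n; apply/measurable_EFinP; exact: (bmfM bw (bb n)).1.
- by apply/measurable_EFinP; exact: bf.1.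
- apply: aeW => t tT; apply: cvg_EFin; first by apply: nearW.
  apply: cvgM; first exact: cvg_cst.
  have := @bump_cvg R e (t - a).
  rewrite !indicE (_ : (t - a \in `]0, e[%classic) = (t \in `]a, (a + e)[%classic))//.
  by apply/idP/idP; rewrite !inE/= !in_itv/= => /andP[? ?]; apply/andP; split; lra.
- exact: (bmf_integrable (bmf_cst T `|M|) (lexx 0) (lexx T)).
- apply: aeW => t n; rewrite /= in_itv/= => tT; rewrite lee_fin normrM -[leRHS]mulr1.
  apply: ler_pM => //; first by apply: le_trans (ler_norm M); exact: wM.
  by rewrite ger0_norm ?bump_ge0 ?bump_le1.
rewrite -fE; apply: (@fine_cvg R).
have -> : (intg 0 T f)%:E = (\int[mu]_(x in `]0%R, T[) (EFin \o f) x)%E.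
  by rewrite fineK//; apply: integrable_fin_num => //; exact: (bmf_integrable bf).
exact: H.
Qed.

Lemma aeS (P Q : R -> Prop) : (forall x, P x -> Q x) ->
  {ae mu, forall x, P x} -> {ae mu, forall x, Q x}.
Proof.
move=> PQ [N [mN N0 NP]]; exists N; split=> // x nQ; apply: NP => /PQ; exact: nQ.
Qed.

Lemma aeI (P Q : R -> Prop) : {ae mu, forall x, P x} -> {ae mu, forall x, Q x} ->
  {ae mu, forall x, P x /\ Q x}.
Proof.
move=> nP nQ; have := negligibleU nP nQ.
by apply: negligibleS => x /= /not_andP.
Qed.

Lemma ae_itv_exists T a b (P : R -> Prop) : 0 <= a -> a < b -> b <= T ->
  {ae mu, forall t, t \in `]0, T[ -> P t} -> exists2 t, a < t < b & P t.
Proof.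
move=> a0 ab bT [N [mN N0 NP]]; apply: contrapT => nex.
have sub : `]a, b[%classic `<=` N.
  move=> t /=; rewrite in_itv/= => tab; apply: NP => /= H; apply: nex; exists t => //.
  by apply: H; case/andP: tab => ? ?; rewrite in_itv/=; apply/andP; split; lra.
have : (mu `]a, b[%classic <= mu N)%E by apply: le_measure => //; rewrite inE//; exact: measurable_itv.
by rewrite N0 /= lebesgue_measure_itv/= lte_fin ab -EFinB lee_fin; lra.
Qed.

(* F' = w almost everywhere for a primitive F of w, and the increments of F
   do not depend on the base point. *)
Lemma ae_cst_translation T w : 0 < T -> bmf T w ->
  (forall a b e, 0 < e -> 0 < a -> a + e < T -> 0 < b -> b + e < T ->
    intg a (a + e) w = intg b (b + e) w) ->
  exists c, {ae mu, forall t, t \in `]0, T[ -> w t = c}.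
Proof.
move=> T0 bw wab; have [mw _] := bw.
pose f := w \_ `]0, T[.
have itf : mu.-integrable [set: R] (EFin \o f).
  by rewrite /f -restrict_EFin; apply/integrable_restrict => //=; rewrite setTI; exact: (bmf_integrable bw).
have locf : locally_integrable [set: R] f by apply: integrable_locally => //; exact: (bmf_integrable bw).
have ity y : mu.-integrable [set` Interval (BLeft 0) (BRight y)] (EFin \o f).
  exact: integrableS itf.
have /= H := FTC1 ity locf.
pose F (x : R) := \int[mu]_(t in `[0, x]) f t; rewrite -/F in H.
have FE x : 0 <= x <= T -> F x = intg 0 x w.
  move=> /andP[x0 xT]; rewrite /F -Rintegral_itv_obnd_cbnd; last exact: integrableS itf.
  rewrite -Rintegral_itv_bndo_bndc; last exact: integrableS itf.
  apply: eq_Rintegral => s; rewrite inE/= in_itv/= => /andP[s0 sx].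
  by rewrite /f patchE mem_set//= in_itv/= s0 (lt_le_trans sx).
have good : {ae mu, forall t, t \in `]0, T[ -> derivable F t 1 /\ derive1 F t = w t}.
  apply: aeS H => t Ht tT; have /andP[t0 _] : 0 < t < T by move: tT; rewrite in_itv.
  have [|dt ->] := Ht; first by rewrite lte_fin.
  by split=> //; rewrite /f patchE mem_set.
have approx t : 0 < t < T -> derivable F t 1 -> forall eps, 0 < eps ->
    exists2 r : R, 0 < r & forall h, 0 < h < r -> t + h < T ->
      `|derive1 F t - h^-1 * intg t (t + h) w| <= eps.
  move=> /andP[t0 tT] dF eps eps0; rewrite derive1E.
  have /cvgrPdist_le/(_ _ eps0) : h^-1 *: (F (h *: 1 + t) - F t) @[h --> (0 : R)^'] --> 'D_1 F t.
    exact: dF.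
  move=> [r /= r0 Hr]; exists r => // h /andP[h0 hr] thT.
  have := Hr h; rewrite /= sub0r normrN gtr0_norm// => /(_ hr).
  rewrite gt_eqF// => /(_ isT); rewrite /GRing.scale/= mulr1 [h + t]addrC.
  rewrite !FE; last 2 first.
  - by rewrite !ltW.
  - by apply/andP; split; lra.
  have th : t <= t + h by lra.
  by rewrite (intg_split bw (lexx 0) (ltW t0) th (ltW thT)) addrAC subrr add0r.
clear H FE ity locf itf; clearbody F; clear f mw.
have [t0 t0I [d0 D0]] := ae_itv_exists (lexx 0) T0 (lexx T) good.
exists (w t0); apply: aeS good => t Ht tT; have [dt Dt] := Ht tT.
have tI : 0 < t < T by move: tT; rewrite in_itv.
clear Ht.
apply/eqP; rewrite -subr_eq0 -normr_eq0 eq_le normr_ge0 andbT.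
apply/ler_addgt0Pl => eps eps0; rewrite addr0.
have eps2 : 0 < eps / 2 by lra.
have [r r0 Hr] := approx t tI dt _ eps2.
have [r' r'0 Hr'] := approx t0 t0I d0 _ eps2.
case/andP: tI => tp tlt; case/andP: t0I => t0p t0lt.
pose h := Num.min (Num.min r r') (Num.min (T - t) (T - t0)) / 2.
have m0 : 0 < Num.min (Num.min r r') (Num.min (T - t) (T - t0)).
  by rewrite !lt_min r0 r'0 !subr_gt0 tlt t0lt.
have hm : h < Num.min (Num.min r r') (Num.min (T - t) (T - t0)) by rewrite /h; lra.
have h0 : 0 < h by rewrite /h; lra.
move: hm; rewrite !lt_min => /andP[/andP[hr hr'] /andP[hT hT']].
have a1 : t + h < T by lra.
have a2 : t0 + h < T by lra.
have := Hr h; rewrite h0 hr Dt => /(_ isT a1) B1.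
have := Hr' h; rewrite h0 hr' D0 -(wab t t0 h)// => /(_ isT a2) B2.
have -> : w t - w t0 = (w t - h^-1 * intg t (t + h) w) - (w t0 - h^-1 * intg t (t + h) w) by ring.
by apply: le_trans (ler_normB _ _) _; lra.
Qed.

Lemma ae_intg_eq T g w (a b : R) : bmf T g -> bmf T w -> 0 <= a -> b <= T ->
  {ae mu, forall t, t \in `]0, T[ -> g t = w t} -> intg a b g = intg a b w.
Proof.
move=> bg bw a0 bT gw; rewrite /intg /Rintegral; congr fine.
have sub : `]a, b[%classic `<=` `]0, T[%classic.
  by move=> t /=; rewrite !in_itv/= => /andP[? ?]; apply/andP; split; lra.
apply: ae_eq_integral => //.
- by apply/measurable_EFinP; exact: measurable_funS sub bg.1.
- by apply/measurable_EFinP; exact: measurable_funS sub bw.1.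
apply: aeS gw => t gwt tab; congr EFin; apply: gwt.
by have := sub _ tab.
Qed.

(** Bumps show that the integral of w over every interval ]a, a + e[ with 0 < a and a + e < T
    vanishes; w is then almost everywhere a constant by [ae_cst_translation], and the integral of
    this constant is 0. *)
Lemma ae_eq0_test T w : 0 < T -> bmf T w ->
  (forall phi, test_function T phi -> intg 0 T (fun t => w t * phi t) = 0) ->
  {ae mu, forall t, t \in `]0, T[ -> w t = 0}.
Proof.
move=> T0 bw H.
have I0 a e : 0 < e -> 0 < a -> a + e < T -> intg a (a + e) w = 0.
  move=> e0 a0 aT; have := bump_limit e0 a0 aT bw.
  have -> : (fun n : nat => intg 0 T (fun t => w t * flat_bump e n.+1%:R^-1 (t - a))) = (fun=> 0).
    apply/funext => n; apply: H; apply: bump_test => //; by rewrite invr_gt0 ltr0n.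
  by move=> L; exact: (cvg_unique (@Rhausdorff R) L (cvg_cst _)).
have [a b e e0 a0 aT b0 bT|c Hc] := ae_cst_translation T0 bw.
  by rewrite !I0.
suff c0 : c = 0 by rewrite c0 in Hc.
have T3 : 0 < T / 3 by lra.
have := I0 (T / 3) (T / 3) T3 T3; rewrite (ae_intg_eq bw (bmf_cst T c) _ _ Hc); [|lra|lra].
rewrite intg_cst; last lra.
have -> : T / 3 + T / 3 - T / 3 = T / 3 by ring.
move=> E; have {E}/eqP : c * (T / 3) = 0 by apply: E; lra.
by rewrite mulf_eq0 => /orP[/eqP//|/eqP]; lra.
Qed.

(** The difference of two bumps of the same width is the derivative of a test function, so in the
    limit the integral of w over an interval depends only on the length. *)
Lemma ae_cst_test T w : 0 < T -> bmf T w ->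
  (forall phi, test_function T phi -> intg 0 T (fun t => w t * derive1 phi t) = 0) ->
  exists c, {ae mu, forall t, t \in `]0, T[ -> w t = c}.
Proof.
move=> T0 bw H; apply: ae_cst_translation => // a b e e0 a0 aT b0 bT.
have L1 := bump_limit e0 a0 aT bw; have L2 := bump_limit e0 b0 bT bw.
suff E : (fun n : nat => intg 0 T (fun t => w t * flat_bump e n.+1%:R^-1 (t - a))) =
         (fun n : nat => intg 0 T (fun t => w t * flat_bump e n.+1%:R^-1 (t - b))).
  by rewrite E in L1; exact: (cvg_unique (@Rhausdorff R) L1 L2).
apply/funext => n; have n0 : (0 : R) < n.+1%:R^-1 by rewrite invr_gt0 ltr0n.
have [phi tphi dphi] := step_test e0 n0 a0 aT b0 bT.
have [sa _] := bump_test e0 n0 a0 aT; have [sb _] := bump_test e0 n0 b0 bT.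
apply/eqP; rewrite -subr_eq0 -(intgB (lexx 0) (lexx T)); [|exact: bmfM (bmf_smooth _ sa)|exact: bmfM (bmf_smooth _ sb)].
apply/eqP; rewrite -[RHS](H _ tphi) dphi; congr intg; apply/funext => t; ring.
Qed.

(* If v is the weak derivative of u, then u - int v is orthogonal to all
   derivatives of test functions. *)
Lemma weak_derivative_prim T u v : 0 < T -> bmf T u -> bmf T v ->
  (forall phi, test_function T phi ->
    intg 0 T (fun t => u t * derive1 phi t) = - intg 0 T (fun t => v t * phi t)) ->
  exists c, {ae mu, forall t, t \in `]0, T[ -> u t = c + intg 0 t v}.
Proof.
move=> T0 bu bv H; pose F t := intg 0 t v.
have pF : prim T F v by apply: prim0 => //; exact: ltW.
have bF := prim_bmf pF.
have [phi tphi|c Hc] := @ae_cst_test T (fun t => u t - F t) T0 (bmfB bu bF).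
  have [sphi _] := tphi; have pphi := prim_smooth T sphi.
  have [phi0 phiT] := test_function_ends T0 tphi.
  have bphi := prim_bmf pphi; have bdphi := pphi.1.
  have := (primM pF pphi).2 T; rewrite (ltW T0) lexx => /(_ isT).
  rewrite phi0 phiT !mulr0 add0r (intgD (lexx 0) (lexx T)); [|exact: bmfM..].
  have -> : (fun t => (u t - F t) * derive1 phi t) =
    (fun t => u t * derive1 phi t - F t * derive1 phi t) by apply/funext => t; ring.
  rewrite (intgB (lexx 0) (lexx T)); [|exact: bmfM|exact: bmfM].
  by rewrite H// => E; lra.
by exists c; apply: aeS Hc => t Ht /Ht; rewrite -/(F t) => <-; rewrite subrK.
Qed.

Lemma ae_continuous_eq0 T g : 0 < T -> {within `[0, T], continuous g} ->
  {ae mu, forall t, t \in `]0, T[ -> g t = 0} -> forall t, 0 <= t <= T -> g t = 0.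
Proof.
move=> T0 cg g0 t tT; apply/eqP; rewrite -normr_eq0 eq_le normr_ge0 andbT.
apply/ler_addgt0Pl => e e0; rewrite addr0.
have /subspace_continuousP/(_ t) := cg.
rewrite /= in_itv/= => /(_ tT)/cvgrPdist_le/(_ _ e0).
move=> [r /= r0 Hr].
case/andP: tT => t0 tT.
pose a := Num.max 0 (t - r); pose b := Num.min T (t + r).
have ab : a < b by rewrite /a /b gt_max !lt_min; apply/andP; split; apply/andP; split; lra.
have a0 : 0 <= a by rewrite /a le_max lexx.
have ar : t - r <= a by rewrite /a le_max lexx orbT.
have bT : b <= T by rewrite /b ge_min lexx.
have br : b <= t + r by rewrite /b ge_min lexx orbT.
have [s /andP[sa sb] gs] := ae_itv_exists a0 ab bT g0.
have sr : `|t - s| < r by rewrite ltr_norml; apply/andP; split; lra.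
have sT : s \in `[0, T] by rewrite in_itv/=; apply/andP; split; lra.
by have /(_ sT) := Hr s sr; rewrite /from_subspace gs subr0.
Qed.

End DuBoisReymond.

(** * Continuous representatives of Sobolev functions *)

Section SobolevChain.
Context {R : realType}.
Implicit Types (T a b c t s eta : R) (w u v F g phi : R -> R).
Notation mu := (@lebesgue_measure R).

Lemma Lpnorm_oo_ae T u eta : (Lpnorm +oo T u <= eta%:E)%E ->
  {ae mu, forall t, t \in `]0, T[ -> `|u t| <= eta}.
Proof.
rewrite /Lpnorm unlock /=.
(* The norm of exponent +oo is the essential supremum only when the whole space has positive
   measure. *)
have -> : (0 < mu [set: R])%E.
  apply: (@lt_le_trans _ _ (mu `]0, 1[%classic)).
    by rewrite /= lebesgue_measure_itv/= lte_fin ltr01 -EFinB subr0 lte_fin.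
  by apply: le_measure; rewrite ?inE//; exact: measurable_itv.
move=> /ess_sup_inf.ess_supP; apply: aeS => t + tT.
by rewrite /= patchE mem_set// lee_fin.
Qed.

Lemma Lpnorm_ge0 p T u : (0 <= Lpnorm p T u)%E.
Proof. exact: Lnorm_ge0. Qed.

(** Truncation to [-eta, eta] changes u on a null set only and gives a representative bounded
    everywhere, as [bmf] requires. *)
Lemma clamp_exists T u eta : measurable_fun `]0, T[ u ->
  (Lpnorm +oo T u <= eta%:E)%E -> exists u',
  [/\ bmf T u', forall s, `|u' s| <= eta &
      {ae mu, forall t, t \in `]0, T[ -> u t = u' t}].
Proof.
move=> mu_ ule; have eta0 : 0 <= eta.
  by rewrite -lee_fin; apply: le_trans ule; exact: Lpnorm_ge0.
pose u' s := Num.max (- eta) (Num.min eta (u s)).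
have u'le s : `|u' s| <= eta.
  by rewrite ler_norml /u' le_max lexx/= ge_max ge_min lexx andbT; lra.
exists u'; split=> //.
  split; last by exists eta => s _.
  apply: measurable_maxr => //; exact: measurable_minr.
apply: aeS (Lpnorm_oo_ae ule) => t Ht /Ht; rewrite ler_norml => /andP[u1 u2].
by rewrite /u' (min_idPr u2) (max_idPr u1).
Qed.

Lemma Linfty_bound T u : Linfty T u -> exists eta : R, (Lpnorm +oo T u <= eta%:E)%E.
Proof.
move=> [_ ufin]; exists (fine (Lpnorm +oo T u)); rewrite fineK//.
by rewrite ge0_fin_numE// Lpnorm_ge0.
Qed.

Lemma ae_Rintegral_eq T (g w : R -> R) :
  measurable_fun `]0, T[ g -> measurable_fun `]0, T[ w ->
  {ae mu, forall t, t \in `]0, T[ -> g t = w t} ->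
  \int[mu]_(t in `]0, T[) g t = intg 0 T w.
Proof.
move=> mg mw gw; rewrite /intg /Rintegral; congr fine.
apply: ae_eq_integral => //; [exact/measurable_EFinP|exact/measurable_EFinP|].
by apply: aeS gw => t gwt tab; congr EFin; apply: gwt.
Qed.

Lemma weak_derivativeP m T u j : Sobolev m T u -> (j <= m)%N ->
  Linfty T (weak_derivative T j u) /\ is_weak_derivative T j u (weak_derivative T j u).
Proof.
move=> [_ H] jm; have [v v1 v2] := H j jm.
by apply: (@getPex _ [set v | Linfty T v /\ is_weak_derivative T j u v]); exists v.
Qed.

Lemma Sobolev_norm_ge m T u j eta : (j <= m)%N -> (Sobolev_norm m T u <= eta%:E)%E ->
  (Lpnorm +oo T (weak_derivative T j u) <= eta%:E)%E.
Proof.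
move=> jm; apply: le_trans; rewrite /Sobolev_norm.
have jm' : (j < m.+1)%N by [].
rewrite (bigD1 (Ordinal jm'))//= leeDl// sume_ge0// => i _; exact: Lpnorm_ge0.
Qed.

(** Every weak derivative is first clamped. Below order m, each one is almost everywhere a constant
    plus the primitive of the next one, and these primitives form the chain; at order m the clamped
    function itself is kept. *)
Lemma sobolev_chain m T u eta : 0 < T -> (0 < m)%N -> Sobolev m T u ->
  (Sobolev_norm m T u <= eta%:E)%E -> exists g : nat -> R -> R,
  [/\ prim_chain T m g, forall s, `|g m s| <= eta,
      {ae mu, forall t, t \in `]0, T[ -> u t = g 0%N t},
      forall j, (j <= m)%N ->
        {ae mu, forall t, t \in `]0, T[ -> g j t = weak_derivative T j u t} &
      forall s, 0 <= s <= T -> `|g 0%N s| <= eta].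
Proof.
move=> T0 m0 uS ueta; set wd := fun j => weak_derivative T j u.
have [[mu_ ufin] _] := uS.
have /choice[v' Hv'] : forall j, exists v', (j <= m)%N ->
  [/\ bmf T v', forall s, `|v' s| <= eta &
      {ae mu, forall t, t \in `]0, T[ -> wd j t = v' t}].
  move=> j; have [jm|jm] := boolP (j <= m)%N; last by exists u.
  have [[mj _] _] := weak_derivativeP uS jm.
  by have [v' ?] := clamp_exists mj (Sobolev_norm_ge jm ueta); exists v'.
have weak j phi : (j <= m)%N -> test_function T phi ->
    \int[mu]_(t in `]0, T[) (u t * derive1n j phi t) =
    (-1) ^+ j * intg 0 T (fun t => v' j t * phi t).
  move=> jm tphi; have [[mj _] ->//] := weak_derivativeP uS jm.
  have [bv _ av] := Hv' j jm; have bphi := bmf_smooth T tphi.1.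
  congr (_ * _); apply: ae_Rintegral_eq.
  - by apply: measurable_funM => //; exact: bphi.1.
  - exact: (bmfM bv bphi).1.
  - by apply: aeS av => t Ht /Ht; rewrite /wd => ->.
(* The identity of order j tested on phi' and that of order j + 1 tested on phi show that [v' j.+1]
   is the weak derivative of [v' j]. *)
have weak1 j : (j < m)%N -> exists c,
    {ae mu, forall t, t \in `]0, T[ -> v' j t = c + intg 0 t (v' j.+1)}.
  move=> jm; have [bv _ _] := Hv' j (ltnW jm); have [bv1 _ _] := Hv' j.+1 jm.
  apply: weak_derivative_prim => // phi tphi.
  have := weak j _ (ltnW jm) (test_function_derive tphi).
  rewrite -derive1Sn (weak j.+1 _ jm tphi) exprS -mulrA mulN1r.
  by move=> /eqP; rewrite -mulrN (inj_eq (mulfI _)) ?signr_eq0// => /eqP ->.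
have /choice[c Hc] : forall j, exists c, (j < m)%N ->
    {ae mu, forall t, t \in `]0, T[ -> v' j t = c + intg 0 t (v' j.+1)}.
  by move=> j; have [/weak1[c ?]|?] := boolP (j < m)%N; [exists c|exists 0].
pose g j t := if (j < m)%N then c j + intg 0 t (v' j.+1) else v' j t.
have gv j : (j <= m)%N -> {ae mu, forall t, t \in `]0, T[ -> v' j t = g j t}.
  move=> jm; rewrite /g; have [/Hc//|_] := boolP (j < m)%N.
  by apply: aeW.
have pg : prim_chain T m g.
  move=> j jm; have [bv1 _ _] := Hv' j.+1 jm.
  have pv := primD (prim_cst T (c j)) (prim0 (ltW T0) bv1).
  have bg1 : bmf T (g j.+1).
    rewrite /g; case: (boolP (j.+1 < m)%N) => // jm1.
    have [bv2 _ _] := Hv' j.+2 jm1.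
    exact: prim_bmf (primD (prim_cst T (c j.+1)) (prim0 (ltW T0) bv2)).
  split=> // t /andP[t0 tT]; rewrite {1 2}/g jm intgaa addr0; congr (_ + _).
  exact: (ae_intg_eq bv1 bg1 (lexx 0) tT (gv _ jm)).
exists g; split=> //.
- by move=> s; rewrite /g ltnn; have [_ -> _] := Hv' m (leqnn m).
(* [weak_derivative T 0 u] is a choice among the bounded functions weakly equal to u, so that its
   almost everywhere equality with u has to be established by testing. *)
- have [eta' Heta'] := Linfty_bound uS.1.
  have [u' [bu' _ uu']] := clamp_exists mu_ Heta'.
  have [bv0 _ _] := Hv' 0%N (leq0n m).
  have H : {ae mu, forall t, t \in `]0, T[ -> u' t - v' 0%N t = 0}.
    apply: ae_eq0_test => //; first exact: bmfB.
    move=> phi tphi; have bphi := bmf_smooth T tphi.1.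
    have := weak 0%N _ (leq0n m) tphi; rewrite expr0 mul1r derive1n0.
    rewrite (@ae_Rintegral_eq _ _ (fun t => u' t * phi t)); last 3 first.
    + by apply: measurable_funM => //; exact: bphi.1.
    + exact: (bmfM bu' bphi).1.
    + by apply: aeS uu' => t Ht /Ht ->.
    move=> E; have -> : (fun t => (u' t - v' 0%N t) * phi t) =
       (fun t => u' t * phi t - v' 0%N t * phi t) by apply/funext => t; ring.
    rewrite (intgB (lexx 0) (lexx T)) ?E ?subrr//; exact: bmfM.
  apply: aeS (aeI (aeI uu' H) (gv 0%N (leq0n m))) => t [[H1 H2] H3] tT.
  by rewrite H1// -H3//; apply/eqP; rewrite -subr_eq0 H2.
- move=> j jm; have [_ _ wv] := Hv' j jm.
  by apply: aeS (aeI wv (gv j jm)) => t [H1 H2] tT; rewrite -/(wd j) H1// H2.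
- have [M M0 gM] := prim_lip (pg 0%N m0).
  (* Twice the positive part of |g 0| - eta: a Lipschitz function that vanishes almost everywhere,
     hence everywhere on [0, T]. *)
  pose h t := (`|g 0%N t| - eta) + `| `|g 0%N t| - eta|.
  have hlip s t : 0 <= s <= T -> 0 <= t <= T -> `|h t - h s| <= 2 * M * `|t - s|.
    move=> sT tT; have H1 := gM s t sT tT.
    have H2 := le_trans (ler_dist_dist _ _) H1.
    have H3 := le_trans (ler_dist_dist (`|g 0%N t| - eta) (`|g 0%N s| - eta)) _.
    have {H3} : `| `| `|g 0%N t| - eta| - `| `|g 0%N s| - eta| | <= M * `|t - s|.
      apply: H3; by have -> : `|g 0%N t| - eta - (`|g 0%N s| - eta) = `|g 0%N t| - `|g 0%N s| by ring.
    move=> H3; have -> : h t - h s = (`|g 0%N t| - `|g 0%N s|) +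
      (`| `|g 0%N t| - eta| - `| `|g 0%N s| - eta|) by rewrite /h; ring.
    by apply: le_trans (ler_normD _ _) _; lra.
  have h0 : {ae mu, forall t, t \in `]0, T[ -> h t = 0}.
    apply: aeS (gv 0%N (leq0n m)) => t Ht tT; rewrite /h -Ht//.
    have [_ vle _] := Hv' 0%N (leq0n m).
    have H : `|v' 0%N t| - eta <= 0 by rewrite subr_le0.
    by rewrite (ler0_norm H) subrr.
  move=> s sT; have := ae_continuous_eq0 T0 (lip_continuous hlip) h0 sT.
  by rewrite /h; have := ler_norm (`|g 0%N s| - eta); have := normr_ge0 (`|g 0%N s| - eta); lra.
Qed.

Lemma sobolev0_chain m T u (g : nat -> R -> R) j : 0 < T -> Sobolev0 m T u -> (j < m)%N ->
  prim_chain T m g ->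
  {ae mu, forall t, t \in `]0, T[ -> g j t = weak_derivative T j u t} -> g j 0 = 0.
Proof.
move=> T0 [_ H] jm pg gj; have [w [cw aw w0]] := H j jm.
have cg := prim_continuous (pg j jm).
suff : g j 0 - w 0 = 0 by rewrite w0 subr0.
apply: (@ae_continuous_eq0 _ T (fun t => g j t - w t)) => //.
- exact: within_continuousB.
- by apply: aeS (aeI aw gj) => t [H1 H2] tT; rewrite H1// H2// subrr.
- by rewrite lexx ltW.
Qed.

End SobolevChain.

(** * Jets of vector fields and of their Lie brackets *)

Section DiffCalculus.
Context {R : realType}.

Lemma diff_sum (V W : normedModType R) (I : Type) (r : seq I) (F : I -> V -> W) (x v : V) :
  (forall i, differentiable (F i) x) ->
  differentiable (fun y => \sum_(i <- r) F i y) x /\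
  'd (fun y => \sum_(i <- r) F i y) x v = \sum_(i <- r) 'd (F i) x v.
Proof.
move=> dF; elim: r => [|i r [IH1 IH2]].
  have -> : (fun y : V => \sum_(i <- [::]) F i y) = cst 0 by apply/funext => y; rewrite big_nil.
  by rewrite big_nil (diff_cst (0 : W)); split=> //; exact: differentiable_cst.
have -> : (fun y : V => \sum_(j <- i :: r) F j y) = F i + (fun y => \sum_(j <- r) F j y).
  by apply/funext => y; rewrite big_cons.
split; first exact: (differentiableD (dF i) IH1).
by rewrite big_cons -IH2 (diffD (dF i) IH1).
Qed.

Lemma diff_coord (V : normedModType R) n (F : V -> 'rV[R]_n) (x v : V) i :
  differentiable F x ->
  differentiable (fun y => F y 0 i) x /\ 'd (fun y => F y 0 i) x v = ('d F x v) 0 i.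
Proof.
move=> dF; pose L (M : 'rV[R]_n) := M 0 i.
have lL : linear L by move=> a u w; rewrite /L !mxE.
pose LL : {linear 'rV[R]_n -> R} := HB.pack L (GRing.isLinear.Build _ _ _ _ L lL).
have cL : continuous LL by exact: coord_continuous.
have dL w : differentiable LL w by exact: linear_differentiable.
split; first exact: (differentiable_comp dF (dL _)).
by have -> : 'd (fun y => F y 0 i) x = 'd (LL \o F) x by []; rewrite diff_comp// diff_lin.
Qed.

Lemma diff_row (V : normedModType R) n (F : V -> 'rV[R]_n) (x v : V) :
  (forall i, differentiable (fun y => F y 0 i) x) ->
  differentiable F x /\ 'd F x v = \row_i 'd (fun y => F y 0 i) x v.
Proof.
move=> dF.
have dFi i : differentiable (fun y => F y 0 i *: (delta_mx 0 i : 'rV[R]_n)) x.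
  exact: differentiableZl.
have [d1 d2] := @diff_sum V _ _ (index_enum 'I_n) (fun i y => F y 0 i *: (delta_mx 0 i : 'rV[R]_n)) x v dFi.
have E : F = (fun y => \sum_i F y 0 i *: (delta_mx 0 i : 'rV[R]_n)).
  by apply/funext => y; rewrite -row_sum_delta.
move: d1 d2; rewrite -E => d1 d2; split=> //; rewrite d2.
rewrite [RHS]row_sum_delta; apply: eq_bigr => i _.
by rewrite (diffZl _ (dF i))/= mxE.
Qed.

Lemma diff_scale (V : normedModType R) n (g : V -> R) (F : V -> 'rV[R]_n) (x v : V) :
  differentiable g x -> differentiable F x ->
  differentiable (fun y => g y *: F y) x /\
  'd (fun y => g y *: F y) x v = g x *: 'd F x v + 'd g x v *: F x.
Proof.
move=> dg dF.
have E i : (fun y => (g y *: F y) 0 i) = g * (fun y => F y 0 i).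
  by apply/funext => y; rewrite mxE.
have dc i : differentiable (fun y => (g y *: F y) 0 i) x.
  by rewrite E; apply: differentiableM => //; exact: (diff_coord v i dF).1.
have H := @diff_row V n (fun y => g y *: F y) x v dc.
have [d1 d2] := H.
split; first exact: d1.
apply: (eq_trans d2).
apply/rowP => i; rewrite !mxE.
have [di ei] := diff_coord v i dF.
transitivity ('d (g * (fun y => F y 0 i)) x v); first by rewrite -E.
have M := diffM dg di.
transitivity ((g x \*: 'd (fun y => F y 0 i) x + F x 0 i \*: 'd g x) v); first by rewrite -M.
rewrite -ei (mulrC ('d g x v)).
reflexivity.
Qed.

Lemma linear_row_sum n m (L : 'rV[R]_n -> 'rV[R]_m) (z : 'rV[R]_n) :
  linear L -> L z = \sum_i z 0 i *: L (delta_mx 0 i).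
Proof.
move=> lL; pose LL : {linear 'rV[R]_n -> 'rV[R]_m} := HB.pack L (GRing.isLinear.Build _ _ _ _ L lL).
rewrite {1}[z]row_sum_delta -[L]/(LL : _ -> _) linear_sum; apply: eq_bigr => i _.
by rewrite linearZ.
Qed.

(** Product rule for a field of linear maps applied to a vector field, reduced to the scalar rule by
    expansion in the canonical basis. It serves for x |-> 'd Y x (X x) in brackets. *)
Lemma diff_apply (n m : nat) (M : 'rV[R]_n -> 'rV[R]_m -> 'rV[R]_m)
  (Z : 'rV[R]_n -> 'rV[R]_m) (x h : 'rV[R]_n) :
  (forall y, linear (M y)) -> (forall v, differentiable (fun y => M y v) x) ->
  differentiable Z x ->
  differentiable (fun y => M y (Z y)) x /\
  'd (fun y => M y (Z y)) x h = 'd (fun y => M y (Z x)) x h + M x ('d Z x h).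
Proof.
move=> lM dM dZ.
have E z y : M y z = \sum_i z 0 i *: M y (delta_mx 0 i) by exact: linear_row_sum.
have dt i : differentiable (fun y => Z y 0 i *: M y (delta_mx 0 i)) x.
  by have [] := diff_scale h (diff_coord h i dZ).1 (dM (delta_mx 0 i)).
have dc i : differentiable (fun y => Z x 0 i *: M y (delta_mx 0 i)) x.
  exact: differentiableZ.
have E1 : (fun y => M y (Z y)) = (fun y => \sum_i Z y 0 i *: M y (delta_mx 0 i)).
  by apply/funext => y; exact: E.
have E2 : (fun y => M y (Z x)) = (fun y => \sum_i Z x 0 i *: M y (delta_mx 0 i)).
  by apply/funext => y; exact: E.
have [d1 e1] := diff_sum (index_enum 'I_m) h dt.
have [d2 e2] := diff_sum (index_enum 'I_m) h dc.
rewrite E1; split; first exact: d1.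
apply: (eq_trans e1).
transitivity (\sum_i 'd (fun y => Z x 0 i *: M y (delta_mx 0 i)) x h +
  \sum_i ('d Z x h) 0 i *: M x (delta_mx 0 i)); last first.
  by congr (_ + _); [rewrite E2; exact: (esym e2)|exact: (esym (E ('d Z x h) x))].
rewrite -big_split/=; apply: eq_bigr => i _.
have S := (diff_scale h (diff_coord h i dZ).1 (dM (delta_mx 0 i))).2.
apply: (eq_trans S); congr (_ + _); last by rewrite (diff_coord h i dZ).2.
exact: (esym (congr1 (fun F => F h) (diffZ (Z x 0 i) (dM (delta_mx 0 i))))).
Qed.

(** Once differentiability is known, an exact second-order expansion along one line determines the
    differential in that direction. *)
Lemma diff_quadratic (V W : normedModType R) (F : V -> W) (x v : V) (l m : W) :
  differentiable F x -> (forall h : R, F (x + h *: v) = F x + h *: l + h ^+ 2 *: m) ->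
  'd F x v = l.
Proof.
move=> dF FE; rewrite -deriveE//.
have H : h^-1 *: (F (h *: v + x) - F x) @[h --> (0 : R)^'] --> l.
  have -> : l = l + (0 : R) *: m by rewrite scale0r addr0.
  apply: (@cvg_trans _ ((fun h : R => l + h *: m) @ (0 : R)^')).
    apply: near_eq_cvg; near=> h.
    have h0 : h != 0 by near: h; exact: nbhs_dnbhs_neq.
    rewrite [_ + x]addrC FE -[F x + _ + _]addrA [F x + _]addrC addrK scalerDr !scalerA.
    by rewrite mulVf// scale1r expr2 mulrA mulVf// mul1r.
  apply: cvgD; first exact: cvg_cst.
  apply: cvgZr_tmp; exact: cvg_within.
exact: cvg_lim H.
Unshelve. all: by end_near. Qed.

Lemma Ck_id (V : normedModType R) k : Ck k (@id V).
Proof.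
case: k => [|k]; first by move=> x.
split=> [x|v]; first by have [] := is_diff_id x.
have -> : (fun x => 'd (@id V) x v) = (fun=> v); last exact: Ck_cst.
by apply/funext => x; have [_ ->] := is_diff_id x.
Qed.

Lemma Ck_linear n m k (L : 'rV[R]_n -> 'rV[R]_m) : linear L -> Ck k L.
Proof.
move=> lL; have -> : L = (fun x => \sum_i x 0 i *: L (delta_mx 0 i)).
  by apply/funext => x; exact: linear_row_sum.
by apply: Ck_sum => i; apply/Ck_scalel/Ck_coord/Ck_id.
Qed.

Lemma Ck_apply n m k (M : 'rV[R]_n -> 'rV[R]_m -> 'rV[R]_m) (Z : 'rV[R]_n -> 'rV[R]_m) :
  (forall y, linear (M y)) -> (forall v, Ck k (fun y => M y v)) -> Ck k Z ->
  Ck k (fun y => M y (Z y)).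
Proof.
move=> lM CM CZ.
have -> : (fun y => M y (Z y)) = (fun y => \sum_i Z y 0 i *: M y (delta_mx 0 i)).
  by apply/funext => y; exact: linear_row_sum.
apply: Ck_sum => i; apply: Ck_row => j.
under [X in Ck k X]eq_fun do rewrite mxE.
by apply: CkM; exact: Ck_coord.
Qed.

End DiffCalculus.

Section LieJets.
Context {R : realType} {n : nat}.
Notation V := 'rV[R]_n.
Implicit Types (X Y Z : V -> V) (x y v w h : V).

Lemma smooth_differentiable X x : smooth X -> differentiable X x.
Proof. by move=> /(_ 1%N)[]. Qed.

Lemma smooth_diff X v : smooth X -> smooth (fun x => 'd X x v).
Proof. by move=> sX k; have [_ /(_ v)] := sX k.+1. Qed.

Lemma smoothB X Y : smooth X -> smooth Y -> smooth (fun x => X x - Y x).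
Proof.
move=> sX sY k; apply: CkD; first exact: sX.
have l : linear (fun x : V => - x) by move=> a u w; rewrite opprD scalerN.
have -> : (fun x => - Y x) = (fun x => (fun _ => (fun x => - x)) x (Y x)) by [].
apply: (@Ck_apply _ _ _ _ (fun _ => (fun x => - x))) => // v; exact: Ck_cst.
Qed.

Lemma smooth_lie X Y : smooth X -> smooth Y -> smooth (lie X Y).
Proof.
move=> sX sY; apply: smoothB => k.
  apply: (@Ck_apply _ _ _ _ (fun x => 'd Y x)) => // [y|v]; [exact: linearP|exact: smooth_diff].
apply: (@Ck_apply _ _ _ _ (fun x => 'd X x)) => // [y|v]; [exact: linearP|exact: smooth_diff].
Qed.

Lemma diffv0 X x : 'd X x 0 = 0.
Proof. exact: linear0. Qed.

Lemma lieN X Y : lie Y X = (fun x => - lie X Y x).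
Proof. by apply/funext => x; rewrite /lie opprB. Qed.

Lemma diffN_smooth X x v : smooth X -> 'd (fun y => - X y) x v = - 'd X x v.
Proof.
move=> sX; exact: (congr1 (fun F => F v) (diffN (smooth_differentiable x sX))).
Qed.

Definition bilin (B : V -> V -> V) : Prop :=
  (forall x, linear (B x)) /\ (forall y, linear (B^~ y)).

Section Bilin.
Variable B : V -> V -> V.
Hypothesis bB : bilin B.
Lemma bilinDl x y z : B (x + y) z = B x z + B y z.
Proof. by have := bB.2 z 1 x y; rewrite !scale1r. Qed.
Lemma bilinDr x y z : B z (x + y) = B z x + B z y.
Proof. by have := bB.1 z 1 x y; rewrite !scale1r. Qed.
Lemma bilin0l z : B 0 z = 0.
Proof. by apply: (addrI (B 0 z)); rewrite -bilinDl !addr0. Qed.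
Lemma bilin0r z : B z 0 = 0.
Proof. by apply: (addrI (B z 0)); rewrite -bilinDr !addr0. Qed.
Lemma bilinZl a x z : B (a *: x) z = a *: B x z.
Proof. by have := bB.2 z a x 0; rewrite bilin0l !addr0. Qed.
Lemma bilinZr a x z : B z (a *: x) = a *: B z x.
Proof. by have := bB.1 z a x 0; rewrite bilin0r !addr0. Qed.
Lemma bilinNr x z : B z (- x) = - B z x.
Proof. by rewrite -scaleN1r bilinZr scaleN1r. Qed.
Lemma bilin_suml (I : Type) (r : seq I) (P : pred I) (F : I -> V) z :
  B (\sum_(i <- r | P i) F i) z = \sum_(i <- r | P i) B (F i) z.
Proof. exact: (big_morph (B^~ z) (fun x y => bilinDl x y z) (bilin0l z)). Qed.
Lemma bilin_sumr (I : Type) (r : seq I) (P : pred I) (F : I -> V) z :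
  B z (\sum_(i <- r | P i) F i) = \sum_(i <- r | P i) B z (F i).
Proof. exact: (big_morph (B z) (fun x y => bilinDr x y z) (bilin0r z)). Qed.
End Bilin.

Lemma smooth_bilin B : bilin B -> smooth (fun x => B x x).
Proof.
move=> bB k; apply: (@Ck_apply _ _ _ _ B) => [y|v|]; first exact: bB.1.
- exact: Ck_linear (bB.2 v).
- exact: Ck_id.
Qed.

Lemma diff_bilin_diag B x v : bilin B -> 'd (fun x => B x x) x v = B x v + B v x.
Proof.
move=> bB; apply: (@diff_quadratic _ _ _ _ x v _ (B v v)).
  by have [] := smooth_bilin bB 1.
move=> h; rewrite !(bilinDl bB) !(bilinDr bB) !(bilinZl bB) !(bilinZr bB) scalerDr.
by rewrite scalerA -expr2 !addrA.
Qed.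

(** [X0] and [X1] model the Taylor polynomials of the drift and of the control field: H = f_0'(0), B
    the symmetrized second derivative of f_0 at 0, b = f_1(0) and L = f_1'(0). *)
Variables (H L : V -> V) (B : V -> V -> V) (b : V).
Hypotheses (lH : linear H) (lL : linear L) (bB : bilin B).
Hypothesis Bsym : forall x y, B x y = B y x.
Variables X0 X1 : V -> V.
Hypotheses (X0E : forall x, X0 x = H x + 2^-1 *: B x x).
Hypotheses (X1E : forall x, X1 x = b + L x).

Lemma smooth_X0 : smooth X0.
Proof.
have -> : X0 = (fun x => H x + 2^-1 *: B x x) by apply/funext.
move=> k; apply: CkD; first exact: Ck_linear.
have l : linear (fun x : V => 2^-1 *: x).
  by move=> a u w; rewrite scalerDr !scalerA mulrC.
apply: (@Ck_apply _ _ _ _ (fun _ x => 2^-1 *: x)) => [//|v|]; [exact: Ck_cst|exact: smooth_bilin].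
Qed.

Lemma smooth_X1 : smooth X1.
Proof.
have -> : X1 = (fun x => b + L x) by apply/funext.
by move=> k; apply: CkD; [exact: Ck_cst|exact: Ck_linear].
Qed.

Let H0 : H 0 = 0.
Proof. by have := lH (-1) 0 0; rewrite scaler0 addr0 scaleN1r addNr. Qed.
Let HD x y : H (x + y) = H x + H y.
Proof. by have := lH 1 x y; rewrite !scale1r. Qed.
Let HZ a x : H (a *: x) = a *: H x.
Proof. by have := lH a x 0; rewrite !addr0 H0 addr0. Qed.
Let LZ a x y : L (a *: x + y) = a *: L x + L y.
Proof. exact: lL. Qed.

Lemma X00 : X0 0 = 0.
Proof. by rewrite X0E H0 (bilin0l bB) scaler0 addr0. Qed.

Lemma diff_X0 x v : 'd X0 x v = H v + B x v.
Proof.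
apply: (@diff_quadratic _ _ _ X0 x v _ (2^-1 *: B v v)).
  exact: smooth_differentiable smooth_X0.
move=> h; rewrite !X0E HD HZ !(bilinDl bB) !(bilinDr bB) !(bilinZl bB) !(bilinZr bB).
by rewrite (Bsym v x); apply/rowP => i; rewrite !mxE; field.
Qed.

Lemma diff_X1 x v : 'd X1 x v = L v.
Proof.
apply: (@diff_quadratic _ _ _ X1 x v _ 0).
  exact: smooth_differentiable smooth_X1.
by move=> h; rewrite !X1E [x + _]addrC LZ scaler0 addr0 -!addrA [h *: _ + _]addrC.
Qed.

Lemma lie_X0_at0 Y : lie X0 Y 0 = - H (Y 0).
Proof.
have E1 : 'd Y 0 (X0 0) = 0 by rewrite X00; exact: diffv0.
have E2 : 'd X0 0 (Y 0) = H (Y 0) by apply: (eq_trans (diff_X0 _ _)); rewrite (bilin0l bB) addr0.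
exact: (eq_trans (congr2 (fun u w => u - w) E1 E2) (sub0r _)).
Qed.

(** Second derivatives of Y drop out because [X0] vanishes at 0. With [lie_X0_at0], the bracket with
    [X0] therefore acts on first jets at 0, and iterated brackets can be followed through Y(0) and
    Y'(0) alone. *)
Lemma diff_lie_X0 Y h : smooth Y ->
  'd (lie X0 Y) 0 h = 'd Y 0 (H h) - B h (Y 0) - H ('d Y 0 h).
Proof.
move=> sY; have dY := smooth_differentiable 0 sY.
have sX := smooth_X0; have dX := smooth_differentiable 0 sX.
have lY y : linear ('d Y y) by exact: linearP.
have lX y : linear ('d X0 y) by exact: linearP.
have dY' v : differentiable (fun y => 'd Y y v) 0 by exact/smooth_differentiable/smooth_diff.
have dX' v : differentiable (fun y => 'd X0 y v) 0 by exact/smooth_differentiable/smooth_diff.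
have [d1 e1] := @diff_apply R n n (fun x => 'd Y x) X0 0 h lY dY' dX.
have [d2 e2] := @diff_apply R n n (fun x => 'd X0 x) Y 0 h lX dX' dY.
transitivity ('d (fun x => 'd Y x (X0 x)) 0 h - 'd (fun x => 'd X0 x (Y x)) 0 h).
  exact: (congr1 (fun F => F h) (diffB d1 d2)).
have z1 : 'd (fun x => 'd Y x (X0 0)) 0 h = 0.
  have -> : (fun x => 'd Y x (X0 0)) = cst 0.
    by apply/funext => x; rewrite X00; exact: diffv0.
  by rewrite (diff_cst (0 : V)).
have z2 : 'd (fun x => 'd X0 x (Y 0)) 0 h = B h (Y 0).
  have -> : (fun x => 'd X0 x (Y 0)) = (fun x => H (Y 0) + B x (Y 0)).
    by apply/funext => x; exact: diff_X0.
  apply: (@diff_quadratic _ _ _ _ 0 h _ 0).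
    have C : Ck 1 (fun x => H (Y 0) + B x (Y 0)).
      by apply: CkD; [exact: Ck_cst|exact: Ck_linear (bB.2 _)].
    by case: C.
  by move=> a; rewrite add0r (bilin0l bB) addr0 (bilinZl bB) scaler0 addr0.
have z3 : 'd X0 0 h = H h by apply: (eq_trans (diff_X0 _ _)); rewrite (bilin0l bB) addr0.
have z4 : 'd X0 0 ('d Y 0 h) = H ('d Y 0 h).
  by apply: (eq_trans (diff_X0 _ _)); rewrite (bilin0l bB) addr0.
have s1 : 'd (fun x => 'd Y x (X0 x)) 0 h = 'd Y 0 (H h).
  apply: (eq_trans e1); apply: (eq_trans (congr2 (fun u w => u + 'd Y 0 w) z1 z3)).
  exact: add0r.
have s2 : 'd (fun x => 'd X0 x (Y x)) 0 h = B h (Y 0) + H ('d Y 0 h).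
  exact: (eq_trans e2 (congr2 (fun u w => u + w) z2 z4)).
apply: (eq_trans (congr2 (fun u w => u - w) s1 s2)).
by move: ('d Y 0 (H h)) (H _) => u w; rewrite opprD addrA.
Qed.

End LieJets.

(** * Quadratic normal form along the Krylov basis *)

Section OrthoProj.
Context {R : realType} {n : nat}.
Notation V := 'rV[R]_n.
Variable S : {vspace V}.

Definition coproj (x : V) : V := x - orthoproj S x.

Lemma linear_orthoproj : linear (orthoproj S).
Proof. by move=> a x y; rewrite /orthoproj linearP. Qed.

Lemma linear_coproj : linear coproj.
Proof.
by move=> a x y; rewrite /coproj linear_orthoproj scalerBr opprD addrACA.
Qed.

Lemma coproj_in x : x \in S -> coproj x = 0.
Proof.
move=> xS; have [pS cC] := orthoprojP S x; have [cap _] := ortho_compl_direct S.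
apply/eqP; rewrite -memv0 -cap memv_cap cC andbT; exact: memvB.
Qed.

Lemma coproj_eq0 x : coproj x = 0 -> x \in S.
Proof. by move/eqP; rewrite subr_eq0 => /eqP ->; have [] := orthoprojP S x. Qed.

Lemma coproj_compl x : coproj x \in ortho_compl S.
Proof. by have [] := orthoprojP S x. Qed.

Lemma orthoproj_in x : x \in S -> orthoproj S x = x.
Proof. by move/coproj_in/eqP; rewrite subr_eq0 => /eqP. Qed.

Lemma orthoproj_compl0 x : x \in ortho_compl S -> orthoproj S x = 0.
Proof.
move=> xC; have [pS cC] := orthoprojP S x; have [cap _] := ortho_compl_direct S.
apply/eqP; rewrite -memv0 -cap memv_cap pS/=.
by rewrite -[orthoproj S x](subKr x) memvB.
Qed.

Lemma coproj_id x : x \in ortho_compl S -> coproj x = x.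
Proof. by move/orthoproj_compl0; rewrite /coproj => ->; rewrite subr0. Qed.

End OrthoProj.

Section LinearSums.
Context {R : realType} {U W : lmodType R}.
Variable f : U -> W.
Hypothesis lf : linear f.
Lemma lin0 : f 0 = 0.
Proof. by have := lf (-1) 0 0; rewrite scaler0 addr0 scaleN1r addNr. Qed.
Lemma linD x y : f (x + y) = f x + f y.
Proof. by have := lf 1 x y; rewrite !scale1r. Qed.
Lemma linZ a x : f (a *: x) = a *: f x.
Proof. by have := lf a x 0; rewrite !addr0 lin0 addr0. Qed.
Lemma linN x : f (- x) = - f x.
Proof. by rewrite -scaleN1r linZ scaleN1r. Qed.
Lemma linB x y : f (x - y) = f x - f y.
Proof. by rewrite linD linN. Qed.
Lemma lin_sum (I : Type) (r : seq I) (P : pred I) (F : I -> U) :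
  f (\sum_(i <- r | P i) F i) = \sum_(i <- r | P i) f (F i).
Proof. exact: (big_morph f linD lin0). Qed.
End LinearSums.

Section BracketValues.
Context {R : realType} {n : nat}.
Notation V := 'rV[R]_n.
Implicit Types (X Y Z : V -> V) (x y v w h : V).
Variables (H L : V -> V) (B : V -> V -> V) (b : V).
Hypotheses (lH : linear H) (lL : linear L) (bB : bilin B).
Hypothesis Bsym : forall x y, B x y = B y x.
Variables X0 X1 : V -> V.
Hypotheses (X0E : forall x, X0 x = H x + 2^-1 *: B x x).
Hypotheses (X1E : forall x, X1 x = b + L x).

Let sX0 : smooth X0. Proof. exact: smooth_X0 X0E. Qed.
Let sX1 : smooth X1. Proof. exact: smooth_X1 X1E. Qed.

Lemma smooth_bracket br : smooth (bracket_eval X0 X1 br).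
Proof. by elim: br => //= b1 s1 b2 s2; exact: smooth_lie. Qed.

Lemma lieXX X : lie X X = (fun=> 0).
Proof. by apply/funext => x; exact: subrr. Qed.

Lemma lieX0 X : lie X (fun=> 0) = (fun=> 0).
Proof.
apply/funext => x.
have E1 : 'd (fun _ : V => (0 : V)) x (X x) = 0.
  exact: (congr1 (fun F => F (X x)) (diff_cst (0 : V) x)).
exact: (eq_trans (congr2 (fun u w => u - w) E1 (diffv0 X x)) (subr0 0)).
Qed.

Lemma lie0X X : lie (fun=> 0) X = (fun=> 0).
Proof. by rewrite lieN lieX0; apply/funext => x; rewrite oppr0. Qed.

Lemma bracket_count0 br : bracket_count1 br = 0%N ->
  bracket_eval X0 X1 br = X0 \/ bracket_eval X0 X1 br = (fun=> 0).
Proof.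
elim: br => [||b1 IH1 b2 IH2] //=; first by left.
move=> /eqP; rewrite addn_eq0 => /andP[/eqP/IH1 h1 /eqP/IH2 h2]; right.
by case: h1 => ->; case: h2 => ->; rewrite ?lieXX ?lieX0 ?lie0X.
Qed.

(** A bracket without [X1] is [X0] or 0, so a bracket containing [X1] once is, up to sign, an
    iterate of [X0, .] on [X1], or 0. *)
Lemma bracket1_ind (P : (V -> V) -> Prop) : P X1 -> P (fun=> 0) ->
  (forall Y, smooth Y -> P Y -> P (lie X0 Y)) ->
  (forall Y, smooth Y -> P Y -> P (fun x => - Y x)) ->
  forall br, bracket_count1 br = 1%N -> P (bracket_eval X0 X1 br).
Proof.
move=> P1 P0 PX PN; elim=> [||b1 IH1 b2 IH2] //=.
case c1: (bracket_count1 b1) => [|[|]] //.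
  rewrite add0n => c2; have [->|->] := bracket_count0 c1; last by rewrite lie0X.
  by apply: PX; [exact: smooth_bracket|exact: IH2].
rewrite add1n => -[c2]; have [->|->] := bracket_count0 c2; last by rewrite lieX0.
rewrite lieN; have sb := smooth_bracket b1.
by apply: PN; [exact: smooth_lie|apply: PX => //; exact: IH1].
Qed.

(** At the root, either the two occurrences of [X1] are separated, or one of the factors contains
    none and is [X0] or 0. *)
Lemma bracket2_ind (P Q : (V -> V) -> Prop) :
  (forall br, bracket_count1 br = 1%N -> P (bracket_eval X0 X1 br)) -> Q (fun=> 0) ->
  (forall Y Z, smooth Y -> smooth Z -> P Y -> P Z -> Q (lie Y Z)) ->
  (forall Y, smooth Y -> Q Y -> Q (lie X0 Y)) ->
  (forall Y, smooth Y -> Q Y -> Q (fun x => - Y x)) ->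
  forall br, bracket_count1 br = 2%N -> Q (bracket_eval X0 X1 br).
Proof.
move=> P1 Q0 QP QX QN; elim=> [||b1 IH1 b2 IH2] //=.
case c1: (bracket_count1 b1) => [|[|[|]]] //.
- rewrite add0n => c2; have [->|->] := bracket_count0 c1; last by rewrite lie0X.
  by apply: QX; [exact: smooth_bracket|exact: IH2].
- rewrite add1n => -[c2]; apply: QP; [exact: smooth_bracket|exact: smooth_bracket| |];
    exact: P1.
- rewrite addSn add1n => -[c2]; have [->|->] := bracket_count0 c2; last by rewrite lieX0.
  rewrite lieN; have sb := smooth_bracket b1.
  by apply: QN; [exact: smooth_lie|apply: QX => //; exact: IH1].
Qed.

Notation S := (lie_space X0 X1 1).

Lemma lie_space_b : b \in S.
Proof.
apply: (vspanP _).1; exists B1 => //=.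
by rewrite X1E (lin0 lL) addr0.
Qed.

Lemma lie_space_inv v : v \in S -> H v \in S.
Proof.
pose HH : {linear V -> V} := HB.pack H (GRing.isLinear.Build _ _ _ _ H lH).
have sub : (S <= linfun HH @^-1: S)%VS.
  apply: (vspanP _).2 => w [br cbr ->]; rewrite -memv_preim lfunE/= -memvN.
  apply: (vspanP _).1; exists (Br B0 br) => //=.
  by rewrite (lie_X0_at0 lH bB Bsym X0E).
by move=> /(subvP sub); rewrite -memv_preim lfunE.
Qed.

(** By [bracket1_ind] the generators of S are 0 or the vectors H^i b up to sign: S is the smallest
    H-invariant subspace containing b, the reachable space of the linearized system. *)
Lemma lie_space_min (W : {vspace V}) : b \in W -> (forall v, v \in W -> H v \in W) ->
  (S <= W)%VS.
Proof.
move=> bW HW; apply: (vspanP _).2 => v [br + ->].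
have X00 := X00 lH bB X0E.
rewrite leq_eqVlt ltnS leqn0 => /orP[/eqP c1|/eqP c0].
  apply: (@bracket1_ind (fun Y => Y 0 \in W)) => //.
  - by rewrite X1E (lin0 lL) addr0.
  - exact: mem0v.
  - by move=> Y _ YW; rewrite (lie_X0_at0 lH bB Bsym X0E) memvN; exact: HW.
  - by move=> Y _ YW; rewrite memvN.
by have [->|->] := bracket_count0 c0; rewrite ?X00 mem0v.
Qed.

Definition kry (i : nat) : V := iter i H b.

Lemma kry_in i : kry i \in S.
Proof. by elim: i => [|i IH]; [exact: lie_space_b|exact: lie_space_inv]. Qed.

Definition krys m : seq V := [seq kry i | i <- iota 0 m].

Lemma krysS m : krys m.+1 = rcons (krys m) (kry m).
Proof. by rewrite /krys -[m.+1]addn1 iotaD map_cat cats1. Qed.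

(** Let m be the least index with H^m b in the span of the previous Krylov vectors. By minimality
    these are free, their span is H-invariant, hence equal to S, and m = dim S. *)
Lemma krys_basis : basis_of S (krys (\dim S)).
Proof.
have free_kry m : (forall i, (i < m)%N -> kry i \notin <<krys i>>%VS) -> free (krys m).
  elim: m => [_|m IH Hm]; first exact: nil_free.
  rewrite krysS (perm_free (_ : perm_eq _ (kry m :: krys m))) ?perm_rcons//.
  by rewrite free_cons Hm// IH// => i im; apply: Hm; exact: ltnW.
have ex : exists m, kry m \in <<krys m>>%VS.
  apply: contrapT => nex.
  have /free_kry : forall i, (i < n.+1)%N -> kry i \notin <<krys i>>%VS.
    by move=> i _; apply/negP => ki; apply: nex; exists i.
  move=> /eqP; rewrite size_map size_iota => e.
  have := dimvS (subvf <<krys n.+1>>%VS).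
  by rewrite e dimvf /dim/= mul1n ltnn.
have [m km mmin] := ex_minnP ex.
have fm : free (krys m).
  by apply: free_kry => i im; apply/negP => /mmin; rewrite leqNgt im.
have sub1 : (<<krys m>> <= S)%VS.
  by apply/span_subvP => v /mapP[i _ ->]; exact: kry_in.
pose HH : {linear V -> V} := HB.pack H (GRing.isLinear.Build _ _ _ _ H lH).
have inv : (<<krys m>> <= linfun HH @^-1: <<krys m>>)%VS.
  apply/span_subvP => v /mapP[i]; rewrite mem_iota add0n => /andP[_ im] ->.
  rewrite -memv_preim lfunE/= -[H (kry i)]/(kry i.+1).
  move: im; rewrite leq_eqVlt => /orP[/eqP ->//|im].
  by apply/memv_span/mapP; exists i.+1 => //; rewrite mem_iota add0n.
have sub2 : (S <= <<krys m>>)%VS.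
  apply: lie_space_min.
    have [m0|m0] := posnP m; first by move: km; rewrite m0.
    by apply/memv_span/mapP; exists 0%N => //; rewrite mem_iota add0n.
  by move=> v /(subvP inv); rewrite -memv_preim lfunE.
have eS : (<<krys m>> = S)%VS by apply/eqP; rewrite eqEsubv sub1.
have -> : \dim S = m by rewrite -eS (eqP fm) size_map size_iota.
by rewrite basisEfree fm -eS subvv (eqP fm) size_map size_iota/=.
Qed.

(** Indexed by all natural numbers, with value 0 from dim S on, so that the recursion defining
    [nf_ell] carries no bound. It is linear on the whole space, but a genuine coordinate only on
    S. *)
Definition krycoord (i : nat) (v : V) : R :=
  if insub i is Some i' then coord (in_tuple (krys (\dim S))) i' v else 0.

Let size_krys m : size (krys m) = m. Proof. by rewrite size_map size_iota. Qed.
Let nth_krys m i : (i < m)%N -> (krys m)`_i = kry i.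
Proof. by move=> im; rewrite (nth_map 0%N) ?size_iota// nth_iota. Qed.

Lemma krycoord_linear i : scalar (krycoord i).
Proof.
move=> a x y; rewrite /krycoord; case: insubP => [i' _ _|_]; last by rewrite mulr0 addr0.
by rewrite linearP.
Qed.

Lemma krycoord_kry i j : (i < \dim S)%N -> (j < \dim S)%N ->
  krycoord i (kry j) = (i == j)%:R.
Proof.
move=> id jd; rewrite /krycoord; case: insubP => [i' _ <-|]; last by rewrite size_krys id.
have jd' : (j < size (krys (\dim S)))%N by rewrite size_krys.
have -> : kry j = (in_tuple (krys (\dim S)))`_(Ordinal jd') by rewrite /= nth_krys.
by rewrite coord_free ?(basis_free krys_basis)//= eq_sym.
Qed.

Lemma krycoord_sum v : v \in S -> v = \sum_(i < \dim S) krycoord i v *: kry i.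
Proof.
move=> vS; have vs : v \in <<in_tuple (krys (\dim S))>>%VS by rewrite /= (span_basis krys_basis).
rewrite {1}(coord_span vs).
have E (F : nat -> V) : \sum_(i < \dim S) F i = \sum_(i < size (krys (\dim S))) F i.
  by rewrite size_krys.
rewrite (E (fun i => krycoord i v *: kry i)); apply: eq_bigr => i _.
have id : (i < \dim S)%N by apply: leq_trans (ltn_ord i) _; rewrite size_krys.
by rewrite /= nth_krys// /krycoord valK.
Qed.

Notation Pp := (coproj S).
Notation d := (\dim S).
Notation C := (ortho_compl S).
Let lP := linear_coproj S.

(* For G (x, y) = \sum_i xi_i(x) *: ell i y, the defect
     Pp (B x y) / 2 + Pp (H (G x y)) - G (H x) y - G x (H y)
   at x = kry i is  nf_step i (ell i) y - G (kry i.+1) y;  ell i.+1 is chosen so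
   that this is a multiple of xi_i(y), the multiple being forced by symmetry. *)
Definition nf_step (i : nat) (l : V -> V) (y : V) : V :=
  2^-1 *: Pp (B (kry i) y) + Pp (H (l y)) - l (H y).

Fixpoint nf_ell (i : nat) : V -> V :=
  if i is j.+1 then
    fun y => nf_step j (nf_ell j) y -
             krycoord j y *: (nf_step j (nf_ell j) (kry j) - nf_ell j (kry j.+1))
  else fun y => 2^-1 *: Pp (L y).

Lemma linear_nf_step i l : linear l -> linear (nf_step i l).
Proof.
move=> ll a x y; rewrite /nf_step (bB.1 (kry i)) !lP ll !lH lP ll.
by apply/rowP => k; rewrite !mxE; ring.
Qed.

Lemma linear_nf_ell i : linear (nf_ell i).
Proof.
elim: i => [|i IH] a x y /=.
  by rewrite lL lP scalerDr !scalerA mulrC.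
rewrite (linear_nf_step i IH) krycoord_linear.
move: (nf_step i _ _ - nf_ell i _) (nf_step i _ x) (nf_step i _ y) => u v w.
by apply/rowP => k; rewrite !mxE; ring.
Qed.

Lemma nf_ell_compl i y : nf_ell i y \in C.
Proof.
have st j l z : (forall y, l y \in C) -> nf_step j l z \in C.
  move=> lC; rewrite /nf_step memvB ?lC// memvD ?coproj_compl// memvZ// coproj_compl//.
elim: i y => [|i IH] y /=; first by rewrite memvZ// coproj_compl.
by rewrite memvB ?st// memvZ// memvB ?st.
Qed.

(** The diagonal correction in [nf_ell] imposes the equality for consecutive indices. For smaller j,
    the recursion is unfolded once in each index, and the symmetry of B together with the induction
    hypothesis at j and j + 1 identifies the two results. *)
Lemma nf_ell_sym i j : (i < d)%N -> (j <= i)%N -> nf_ell i (kry j) = nf_ell j (kry i).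
Proof.
elim: i j => [|i IH] j id; first by rewrite leqn0 => /eqP ->.
have id' := ltnW id.
rewrite leq_eqVlt => /orP[/eqP ->//|]; rewrite ltnS leq_eqVlt => /orP[/eqP ->|ji].
  (* At [kry i] the coordinate is 1: the step cancels and [nf_ell i (kry i.+1)] remains. *)
  by rewrite /= krycoord_kry// eqxx scale1r subKr.
have jd := ltn_trans ji id'.
rewrite [LHS]/= krycoord_kry// gtn_eqF// scale0r subr0 /nf_step -/(kry j.+1).
rewrite (IH j id' (ltnW ji)) (IH j.+1 id' ji) /= krycoord_kry// ltn_eqF// scale0r subr0.
rewrite /nf_step -/(kry i.+1) Bsym.
by rewrite opprB addrC subrK.
Qed.

Definition nfG (x y : V) : V := \sum_(i < d) krycoord i x *: nf_ell i y.

(** The diagonal defect that the recursion cannot remove. It is written with [nfG] and not with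
    [nf_ell i.+1], so as to cover also i = d - 1, where [kry i.+1] is a combination of the basis
    vectors. *)
Definition nf_gam (i : nat) : V :=
  nf_step i (nf_ell i) (kry i) - nfG (kry i.+1) (kry i).

Lemma bilin_nfG : bilin nfG.
Proof.
split=> [x|y] a u v; rewrite /nfG scaler_sumr -big_split/=; apply: eq_bigr => i _.
  by rewrite (linear_nf_ell i) scalerDr !scalerA mulrC.
by rewrite krycoord_linear scalerDl scalerA.
Qed.

Lemma nfG_compl x y : nfG x y \in C.
Proof. by apply: memv_suml => i _; rewrite memvZ// nf_ell_compl. Qed.

Lemma nfG_kry i y : (i < d)%N -> nfG (kry i) y = nf_ell i y.
Proof.
move=> id; rewrite /nfG (bigD1 (Ordinal id))//= krycoord_kry// eqxx scale1r.
rewrite big1 ?addr0// => j ji; rewrite krycoord_kry// (_ : _ == _ = false) ?scale0r//.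
by apply/negbTE; apply: contra ji => /eqP ji; apply/eqP/val_inj.
Qed.

Lemma nfG_sym x y : x \in S -> y \in S -> nfG x y = nfG y x.
Proof.
move=> xS yS; rewrite (krycoord_sum xS) (krycoord_sum yS).
have bG := bilin_nfG.
rewrite !(bilin_suml bG).
under eq_bigr do rewrite (bilin_sumr bG).
under [RHS]eq_bigr do rewrite (bilin_sumr bG).
rewrite exchange_big; apply: eq_bigr => j _; apply: eq_bigr => i _.
rewrite !(bilinZl bG) !(bilinZr bG) !scalerA mulrC; congr (_ *: _).
rewrite !nfG_kry//; have [ji|/ltnW ij] := leqP j i; first exact: nf_ell_sym.
by rewrite -nf_ell_sym.
Qed.

Lemma nf_gam_compl i : nf_gam i \in C.
Proof.
rewrite /nf_gam memvB ?nfG_compl// /nf_step memvB ?nf_ell_compl//.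
by rewrite memvD ?coproj_compl// memvZ// coproj_compl.
Qed.

(** This is the purpose of the factor 1/2 in the initial term of [nf_ell]: the terms of the gap
    equation that are bilinear in u and P x cancel. *)
Lemma nfG_b y : y \in S -> Pp (L y) = 2 *: nfG b y.
Proof.
move=> yS; have [d0|d0] := posnP d.
  have -> : y = 0 by rewrite (krycoord_sum yS) big1// => -[i +]; rewrite d0.
  by rewrite (lin0 lL) (lin0 lP) (bilin0r bilin_nfG) scaler0.
by rewrite -[b]/(kry 0) nfG_kry//= scalerA mulfV ?scale1r.
Qed.

Definition nf_defect (x y : V) : V :=
  2^-1 *: Pp (B x y) + Pp (H (nfG x y)) - nfG (H x) y - nfG x (H y).

Lemma bilin_nf_defect : bilin nf_defect.
Proof.
have bG := bilin_nfG.
split=> [x|y] a u v; rewrite /nf_defect.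
  rewrite (bB.1 x a u v) (bG.1 x a u v) (bG.1 (H x) a u v) !lH (bG.1 x a (H u) (H v)) !lP.
  by apply/rowP => k; rewrite !mxE; ring.
rewrite (bB.2 y a u v) (bG.2 y a u v) (bG.2 (H y) a u v) !lH (bG.2 y a (H u) (H v)) !lP.
by apply/rowP => k; rewrite !mxE; ring.
Qed.

Lemma nf_defect_sym x y : x \in S -> y \in S -> nf_defect x y = nf_defect y x.
Proof.
move=> xS yS; have HxS := lie_space_inv xS; have HyS := lie_space_inv yS.
rewrite /nf_defect Bsym (nfG_sym xS yS) (nfG_sym HxS yS) (nfG_sym xS HyS).
by rewrite addrAC.
Qed.

(** For i < j < d the vector [kry i.+1] still belongs to the basis, so that nfG (kry i.+1) is
    [nf_ell i.+1], whose definition cancels the defect at [kry j]. The case i > j follows by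
    symmetry, and only the diagonal is left. *)
Lemma nf_defectE x y : x \in S -> y \in S ->
  nf_defect x y = \sum_(i < d) (krycoord i x * krycoord i y) *: nf_gam i.
Proof.
move=> xS yS; have bD := bilin_nf_defect.
have lt i j : (i < j)%N -> (j < d)%N -> nf_defect (kry i) (kry j) = 0.
  move=> ij jd; have id := ltn_trans ij jd; have i1d := leq_ltn_trans ij jd.
  rewrite /nf_defect -[H (kry i)]/(kry i.+1) !nfG_kry// [nf_ell i.+1 _]/=.
  rewrite krycoord_kry// ltn_eqF// scale0r subr0 /nf_step.
  by rewrite addrAC subrr.
have diag i : (i < d)%N -> nf_defect (kry i) (kry i) = nf_gam i.
  by move=> id; rewrite /nf_defect /nf_gam /nf_step -[H (kry i)]/(kry i.+1) !(nfG_kry _ id) addrAC.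
have ne i j : (i < d)%N -> (j < d)%N -> i != j -> nf_defect (kry i) (kry j) = 0.
  move=> id jd; rewrite neq_ltn => /orP[ij|ji]; first exact: lt.
  by rewrite nf_defect_sym ?kry_in// lt.
rewrite {1}(krycoord_sum xS) {1}(krycoord_sum yS) (bilin_suml bD).
apply: eq_bigr => i _; rewrite (bilin_sumr bD) (bigD1 i)//= big1 ?addr0; last first.
  move=> j ji; rewrite (bilinZl bD) (bilinZr bD) ne ?scaler0//.
  by apply: contra ji => /eqP e; apply/eqP/val_inj.
by rewrite (bilinZl bD) (bilinZr bD) diag// scalerA.
Qed.

(* Zero when Y is tangent at first order to the graph y |-> y + nfG y y. *)
Definition jet_defect (Y : V -> V) (y : V) : V := Pp ('d Y 0 y) - 2 *: nfG y (Y 0).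

(** The defect of Y is transported linearly, and [nf_defect] is the only source: a field tangent to
    the graph can lose tangency under [X0, .] through this term alone. *)
Lemma jet_defect_lie Y y : smooth Y -> Y 0 \in S -> y \in S ->
  jet_defect (lie X0 Y) y =
  jet_defect Y (H y) - Pp (H (jet_defect Y y)) - 2 *: nf_defect y (Y 0).
Proof.
move=> sY YS yS; rewrite /jet_defect (lie_X0_at0 lH bB Bsym X0E).
have E := diff_lie_X0 lH bB Bsym X0E y sY.
(* H preserves S, so Pp \o H factors through Pp. *)
have PH z : Pp (H z) = Pp (H (Pp z)).
  rewrite -[z in LHS](subrK (orthoproj S z)) -/(Pp z) (linD lH) (linD lP).
  rewrite [Pp (H (orthoproj S z))]coproj_in ?addr0//; apply: lie_space_inv.
  by have [] := orthoprojP S z.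
have bG := bilin_nfG.
have alg p u w v : p = u - B y v - H w -> Pp p - 2 *: nfG y (- H v) =
    (Pp u - 2 *: nfG (H y) v) - Pp (H (Pp w - 2 *: nfG y v)) - 2 *: nf_defect y v.
  move=> ->; rewrite !(linB lP) (PH w) /nf_defect.
  rewrite (bilinNr bG) (linB lH (Pp w)) (linZ lH) (linB lP (H (Pp w))) (linZ lP).
  by apply/rowP => k; rewrite !mxE; field.
exact: alg E.
Qed.

Lemma jet_defect_X1 y : y \in S -> jet_defect X1 y = 0.
Proof.
move=> yS; rewrite /jet_defect X1E (lin0 lL) addr0.
have -> : Pp ('d X1 0 y) = Pp (L y) by congr coproj; exact: (diff_X1 lL X1E).
rewrite (nfG_b yS) (nfG_sym yS) ?subrr//; exact: lie_space_b.
Qed.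

(** The contributions of [nfG] cancel by symmetry. In particular the bracket of two fields without
    defect takes a value in S at 0. *)
Lemma coproj_lie Y Z : smooth Y -> smooth Z -> Y 0 \in S -> Z 0 \in S ->
  Pp (lie Y Z 0) = jet_defect Z (Y 0) - jet_defect Y (Z 0).
Proof.
move=> sY sZ YS ZS; rewrite /lie (linB lP) /jet_defect (nfG_sym YS ZS).
have alg (u v w : V) : u - v = u - w - (v - w) by rewrite opprB addrA subrK.
exact: alg.
Qed.

Lemma smooth_ad k : smooth (ad X0 k X1).
Proof. by elim: k => [|k IH]//=; exact: smooth_lie. Qed.

Lemma ad_at0 k : ad X0 k X1 0 = (-1) ^+ k *: kry k.
Proof.
elim: k => [|k IH] /=; first by rewrite X1E (lin0 lL) addr0 expr0 scale1r.
by rewrite (lie_X0_at0 lH bB Bsym X0E) IH (linZ lH) exprS mulN1r scaleNr.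
Qed.

Lemma ad_at0_in k : ad X0 k X1 0 \in S.
Proof. by rewrite ad_at0 memvZ// kry_in. Qed.

Lemma nf_defect_ad k y : y \in S -> (k < d)%N ->
  nf_defect y (ad X0 k X1 0) = ((-1) ^+ k * krycoord k y) *: nf_gam k.
Proof.
move=> yS kd; rewrite nf_defectE// ?ad_at0_in// (bigD1 (Ordinal kd))//= big1 ?addr0.
  rewrite ad_at0 -[_ *: kry k]addr0 krycoord_linear krycoord_kry// eqxx.
  have -> : krycoord k 0 = 0 by have := krycoord_linear k (-1) 0 0; rewrite scaler0 addr0 mulN1r => ->; rewrite addNr.
  by rewrite addr0 mulr1 mulrC.
move=> j jk; rewrite ad_at0 -[_ *: kry k]addr0 krycoord_linear krycoord_kry//.
have -> : krycoord j 0 = 0 by have := krycoord_linear j (-1) 0 0; rewrite scaler0 addr0 mulN1r => ->; rewrite addNr.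
rewrite (_ : _ == _ = false) ?mulr0 ?addr0 ?mulr0 ?scale0r//.
by apply/negbTE; apply: contra jk => /eqP e; apply/eqP/val_inj.
Qed.

Lemma jet_defect_ad k : (k <= d)%N -> (forall i, (i < k)%N -> nf_gam i = 0) ->
  forall y, y \in S -> jet_defect (ad X0 k X1) y = 0.
Proof.
elim: k => [|k IH] kd g0 y yS /=; first exact: jet_defect_X1.
have g0' i : (i < k)%N -> nf_gam i = 0 by move=> ik; apply: g0; exact: ltnW.
have IH' := IH (ltnW kd) g0'.
rewrite jet_defect_lie ?ad_at0_in//; last exact: smooth_ad.
rewrite !IH' ?lie_space_inv// (lin0 lH) (lin0 lP) nf_defect_ad// g0//.
by rewrite !scaler0 !subr0.
Qed.

(** Only ad^(k+1) has a defect: the source term produced from ad^k, evaluated at ad^k (0) = (-1)^k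
    H^k b. The two signs multiply to 1, and the factor -2 is that of the source term. *)
Lemma coproj_ad_bracket k : (k < d)%N -> (forall i, (i < k)%N -> nf_gam i = 0) ->
  Pp (lie (ad X0 k X1) (ad X0 k.+1 X1) 0) = - 2 *: nf_gam k.
Proof.
move=> kd g0; rewrite coproj_lie ?ad_at0_in//; [|exact: smooth_ad|exact: smooth_ad].
have J0 := jet_defect_ad (ltnW kd) g0.
rewrite J0 ?ad_at0_in// subr0 /= jet_defect_lie ?ad_at0_in//; last exact: smooth_ad.
rewrite !J0 ?lie_space_inv ?ad_at0_in// (lin0 lH) (lin0 lP) nf_defect_ad ?ad_at0_in//.
rewrite ad_at0 -[_ *: kry k]addr0 krycoord_linear krycoord_kry// eqxx.
have -> : krycoord k 0 = 0 by have := krycoord_linear k (-1) 0 0; rewrite scaler0 addr0 mulN1r => ->; rewrite addNr.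
by rewrite addr0 mulr1 -expr2 sqrr_sign scale1r subr0 sub0r scaleNr.
Qed.

Lemma ad_bracket_lie_space2 k : lie (ad X0 k X1) (ad X0 k.+1 X1) 0 \in lie_space X0 X1 2.
Proof.
pose br := fix br k := if k is j.+1 then Br B0 (br j) else B1.
have brE j : bracket_eval X0 X1 (br j) = ad X0 j X1 by elim: j => //= j ->.
have brc j : bracket_count1 (br j) = 1%N by elim: j.
apply: (vspanP _).1; exists (Br (br k) (br k.+1)); last by rewrite -!brE.
have E : bracket_count1 (Br (br k) (br k.+1)) =
  (bracket_count1 (br k) + bracket_count1 (br k.+1))%N by [].
by rewrite E !brc.
Qed.

(** When all the gam_i vanish so does [nf_defect] on S, and the fields without defect and with value
    in S at 0 are stable under [X0, .]. They contain all brackets with a single [X1], so brackets of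
    two of them stay in S. *)
Lemma lie_space2_sub : (forall i, (i < d)%N -> nf_gam i = 0) ->
  (lie_space X0 X1 2 <= S)%VS.
Proof.
move=> g0.
have D0 x y : x \in S -> y \in S -> nf_defect x y = 0.
  by move=> xS yS; rewrite nf_defectE// big1// => i _; rewrite g0// scaler0.
have X00 := X00 lH bB X0E.
pose P Y := Y 0 \in S /\ (forall y, y \in S -> jet_defect Y y = 0).
have P1 br : bracket_count1 br = 1%N -> P (bracket_eval X0 X1 br).
  apply: bracket1_ind.
  - split; first by rewrite X1E (lin0 lL) addr0 lie_space_b.
    by move=> y; exact: jet_defect_X1.
  - split; first exact: mem0v.
    move=> y yS; rewrite /jet_defect (bilin0r bilin_nfG) scaler0 subr0.
    exact: (eq_trans (congr1 (fun F : V -> V => Pp (F y)) (diff_cst (0 : V) (0 : V))) (lin0 lP)).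
  - move=> Y sY [YS YJ]; split.
      by rewrite (lie_X0_at0 lH bB Bsym X0E) memvN lie_space_inv.
    move=> y yS; rewrite jet_defect_lie// !YJ ?lie_space_inv// D0//.
    by rewrite (lin0 lH) (lin0 lP) scaler0 !subr0.
  - move=> Y sY [YS YJ]; split; first by rewrite memvN.
    move=> y yS; rewrite /jet_defect (bilinNr bilin_nfG).
    have alg (p u w : V) : p = - u -> Pp u - 2 *: w = 0 -> Pp p - 2 *: - w = 0.
      by move=> -> e; rewrite (linN lP) scalerN -opprD e oppr0.
    exact: alg (diffN_smooth 0 y sY) (YJ _ yS).
apply: (vspanP _).2 => v [br + ->].
rewrite leq_eqVlt ltnS leq_eqVlt ltnS leqn0 => /or3P[/eqP c2|/eqP c1|/eqP c0].
- apply: (@bracket2_ind P (fun Y => Y 0 \in S)) => //.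
  + exact: mem0v.
  + move=> Y Z sY sZ [YS YJ] [ZS ZJ]; apply: coproj_eq0.
    by rewrite coproj_lie// YJ// ZJ// subr0.
  + by move=> Y _ YS; rewrite (lie_X0_at0 lH bB Bsym X0E) memvN lie_space_inv.
  + by move=> Y _ YS; rewrite memvN.
- by have [] := P1 br c1.
- by have [->|->] := bracket_count0 c0; rewrite ?X00 mem0v.
Qed.

End BracketValues.

(** * Taylor expansion of the system *)

Section Taylor.
Context {R : realType}.

Lemma mvt_bound (F G : R -> R) (M t : R) : 0 <= t <= 1 ->
  (forall x : R, is_derive x (1 : R) F (G x)) -> 0 <= M ->
  (forall x, 0 <= x <= 1 -> `|G x| <= M) -> `|F t - F 0| <= M.
Proof.
move=> /andP[t0 t1] dF M0 GM; have [->|tn0] := eqVneq t 0; first by rewrite subrr normr0.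
have tp : 0 < t by rewrite lt_neqAle eq_sym tn0.
have cF : continuous F.
  by move=> x; apply/differentiable_continuous/derivable1_diffP; have [] := dF x.
have [c] := @MVT R F G 0 t tp (fun x _ => dF x) (continuous_subspaceT cF).
rewrite in_itv/= => /andP[c0 ct] ->; rewrite subr0 normrM (gtr0_norm tp).
have H : `|G c| <= M by apply: GM; rewrite ltW// (le_trans (ltW ct)).
by apply: le_trans (ler_pM _ _ H t1) _ => //; rewrite mulr1.
Qed.

Definition dirder {V W : normedModType R} (v : V) (F : V -> W) : V -> W :=
  fun y => 'd F y v.

Lemma Ck_dirder (V W : normedModType R) k v (F : V -> W) : Ck k.+1 F -> Ck k (dirder v F).
Proof. by move=> [_]; exact. Qed.

Lemma is_derive_line (V : normedModType R) m (F : V -> 'rV[R]_m) (p v : V) (i : 'I_m) (t : R) :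
  Ck 1 F -> is_derive t (1 : R) (fun s : R => F (p + s *: v) 0 i) (dirder v F (p + t *: v) 0 i).
Proof.
move=> [dF _].
have dA (s : R) : is_diff s (fun s : R => p + s *: v) (fun s : R => s *: v).
  have H := is_diffD (is_diff_cst (p : V) s) (is_diff_scalel s v).
  have E : (0 : R -> V) + (fun s => s *: v) = (fun s => s *: v) by apply/funext => y; rewrite !fctE add0r.
  exact: (is_diff_eq H E).
have dA' : differentiable (fun s : R => p + s *: v) t by have [] := dA t.
have eA : 'd (fun s : R => p + s *: v) t 1 = v.
  have -> : 'd (fun s : R => p + s *: v) t = (fun s : R => s *: v) :> (R -> V) by have [_ ->] := dA t.
  by rewrite scale1r.
have dC : differentiable (fun s : R => F (p + s *: v)) t.
  exact: (@differentiable_comp _ _ _ _ (fun s : R => p + s *: v) F t dA' (dF _)).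
have eC : 'd (fun s : R => F (p + s *: v)) t 1 = dirder v F (p + t *: v).
  have := @diff_comp _ _ _ _ (fun s : R => p + s *: v) F t dA' (dF _).
  move=> /(congr1 (fun G => G 1)) E; apply: (eq_trans E).
  exact: (congr1 (fun w => 'd F (p + t *: v) w) eA).
have [d1 e1] := diff_coord (1 : R) i dC.
apply: DeriveDef; first exact/derivable1_diffP.
rewrite (deriveE _ d1); exact: (eq_trans e1 (congr1 (fun w : 'rV[R]_m => w 0 i) eC)).
Qed.

Lemma norm_row m (w : 'rV[R]_m) (M : R) : 0 <= M -> (forall i, `|w 0 i| <= M) -> `|w| <= M.
Proof.
move=> M0 wM; rewrite [leLHS]mx_normrE; apply/bigmax_leP; split=> // -[i j] _ /=.
by rewrite [i]ord1.
Qed.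

Lemma norm_row_coord m (w : 'rV[R]_m) i : `|w 0 i| <= `|w|.
Proof.
rewrite [leRHS]mx_normrE; exact: (le_bigmax _ (fun ij => `|w ij.1 ij.2|) (0, i)).
Qed.

Section Remainders.
Variables (V : normedModType R) (m : nat) (F : V -> 'rV[R]_m) (p v : V) (M : R).
Hypothesis M0 : 0 <= M.

Lemma taylor1 : Ck 1 F -> (forall t, 0 <= t <= 1 -> `|dirder v F (p + t *: v)| <= M) ->
  `|F (p + v) - F p| <= M.
Proof.
move=> CF FM; apply: norm_row => // i; rewrite !mxE.
have I1 : 0 <= (1 : R) <= 1 by rewrite ler01 lexx.
have := @mvt_bound _ _ M 1 I1 (fun t => is_derive_line p v i t CF) M0.
rewrite scale1r scale0r addr0; apply=> t t01.
exact: le_trans (norm_row_coord _ _) (FM t t01).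
Qed.

Lemma taylor2 : Ck 2 F ->
  (forall t, 0 <= t <= 1 -> `|dirder v (dirder v F) (p + t *: v)| <= M) ->
  `|F (p + v) - F p - dirder v F p| <= M.
Proof.
move=> CF FM; apply: norm_row => // i; rewrite !mxE.
have I1 : 0 <= (1 : R) <= 1 by rewrite ler01 lexx.
pose g0 t := F (p + t *: v) 0 i; pose g1 t := dirder v F (p + t *: v) 0 i.
pose h t := g0 t - g1 0 * t.
have dh (t : R) : is_derive t (1 : R) h (g1 t - g1 0).
  have d0 := is_derive_line p v i t (CkS CF).
  have d1 := is_deriveZ (g1 0) (is_derive_id t (1 : R)).
  have := is_deriveB d0 d1; rewrite /h /GRing.scale/= mulr1.
  exact.
have := @mvt_bound h _ M 1 I1 dh M0.
rewrite /h /g0 /g1 scale1r scale0r addr0 mulr0 mulr1 subr0 addrAC; apply=> t t01.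
have := @mvt_bound _ _ M t t01 (fun t => is_derive_line p v i t (Ck_dirder v CF)) M0.
rewrite scale0r addr0; apply=> s s01.
exact: le_trans (norm_row_coord _ _) (FM s s01).
Qed.

(** The mean value inequality is applied in turn to F minus its quadratic Taylor polynomial along
    the segment and to its successive derivatives. The factor 1/6 is given up, as the factor 1/2 was
    at order 2. *)
Lemma taylor3 : Ck 3 F ->
  (forall t, 0 <= t <= 1 -> `|dirder v (dirder v (dirder v F)) (p + t *: v)| <= M) ->
  `|F (p + v) - F p - dirder v F p - 2^-1 *: dirder v (dirder v F) p| <= M.
Proof.
move=> CF FM; apply: norm_row => // i; rewrite !mxE.
have I1 : 0 <= (1 : R) <= 1 by rewrite ler01 lexx.
pose g0 t := F (p + t *: v) 0 i; pose g1 t := dirder v F (p + t *: v) 0 i.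
pose g2 t := dirder v (dirder v F) (p + t *: v) 0 i.
pose h1 t := g1 t - g2 0 * t.
pose h0 t := g0 t - g1 0 * t - (2^-1 * g2 0) * t ^+ 2.
have dX (t : R) : is_derive t (1 : R) (fun t : R => t ^+ 2) (2 * t).
  have := is_deriveX 2 (is_derive_id t (1 : R)).
  by move/is_derive_eq; apply; rewrite /GRing.scale/= mulr1 expr1.
have d1 (t : R) : is_derive t (1 : R) h1 (g2 t - g2 0).
  have d0 := is_derive_line p v i t (CkS (Ck_dirder v CF)).
  have d1 := is_deriveZ (g2 0) (is_derive_id t (1 : R)).
  have := is_deriveB d0 d1; rewrite /h1 /GRing.scale/= mulr1.
  exact.
have d0 (t : R) : is_derive t (1 : R) h0 (h1 t - h1 0).
  have d0 := is_derive_line p v i t (CkS (CkS CF)).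
  have d2 := is_deriveZ (g1 0) (is_derive_id t (1 : R)).
  have d3 := is_deriveZ (2^-1 * g2 0) (dX t).
  have H := is_deriveB (is_deriveB d0 d2) d3.
  refine (@is_derive_eq _ _ _ h0 t 1 _ _ H _).
  change (g1 t - g1 0 * 1 - 2^-1 * g2 0 * (2 * t) = (g1 t - g2 0 * t) - (g1 0 - g2 0 * 0)).
  by move: (g1 t) (g1 0) (g2 0) => x y z; field.
have := @mvt_bound h0 _ M 1 I1 d0 M0.
rewrite /h0 /g0 scale1r scale0r addr0 mulr0 expr1n !mulr1 expr0n/= mulr0 !subr0.
rewrite /g1 /g2 scale0r addr0 => H.
have alg (x y z w : R) : x - y - z - w = x - z - w - y by ring.
rewrite alg; apply: H => t t01.
apply: (@mvt_bound h1 _ M t t01 d1 M0) => s s01.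
have := @mvt_bound _ _ M s s01 (fun t => is_derive_line p v i t (Ck_dirder v (Ck_dirder v CF))) M0.
rewrite scale0r addr0 /g2 scale0r addr0; apply=> r r01.
exact: le_trans (norm_row_coord _ _) (FM r r01).
Qed.
End Remainders.

Lemma iter_dirder_sum (V : normedModType R) m k (v : V) (I : Type) (r : seq I) (c : I -> R)
  (F : I -> V -> 'rV[R]_m) : (forall i, Ck k (F i)) ->
  iter k (dirder v) (fun y => \sum_(i <- r) c i *: F i y) =
  (fun y => \sum_(i <- r) c i *: iter k (dirder v) (F i) y).
Proof.
elim: k F => [//|k IH] F CF; rewrite iterSr.
have -> : dirder v (fun y => \sum_(i <- r) c i *: F i y) =
          (fun y => \sum_(i <- r) c i *: dirder v (F i) y).
  apply/funext => y.
  have dF i : differentiable (fun y => c i *: F i y) y.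
    by apply: differentiableZ; have [] := CF i.
  apply: (eq_trans (diff_sum r v dF).2); apply: eq_bigr => i _.
  exact: (congr1 (fun G => G v) (diffZ (c i) ((CF i).1 y))).
rewrite IH; last by move=> i; exact: Ck_dirder.
by apply/funext => y; apply: eq_bigr => i _; rewrite iterSr.
Qed.

Lemma iter_dirder_scale (V : normedModType R) m k (v : V) (a : R) (F : V -> 'rV[R]_m) :
  Ck k F -> iter k (dirder (a *: v)) F = (fun y => a ^+ k *: iter k (dirder v) F y).
Proof.
elim: k F => [|k IH] F CF; first by apply/funext => y; rewrite expr0 scale1r.
rewrite iterSr.
have -> : dirder (a *: v) F = (fun y => \sum_(i <- [:: tt]) a *: dirder v F y).
  by apply/funext => y; rewrite big_seq1; exact: linearZ.
rewrite iter_dirder_sum; last by move=> _; exact: Ck_dirder.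
apply/funext => y; rewrite big_seq1 IH; last exact: Ck_dirder.
by rewrite scalerA -exprS -iterSr.
Qed.

(** Expanding one direction v in the canonical basis reduces order k + 1 to order k for the partial
    derivatives; the neighbourhood does not depend on v. *)
Lemma iter_dirder_bound n m k (F : 'rV[R]_n -> 'rV[R]_m) : Ck k F ->
  exists2 C : R, 0 < C & \forall y \near (0 : 'rV[R]_n), forall v,
    `|iter k (dirder v) F y| <= C * `|v| ^+ k.
Proof.
elim: k F => [F cF|k IH F CF].
  exists (`|F 0| + 1); first by rewrite ltr_wpDl.
  have /cvgrPdist_le/(_ _ ltr01) := cF 0; apply: filterS => y Hy v /=.
  rewrite expr0 mulr1 -[F y](subrK (F 0)) addrC (le_trans (ler_normD _ _))// lerD2l.
  by rewrite distrC.
pose Fi (i : 'I_n) := dirder (delta_mx 0 i) F.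
have CFi i : Ck k (Fi i) by exact: Ck_dirder.
have /choice[C HC] : forall i, exists C : R, 0 < C /\
    \forall y \near (0 : 'rV[R]_n), forall v, `|iter k (dirder v) (Fi i) y| <= C * `|v| ^+ k.
  by move=> i; have [C ? ?] := IH _ (CFi i); exists C.
exists (\sum_i C i + 1).
  by rewrite ltr_wpDl// sumr_ge0// => i _; have [/ltW] := HC i.
have := filter_forall (nbhs_filter _) (fun i => (HC i).2).
apply: filterS => y Hy v; rewrite iterSr.
have -> : dirder v F = (fun y => \sum_i v 0 i *: Fi i y).
  by apply/funext => z; refine (@linear_row_sum R n m (fun w => 'd F z w) v _) => a u w; exact: linearP.
rewrite iter_dirder_sum//; apply: le_trans (ler_norm_sum _ _ _) _.
apply: (@le_trans _ _ (\sum_i C i * `|v| ^+ k.+1)).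
  apply: ler_sum => i _; rewrite normrZ exprS mulrCA.
  by apply: ler_pM => //; exact: norm_row_coord.
rewrite -mulr_suml mulrDl lerDl mul1r; exact: exprn_ge0.
Qed.

Lemma bilin_symmetrize n (B : 'rV[R]_n -> 'rV[R]_n -> 'rV[R]_n) :
  bilin B -> bilin (fun v w => 2^-1 *: (B v w + B w v)).
Proof.
move=> [B1 B2]; have alg (a : R) (x y z t : 'rV[R]_n) :
    2^-1 *: ((a *: x + y) + (a *: z + t)) = a *: (2^-1 *: (x + z)) + 2^-1 *: (y + t).
  by apply/rowP => k; rewrite !mxE; ring.
by split=> [v|w] a x y; rewrite B1 B2 alg.
Qed.

End Taylor.

Section SystemJets.
Context {R : realType} {n : nat}.
Notation V := 'rV[R]_n.
Variable f : V * R -> V.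
Hypothesis fC3 : Ck 3 f.

Let e1 : V * R := (0, 1).
Let inx (x : V) : V * R := (x, 0).

Lemma is_diff_inx (x : V) : is_diff x inx inx.
Proof.
have H := is_diff_pair (is_diff_id x) (is_diff_cst (0 : R) x).
exact: (is_diff_eq H (erefl _)).
Qed.

Definition ctrl_der (k : nat) (x : V) : V := iter k (dirder e1) f (x, 0).

Lemma Ck_ctrl_der k l : (k + l <= 3)%N -> Ck l (ctrl_der k).
Proof.
move=> kl; apply: (@Ck_compaff _ _ _ _ inx inx l (iter k (dirder e1) f) is_diff_inx).
elim: k l kl => [|k IH] l kl; first exact: CkW fC3.
by apply: Ck_dirder; apply: IH; rewrite addnS.
Qed.

Lemma Ck_drift : Ck 3 (drift f).
Proof. exact: (@Ck_ctrl_der 0 3). Qed.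

Lemma derive1_line (F : V * R -> V) (x : V) (u : R) : Ck 1 F ->
  derive1 (fun s : R => F (x, s)) u = dirder e1 F (x, u).
Proof.
move=> [dF _].
have D : is_diff u (fun s : R => (x, s)) (fun s : R => (0 : V, s)).
  have H := is_diff_pair (is_diff_cst x u) (is_diff_id u).
  exact: (is_diff_eq H (erefl _)).
have dA : differentiable (fun s : R => (x, s)) u by have [] := D.
have eA : 'd (fun s : R => (x, s)) u 1 = e1.
  have -> : 'd (fun s : R => (x, s)) u = (fun s : R => (0 : V, s)) :> (R -> V * R) by have [_ ->] := D.
  by [].
have dC : differentiable (fun s : R => F (x, s)) u.
  exact: (@differentiable_comp _ _ _ _ (fun s : R => (x, s)) F u dA (dF _)).
rewrite derive1E (deriveE _ dC).
have E := congr1 (fun G => G 1) (@diff_comp _ _ _ _ (fun s : R => (x, s)) F u dA (dF _)).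
exact: (eq_trans E (congr1 (fun w => 'd F (x, u) w) eA)).
Qed.

Lemma ctrl_fieldE : ctrl_field f = ctrl_der 1.
Proof. by apply/funext => x; apply: derive1_line; exact: CkW fC3. Qed.

Lemma ctrl_secondE : ctrl_second f = ctrl_der 2 0.
Proof.
rewrite /ctrl_second /derive1n /=.
have -> : derive1 (fun u : R => f (0, u)) = (fun u => dirder e1 f (0, u)).
  by apply/funext => u; apply: derive1_line; exact: CkW fC3.
by apply: derive1_line; apply: Ck_dirder; exact: CkW fC3.
Qed.

Let H (v : V) : V := 'd (drift f) 0 v.
Let L (v : V) : V := 'd (ctrl_field f) 0 v.
Let Bq (v w : V) : V := 'd (fun y => 'd (drift f) y v) 0 w.

(** [drift_hat] involves only the diagonal values. Symmetrizing keeps them and supplies the symmetry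
    on which the normal form relies. *)
Definition drift_bil (v w : V) : V := 2^-1 *: (Bq v w + Bq w v).

Lemma bilin_Bq : bilin Bq.
Proof.
split=> [v|w]; first exact: linearP.
move=> a u v; rewrite /Bq.
have [dD cD] := CkS Ck_drift.
have d1 u' : differentiable (fun y => 'd (drift f) y u') 0 by have [] := cD u'.
have E : (fun y => 'd (drift f) y (a *: u + v)) =
         (a \*: (fun y => 'd (drift f) y u)) + (fun y => 'd (drift f) y v).
  by apply/funext => y; exact: linearP.
rewrite E; have dZ := differentiableZ a (d1 u).
apply: (eq_trans (congr1 (fun G => G w) (diffD dZ (d1 v)))).
exact: (congr1 (fun z => z + 'd (fun y => 'd (drift f) y v) 0 w)
          (congr1 (fun G => G w) (diffZ a (d1 u)))).
Qed.

Lemma bilin_drift_bil : bilin drift_bil.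
Proof.
exact: bilin_symmetrize bilin_Bq.
Qed.

Lemma drift_bil_sym v w : drift_bil v w = drift_bil w v.
Proof. by rewrite /drift_bil addrC. Qed.

Lemma drift_bilxx v : drift_bil v v = Bq v v.
Proof.
have alg (z : V) : 2^-1 *: (z + z) = z by apply/rowP => k; rewrite !mxE; field.
exact: alg.
Qed.

Lemma drift_hatE x : f (0, 0) = 0 -> drift_hat f x = H x + 2^-1 *: drift_bil x x.
Proof. by move=> f00; rewrite drift_bilxx /drift_hat {1}/drift f00 add0r. Qed.

(** At fixed x, f is expanded to third order in u around u = 0; the coefficients f_0, f_1 and
    \partial_u^2 f(., 0) are then expanded in x with remainders of order 3, 2 and 1, so that every
    remainder has total degree 3. This uses exactly three derivatives. *)
Lemma taylor_system : f (0, 0) = 0 ->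
  exists rho C : R, [/\ 0 < rho, 0 < C & forall x u, `|x| <= rho -> `|u| <= rho ->
    `|f (x, u) - (H x + u *: ctrl_field f 0 + 2^-1 *: drift_bil x x + u *: L x +
       (2^-1 * u ^+ 2) *: ctrl_second f)| <= C * (`|x| + `|u|) ^+ 3].
Proof.
move=> f00.
have [C0 C00 N0] := iter_dirder_bound Ck_drift.
have [C1 C10 N1] := iter_dirder_bound (@Ck_ctrl_der 1 2 isT).
have [C2 C20 N2] := iter_dirder_bound (@Ck_ctrl_der 2 1 isT).
have c3 : continuous (iter 3 (dirder e1) f) by exact: (Ck_dirder e1 (Ck_dirder e1 (Ck_dirder e1 fC3))).
have /cvgrPdist_le/(_ _ ltr01) N3 := c3 (0, 0).
have /nbhs_normP[r0 /= r00 B0] := N0.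
have /nbhs_normP[r1 /= r10 B1] := N1.
have /nbhs_normP[r2 /= r20 B2] := N2.
have /nbhs_normP[r3 /= r30 B3] := N3.
pose C3 := `|iter 3 (dirder e1) f (0, 0)| + 1.
have C30 : 0 < C3 by rewrite ltr_wpDl.
pose rho := Num.min (Num.min r0 r1) (Num.min r2 r3) / 2.
have m0 : 0 < Num.min (Num.min r0 r1) (Num.min r2 r3) by rewrite !lt_min r00 r10 r20 r30.
have rho0 : 0 < rho by rewrite /rho; lra.
have : rho < Num.min (Num.min r0 r1) (Num.min r2 r3) by rewrite /rho; lra.
rewrite !lt_min => /andP[/andP[h0 h1] /andP[h2 h3]].
have CC0 : 0 < C0 + C1 + C2 + C3.
  by apply: addr_gt0 => //; apply: addr_gt0 => //; apply: addr_gt0.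
exists rho, (C0 + C1 + C2 + C3); split=> [//|//|x u xr ur].
have xt t : 0 <= t <= 1 -> `|t *: x| <= rho.
  move=> /andP[t0 t1]; rewrite normrZ ger0_norm//.
  by apply: le_trans xr; rewrite ler_piMl.
have T0 : `|f (x, 0) - H x - 2^-1 *: drift_bil x x| <= C0 * `|x| ^+ 3.
  have M0 : 0 <= C0 * `|x| ^+ 3 by rewrite mulr_ge0 ?exprn_ge0// ltW.
  have := taylor3 (p := 0) (v := x) M0 Ck_drift.
  rewrite drift_bilxx !add0r /drift f00 subr0; apply=> t t01; rewrite add0r.
  by apply: B0; rewrite /= sub0r normrN (le_lt_trans (xt _ t01)).
have T1 : `|ctrl_field f x - ctrl_field f 0 - L x| <= C1 * `|x| ^+ 2.
  have M0 : 0 <= C1 * `|x| ^+ 2 by rewrite mulr_ge0 ?exprn_ge0// ltW.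
  have := taylor2 (p := 0) (v := x) M0 (@Ck_ctrl_der 1 2 isT).
  rewrite !add0r /L ctrl_fieldE; apply=> t t01; rewrite add0r.
  by apply: B1; rewrite /= sub0r normrN (le_lt_trans (xt _ t01)).
have T2 : `|ctrl_der 2 x - ctrl_second f| <= C2 * `|x|.
  have M0 : 0 <= C2 * `|x| by rewrite mulr_ge0// ltW.
  have := taylor1 (p := 0) (v := x) M0 (@Ck_ctrl_der 2 1 isT).
  rewrite ctrl_secondE !add0r; apply=> t t01; rewrite add0r -[X in _ * X]expr1.
  by apply: B2; rewrite /= sub0r normrN (le_lt_trans (xt _ t01)).
have T3 : `|f (x, u) - f (x, 0) - u *: ctrl_field f x - (2^-1 * u ^+ 2) *: ctrl_der 2 x|
    <= C3 * `|u| ^+ 3.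
  have M0 : 0 <= C3 * `|u| ^+ 3 by rewrite mulr_ge0 ?exprn_ge0// ltW.
  have norm_B3 y : `|(0, 0) - y| < r3 -> `|iter 3 (dirder e1) f y| <= C3.
    move=> /B3/= h; rewrite -[X in `|X|](subrK (iter 3 (dirder e1) f (0, 0))).
    rewrite (le_trans (ler_normD _ _))// addrC lerD2l distrC; exact: h.
  have near3 t : 0 <= t <= 1 -> `|((0 : V), (0 : R)) - ((x, 0) + t *: (0 : V, u))| < r3.
    move=> /andP[t0 t1].
    have -> : ((0 : V), (0 : R)) - ((x, 0) + t *: (0 : V, u)) = (- x, - (t * u)).
      by congr pair; rewrite /= ?scaler0 ?addr0 ?add0r ?sub0r.
    rewrite [X in X < _]prod_normE/= !normrN gt_max; apply/andP; split.
      exact: le_lt_trans xr h3.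
    rewrite normrM (ger0_norm t0); apply: le_lt_trans h3; apply: le_trans ur.
    by rewrite ler_piMl.
  have it k y : (k <= 3)%N -> iter k (dirder (0 : V, u)) f y = u ^+ k *: iter k (dirder e1) f y.
    move=> k3; have -> : (0 : V, u) = u *: e1 by congr pair; rewrite /= ?scaler0// /GRing.scale/= mulr1.
    by rewrite (iter_dirder_scale _ _ (CkW k3 fC3)).
  have i1 : dirder (0, u) f (x, 0) = u *: ctrl_der 1 x by have := it 1%N (x, 0) isT; rewrite expr1.
  have i2 : dirder (0, u) (dirder (0, u) f) (x, 0) = u ^+ 2 *: ctrl_der 2 x by exact: (it 2%N (x, 0) isT).
  have i3 y : dirder (0, u) (dirder (0, u) (dirder (0, u) f)) y = u ^+ 3 *: iter 3 (dirder e1) f y.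
    exact: (it 3%N y isT).
  have alg (F F0 F1 F2 c s : V) (M : R) : F1 = u *: c -> F2 = u ^+ 2 *: s ->
      `|F - F0 - F1 - 2^-1 *: F2| <= M -> `|F - F0 - u *: c - (2^-1 * u ^+ 2) *: s| <= M.
    by move=> -> ->; rewrite scalerA.
  rewrite ctrl_fieldE; apply: (alg _ _ _ _ _ _ _ i1 i2).
  have xu : ((x, 0) : V * R) + (0, u) = (x, u) by congr pair; rewrite /= ?addr0 ?add0r.
  rewrite -xu; apply: (taylor3 M0 fC3) => t t01.
  rewrite i3 normrZ normrX mulrC ler_wpM2r ?exprn_ge0//.
  apply: norm_B3; exact: near3.
clear N0 N1 N2 N3 B0 B1 B2 B3 c3 h0 h1 h2 h3 m0 xt.
move: T0 T1 T2 T3; move: (f (x, u)) (f (x, 0)) (H x) (drift_bil x x) (ctrl_field f x) (ctrl_field f 0) (L x) (ctrl_der 2 x) (ctrl_second f) => F F0 h b c c0 l s s0 T0 T1 T2 T3.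
have -> : F - (h + u *: c0 + 2^-1 *: b + u *: l + (2^-1 * u ^+ 2) *: s0) =
  (F - F0 - u *: c - (2^-1 * u ^+ 2) *: s) + (F0 - h - 2^-1 *: b) + u *: (c - c0 - l) +
  (2^-1 * u ^+ 2) *: (s - s0) by apply/rowP => k; rewrite !mxE; ring.
apply: le_trans (ler_normD _ _) _; apply: le_trans (lerD (ler_normD _ _) (lexx _)) _.
apply: le_trans (lerD (lerD (ler_normD _ _) (lexx _)) (lexx _)) _.
rewrite normrZ [`|_ *: (s - s0)|]normrZ normrM normrX [`|2^-1|]ger0_norm ?invr_ge0//.
have X0 := normr_ge0 x; have U0 := normr_ge0 u.
move: T0 T1 T2 T3 X0 U0; set X := `|x|; set U := `|u| => T0 T1 T2 T3 X0 U0.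
have E1 := ler_wpM2l U0 T1.
have U2 : 0 <= 2^-1 * U ^+ 2 by rewrite mulr_ge0 ?invr_ge0 ?exprn_ge0.
have E2 := ler_wpM2l U2 T2.
have S3 (C a : R) : 0 < C -> 0 <= a -> a <= (X + U) ^+ 3 -> C * a <= C * (X + U) ^+ 3.
  by move=> c1 _ /(ler_wpM2l (ltW c1)).
have P1 : 0 <= X ^+ 3 by rewrite exprn_ge0.
have P2 : 0 <= U ^+ 3 by rewrite exprn_ge0.
have P3 : 0 <= X ^+ 2 * U by rewrite mulr_ge0 ?exprn_ge0.
have P4 : 0 <= U ^+ 2 * X by rewrite mulr_ge0 ?exprn_ge0.
have EX : (X + U) ^+ 3 = X ^+ 3 + U ^+ 3 + 3 * (X ^+ 2 * U) + 3 * (U ^+ 2 * X) by ring.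
have F1 : C0 * X ^+ 3 <= C0 * (X + U) ^+ 3 by rewrite ler_wpM2l ?(ltW C00)// EX; lra.
have F2 : C3 * U ^+ 3 <= C3 * (X + U) ^+ 3 by rewrite ler_wpM2l ?(ltW C30)// EX; lra.
have F3 : C1 * (X ^+ 2 * U) <= C1 * (X + U) ^+ 3 by rewrite ler_wpM2l ?(ltW C10)// EX; lra.
have F4 : C2 * (2^-1 * (U ^+ 2 * X)) <= C2 * (X + U) ^+ 3 by rewrite ler_wpM2l ?(ltW C20)// EX; lra.
have G1 : U * (C1 * X ^+ 2) = C1 * (X ^+ 2 * U) by ring.
have G2 : 2^-1 * U ^+ 2 * (C2 * X) = C2 * (2^-1 * (U ^+ 2 * X)) by ring.
rewrite G1 in E1; rewrite G2 in E2.
have -> : (C0 + C1 + C2 + C3) * (X + U) ^+ 3 = C0 * (X + U) ^+ 3 + C1 * (X + U) ^+ 3 +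
    C2 * (X + U) ^+ 3 + C3 * (X + U) ^+ 3 by rewrite !mulrDl.
apply: le_trans (lerD (lerD (lerD T3 T0) E1) E2) _.
move: F1 F2 F3 F4; lra.
Qed.
End SystemJets.

(** * Estimates along trajectories *)

Section VectorPrimitives.
Context {R : realType}.

Lemma lin_bound n m (A : 'rV[R]_n -> 'rV[R]_m) : linear A ->
  exists2 C : R, 0 < C & forall x, `|A x| <= C * `|x|.
Proof.
move=> lA; exists (\sum_i `|A (delta_mx 0 i)| + 1).
  by rewrite ltr_wpDl// sumr_ge0.
move=> x; rewrite (linear_row_sum x lA); apply: le_trans (ler_norm_sum _ _ _) _.
apply: (@le_trans _ _ ((\sum_i `|A (delta_mx 0 i)|) * `|x|)).
  rewrite mulr_suml; apply: ler_sum => i _; rewrite normrZ mulrC.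
  by rewrite ler_wpM2l// norm_row_coord.
by rewrite ler_wpM2r// lerDl.
Qed.

Lemma bilin_bound n (B : 'rV[R]_n -> 'rV[R]_n -> 'rV[R]_n) : bilin B ->
  exists2 C : R, 0 < C & forall x y, `|B x y| <= C * `|x| * `|y|.
Proof.
move=> [B1 B2].
have /choice[C HC] : forall i : 'I_n, exists C : R, 0 < C /\
    forall y, `|B (delta_mx 0 i) y| <= C * `|y|.
  by move=> i; have [C ? ?] := lin_bound (B1 (delta_mx 0 i)); exists C.
have C0 i : 0 <= C i by have [/ltW] := HC i.
exists (\sum_i C i + 1); first by rewrite ltr_wpDl// sumr_ge0.
move=> x y; rewrite (linear_row_sum x (B2 y)); apply: le_trans (ler_norm_sum _ _ _) _.
apply: (@le_trans _ _ ((\sum_i C i) * `|x| * `|y|)).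
  rewrite !mulr_suml; apply: ler_sum => i _; rewrite normrZ mulrAC mulrC.
  by apply: ler_pM => //; [exact: (HC i).2|exact: norm_row_coord].
by rewrite ler_wpM2r// ler_wpM2r// lerDl.
Qed.

Lemma dot_bound n (x y : 'rV[R]_n) : `|dot x y| <= n%:R * `|x| * `|y|.
Proof.
rewrite /dot; apply: le_trans (ler_norm_sum _ _ _) _.
apply: (@le_trans _ _ (\sum_(i < n) `|x| * `|y|)).
  apply: ler_sum => i _; rewrite normrM.
  by apply: ler_pM => //; exact: norm_row_coord.
by rewrite sumr_const card_ord -mulrA mulr_natl.
Qed.

Definition vprim n (T : R) (X F : R -> 'rV[R]_n) : Prop :=
  forall i, prim T (fun s => X s 0 i) (fun s => F s 0 i).

Lemma primS T T' (F g : R -> R) : T' <= T -> prim T F g -> prim T' F g.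
Proof.
move=> TT [bg H]; split; first exact: bmfS bg.
by move=> t /andP[t0 tT]; rewrite H// t0 (le_trans tT).
Qed.

Lemma vprim_scal n T (F g : R -> R) (c : 'rV[R]_n) : prim T F g ->
  vprim T (fun s => F s *: c) (fun s => g s *: c).
Proof.
move=> pF i; apply: (prim_eq (primZ (c 0 i) pF)) => t; first by move=> _; rewrite mxE mulrC.
by rewrite mxE mulrC.
Qed.

Lemma vprim_sum n T (I : Type) (r : seq I) (P : pred I) (X F : I -> R -> 'rV[R]_n) :
  (forall i, P i -> vprim T (X i) (F i)) ->
  vprim T (fun s => \sum_(i <- r | P i) X i s) (fun s => \sum_(i <- r | P i) F i s).
Proof.
move=> H j; have := @prim_sum R T I r P (fun i s => X i s 0 j) (fun i s => F i s 0 j) (fun i Pi => H i Pi j).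
by move/prim_eq; apply=> t *; rewrite summxE.
Qed.

Lemma vprimB n T (X F Y E : R -> 'rV[R]_n) : vprim T X F -> vprim T Y E ->
  vprim T (fun s => X s - Y s) (fun s => F s - E s).
Proof.
by move=> vX vY j; apply: (prim_eq (primB' (vX j) (vY j))) => t *; rewrite !mxE.
Qed.

Lemma vprim_eq n T (X F X' F' : R -> 'rV[R]_n) : vprim T X F ->
  (forall t, 0 <= t <= T -> X' t = X t) -> (forall t, F' t = F t) -> vprim T X' F'.
Proof. by move=> vX HX HF j; apply: (prim_eq (vX j)) => t *; rewrite ?HX// HF. Qed.

Lemma vprim_lin n m T (A : 'rV[R]_n -> 'rV[R]_m) (X F : R -> 'rV[R]_n) : linear A ->
  vprim T X F -> vprim T (fun s => A (X s)) (fun s => A (F s)).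
Proof.
move=> lA vX; have E (Z : R -> 'rV[R]_n) t : A (Z t) = \sum_i Z t 0 i *: A (delta_mx 0 i).
  exact: linear_row_sum.
apply: (@vprim_eq _ _ (fun s => \sum_i X s 0 i *: A (delta_mx 0 i))
          (fun s => \sum_i F s 0 i *: A (delta_mx 0 i))) => //.
by apply: vprim_sum => i _; exact: vprim_scal.
Qed.

Lemma vprim_bilin n T (B : 'rV[R]_n -> 'rV[R]_n -> 'rV[R]_n) (X F Y E : R -> 'rV[R]_n) :
  bilin B -> vprim T X F -> vprim T Y E ->
  vprim T (fun s => B (X s) (Y s)) (fun s => B (F s) (Y s) + B (X s) (E s)).
Proof.
move=> bB vX vY.
have E2 (Z W : R -> 'rV[R]_n) t : B (Z t) (W t) =
    \sum_i \sum_j (Z t 0 i * W t 0 j) *: B (delta_mx 0 i) (delta_mx 0 j).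
  rewrite (linear_row_sum (Z t) (bB.2 (W t))); apply: eq_bigr => i _.
  rewrite (linear_row_sum (W t) (bB.1 _)) scaler_sumr.
  by apply: eq_bigr => j _; rewrite scalerA.
apply: (@vprim_eq _ _
  (fun s => \sum_i \sum_j (X s 0 i * Y s 0 j) *: B (delta_mx 0 i) (delta_mx 0 j))
  (fun s => \sum_i \sum_j (F s 0 i * Y s 0 j + X s 0 i * E s 0 j) *:
     B (delta_mx 0 i) (delta_mx 0 j))) => [|t _|t]; last 2 first.
- exact: E2.
- rewrite (E2 F Y) (E2 X E) -big_split/=; apply: eq_bigr => i _.
  by rewrite -big_split/=; apply: eq_bigr => j _; rewrite scalerDl.
apply: vprim_sum => i _; apply: vprim_sum => j _; apply: vprim_scal.
by apply: primM.
Qed.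

Lemma prim_dot n T (nu : 'rV[R]_n) (X F : R -> 'rV[R]_n) : vprim T X F ->
  prim T (fun s => dot (X s) nu) (fun s => dot (F s) nu).
Proof.
move=> vX; apply: (@prim_eq _ _ (fun s => \sum_i nu 0 i * X s 0 i)
   (fun s => \sum_i nu 0 i * F s 0 i)) => [|t _|t].
- by apply: prim_sum => i _; exact: primZ.
- by apply: eq_bigr => i _; rewrite mulrC.
- by apply: eq_bigr => i _; rewrite mulrC.
Qed.

Lemma vprim_bound n T (X F : R -> 'rV[R]_n) (h : R -> R) t : vprim T X F -> bmf T h ->
  (forall s, 0 < s < T -> `|F s| <= h s) -> 0 <= t <= T ->
  `|X t - X 0| <= intg 0 t h.
Proof.
move=> vX bh Fh /andP[t0 tT]; have Fh' s : 0 < s < t -> `|F s| <= h s.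
  by move=> /andP[s0 st]; apply: Fh; rewrite s0 (lt_le_trans st).
apply: norm_row => [|i].
  by apply: intg_ge0 => s /Fh'; apply: le_trans.
have [bF Xt] := vX i; rewrite !mxE Xt ?t0// addrAC subrr add0r.
apply: le_trans (intg_norm (lexx 0) tT bF) _; apply: (intg_le (lexx 0) tT) => //.
  exact: bmf_norm.
by move=> s /Fh'; apply: le_trans; exact: norm_row_coord.
Qed.

Lemma vprim_norm_continuous n T (X F : R -> 'rV[R]_n) : vprim T X F ->
  {within `[0, T], continuous (fun s => `|X s|)}.
Proof.
move=> vX.
have /choice[M HM] : forall i, exists M : R, 0 <= M /\ forall s t, 0 <= s <= T -> 0 <= t <= T ->
    `|X t 0 i - X s 0 i| <= M * `|t - s|.
  by move=> i; have [M ? ?] := prim_lip (vX i); exists M.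
apply: (@lip_continuous _ _ (\sum_i M i)) => s t sT tT.
apply: le_trans (ler_dist_dist _ _) _; apply: norm_row => [|i].
  by rewrite mulr_ge0// sumr_ge0// => i _; have [] := HM i.
rewrite !mxE; have [_ /(_ s t sT tT) H] := HM i; apply: le_trans H _.
rewrite ler_wpM2r// (bigD1 i)//= lerDl sumr_ge0// => j _; by have [] := HM j.
Qed.
End VectorPrimitives.

(** * Evolution of the gap along a curve *)

Section GapExpansion.
Context {R : realType} {n : nat}.
Notation V := 'rV[R]_n.
Variables (S : {vspace V}) (F : V -> R -> V) (H L : V -> V) (B G : V -> V -> V) (b q : V).
Hypotheses (lH : linear H) (lL : linear L) (bB : bilin B) (bG : bilin G).
Hypotheses (HS : forall v, v \in S -> H v \in S) (bS : b \in S).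
Hypothesis Gsym : forall x y, x \in S -> y \in S -> G x y = G y x.
Notation P := (orthoproj S).
Notation Pp := (coproj S).
Hypothesis Gb : forall y, y \in S -> Pp (L y) = 2 *: G b y.

Definition quad_jet (x : V) (u : R) : V :=
  H x + u *: b + 2^-1 *: B x x + u *: L x + (2^-1 * u ^+ 2) *: q.

Variables (rho CT : R).
Hypotheses (rho0 : 0 < rho) (CT0 : 0 < CT).
Hypothesis taylorF : forall x u, `|x| <= rho -> `|u| <= rho ->
  `|F x u - quad_jet x u| <= CT * (`|x| + `|u|) ^+ 3.

(** The diagonal of [nf_defect], for an abstract G: the quadratic part of the derivative of the gap
    along the drift, at points of S. *)
Definition resonance (y : V) : V :=
  2^-1 *: Pp (B y y) + Pp (H (G y y)) - G (H y) y - G y (H y).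

Definition gapG (x : V) : V := Pp x - G (P x) (P x).

Definition gapG_der (x v : V) : V := Pp v - (G (P v) (P x) + G (P x) (P v)).

Let lP := linear_orthoproj S.
Let lPp := linear_coproj S.

Lemma quad_jet_bound : exists2 C : R, 0 < C & forall x u, `|x| <= 1 -> `|u| <= 1 ->
  `|quad_jet x u - H x - u *: b| <= C * (`|x| + `|u|) ^+ 2.
Proof.
have [cB cB0 hB] := bilin_bound bB; have [cL cL0 hL] := lin_bound lL.
exists (cB + cL + `|q|); first by rewrite ltr_pwDl ?addr_gt0.
move=> x u x1 u1; rewrite /quad_jet.
have -> : H x + u *: b + 2^-1 *: B x x + u *: L x + (2^-1 * u ^+ 2) *: q - H x - u *: b =
  2^-1 *: B x x + u *: L x + (2^-1 * u ^+ 2) *: q by apply/rowP => k; rewrite !mxE; ring.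
apply: le_trans (ler_normD _ _) _; apply: le_trans (lerD (ler_normD _ _) (lexx _)) _.
rewrite normrZ [`|u *: _|]normrZ [`|_ *: q|]normrZ normrM normrX [`|2^-1|]ger0_norm ?invr_ge0//.
have X0 := normr_ge0 x; have U0 := normr_ge0 u; have q0 := normr_ge0 q.
move: X0 U0 (hB x x) (hL x) q0; set X := `|x|; set U := `|u|; set Q := `|q| => X0 U0 hb hl q0.
have E2 := ler_wpM2l U0 hl.
have P1 : 0 <= X ^+ 2 by rewrite exprn_ge0.
have P2 : 0 <= U ^+ 2 by rewrite exprn_ge0.
have P3 : 0 <= X * U by rewrite mulr_ge0.
have EX : (X + U) ^+ 2 = X ^+ 2 + U ^+ 2 + 2 * (X * U) by ring.
have F1 : cB * (X ^+ 2) <= cB * (X + U) ^+ 2 by rewrite ler_wpM2l ?(ltW cB0)// EX; lra.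
have F2 : cL * (U * X) <= cL * (X + U) ^+ 2 by rewrite ler_wpM2l ?(ltW cL0)// EX; lra.
have F3 : Q * (2^-1 * U ^+ 2) <= Q * (X + U) ^+ 2 by rewrite ler_wpM2l// EX; lra.
have N0 := normr_ge0 (B x x).
rewrite !mulrDl; move: F1 F2 F3 E2 hb N0; rewrite -[cB * X * X]mulrA -expr2.
rewrite [U * (cL * X)]mulrCA [Q * (2^-1 * _)]mulrC.
set a1 := cB * X ^+ 2; set a2 := cL * (U * X); set a3 := _ * Q; set a4 := `|B x x|.
by move=> F1 F2 F3 E2 hb N0; lra.
Qed.

(** The third bound holds because Pp b = 0 and Pp H = Pp H Pp: at first order, Pp x is driven by
    itself alone, which is why it is quadratic in the control. *)
Lemma field_bounds : exists2 C : R, 0 < C & forall x u, `|x| <= Num.min rho 1 -> `|u| <= Num.min rho 1 ->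
  [/\ `|F x u| <= C * (`|x| + `|u|),
      `|F x u - H x - u *: b| <= C * (`|x| + `|u|) ^+ 2 &
      `|Pp (F x u)| <= C * (`|Pp x| + (`|x| + `|u|) ^+ 2)].
Proof.
have [cJ cJ0 hJ] := quad_jet_bound; have [cH cH0 hH] := lin_bound lH.
have [cP cP0 hP] := lin_bound lPp.
pose c2 := cJ + 2 * CT; have c20 : 0 < c2 by rewrite addr_gt0 ?mulr_gt0.
exists (cH + `|b| + 2 * c2 + cP * (cH + c2)).
  have cc := mulr_gt0 cP0 (addr_gt0 cH0 c20).
  have := normr_ge0 b; lra.
move=> x u; rewrite !le_min => /andP[xr x1] /andP[ur u1].
set m := `|x| + `|u|; have m0 : 0 <= m by rewrite addr_ge0.
have m2 : m <= 2 by rewrite /m; lra.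
have O2 : `|F x u - H x - u *: b| <= c2 * m ^+ 2.
  have -> : F x u - H x - u *: b = (F x u - quad_jet x u) + (quad_jet x u - H x - u *: b).
    by apply/rowP => k; rewrite !mxE; ring.
  apply: le_trans (ler_normD _ _) _; rewrite mulrDl addrC lerD ?hJ//.
  apply: le_trans (taylorF xr ur) _; rewrite -/m exprS mulrA ler_wpM2r ?exprn_ge0//.
  by rewrite mulrC ler_wpM2r// ltW.
have mm : m ^+ 2 <= 2 * m by rewrite expr2 ler_wpM2r.
have b0 := normr_ge0 b.
have cc := mulr_gt0 cP0 (addr_gt0 cH0 c20).
split.
- have -> : F x u = H x + u *: b + (F x u - H x - u *: b).
    by apply/rowP => k; rewrite !mxE; ring.
  apply: le_trans (ler_normD _ _) _; apply: le_trans (lerD (ler_normD _ _) (lexx _)) _.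
  rewrite normrZ.
  apply: (@le_trans _ _ (cH * m + `|b| * m + 2 * c2 * m)).
    apply: lerD; last first.
      by rewrite [2 * c2]mulrC -mulrA; apply: le_trans O2 _; rewrite ler_wpM2l ?(ltW c20).
    apply: lerD; first by apply: le_trans (hH x) _; rewrite ler_wpM2l ?(ltW cH0)// lerDl.
    by rewrite mulrC ler_wpM2l// lerDr.
  by rewrite -!mulrDl ler_wpM2r// lerDl ltW.
- apply: le_trans O2 _; rewrite ler_wpM2r ?exprn_ge0//; lra.
have Pb : Pp b = 0 by exact: coproj_in.
have PH : Pp (H x) = Pp (H (Pp x)).
  have {1}-> : x = P x + Pp x by rewrite /coproj addrC subrK.
  rewrite (linD lH) (linD lPp) [Pp (H (P x))]coproj_in ?add0r//.
  by apply: HS; have [] := orthoprojP S x.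
have -> : F x u = H x + u *: b + (F x u - H x - u *: b).
  by apply/rowP => k; rewrite !mxE; ring.
rewrite (linD lPp) (linD lPp) (linZ lPp) Pb scaler0 addr0 PH.
apply: le_trans (ler_normD _ _) _.
apply: (@le_trans _ _ (cP * (cH * `|Pp x|) + cP * (c2 * m ^+ 2))).
  apply: lerD; apply: le_trans (hP _) _; rewrite ler_wpM2l ?(ltW cP0)//.
rewrite -mulrDr.
have Z0 := normr_ge0 (Pp x); have M0 : 0 <= m ^+ 2 by rewrite exprn_ge0.
apply: (@le_trans _ _ (cP * (cH + c2) * (`|Pp x| + m ^+ 2))).
  rewrite -[leRHS]mulrA; apply: ler_wpM2l; first exact: ltW.
  have h1 := mulr_ge0 (ltW cH0) M0; have h2 := mulr_ge0 (ltW c20) Z0.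
  by rewrite [leRHS]mulrDl; apply: lerD; rewrite mulrDr ?lerDl ?lerDr.
rewrite ler_wpM2r ?addr_ge0//; lra.
Qed.

(** With x = y + z, y = P x and z = Pp x, the terms in u and y cancel by [Gb] and the symmetry of G
    on S. What remains contains a factor z together with x or u, or is of degree 3. *)
Lemma gap_expansion : exists2 C : R, 0 < C & forall x u, `|x| <= Num.min rho 1 -> `|u| <= Num.min rho 1 ->
  `|gapG_der x (F x u) - (Pp (H (gapG x)) + (2^-1 * u ^+ 2) *: Pp q + resonance (P x))| <=
  C * ((`|x| + `|u|) * `|Pp x| + (`|x| + `|u|) ^+ 3).
Proof.
have [cF cF0 hF] := field_bounds; have [cB cB0 hB] := bilin_bound bB.
have [cL cL0 hL] := lin_bound lL; have [cP cP0 hP] := lin_bound lP.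
have [cQ cQ0 hQ] := lin_bound lPp; have [cG cG0 hG] := bilin_bound bG.
have [cH cH0 hH] := lin_bound lH.
pose c1 := cQ * (cB * (2 * cP + cQ)) + cQ * cL + 2 * (cG * cP * (cP * cH)).
pose c2 := cQ * CT + 2 * (cG * cP * (cP * cF)).
have c10 : 0 < c1 by rewrite /c1 !addr_gt0 ?mulr_gt0 ?addr_gt0 ?mulr_gt0.
have c20 : 0 < c2 by rewrite /c2 !addr_gt0 ?mulr_gt0.
exists (c1 + c2); first exact: addr_gt0.
move=> x u xr ur; have [_ O2 _] := hF x u xr ur.
move: xr ur; rewrite !le_min => /andP[xr x1] /andP[ur u1].
have T := taylorF xr ur.
have [yS _] := orthoprojP S x.
have xE : x = P x + Pp x by rewrite /coproj addrC subrK.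
move: yS xE (hP x) (hQ x); rewrite /gapG_der /gapG /resonance.
set y := P x; set z := Pp x; set m := `|x| + `|u| => yS xE hy hz.
set O := F x u - H x - u *: b in O2; set Rm := F x u - quad_jet x u in T.
have HxE : H x = H y + H z by rewrite [H x](congr1 H xE) (linD lH).
have PF : P (F x u) = H y + P (H z) + u *: b + P O.
  have -> : F x u = H y + H z + u *: b + O.
    by rewrite -HxE /O; apply/rowP => k; rewrite !mxE; ring.
  by rewrite !(linD lP) (linZ lP) (orthoproj_in (HS yS)) (orthoproj_in bS).
have QF : Pp (F x u) = Pp (H z) + 2^-1 *: Pp (B x x) + u *: Pp (L x) +
    (2^-1 * u ^+ 2) *: Pp q + Pp Rm.
  have -> : F x u = H y + H z + u *: b + 2^-1 *: B x x + u *: L x + (2^-1 * u ^+ 2) *: q + Rm.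
    by rewrite -HxE /Rm /quad_jet; apply/rowP => k; rewrite !mxE; ring.
  by rewrite !(linD lPp) !(linZ lPp) (coproj_in (HS yS)) (coproj_in bS) scaler0 addr0 add0r.
have GP : G (P (F x u)) y = G y (P (F x u)).
  by apply: Gsym => //; have [] := orthoprojP S (F x u).
have GH : G (H y) y = G y (H y) by apply: Gsym => //; exact: HS.
(* The term 2 G(y, b), multiplied by u, cancels the two copies of u G(y, b) coming from the
   derivative of G(P x, P x). *)
have Lx : Pp (L x) = 2 *: G y b + Pp (L z).
  by rewrite [L x](congr1 L xE) (linD lL) (linD lPp) (Gb yS) (Gsym bS yS).
have Bx : Pp (B x x) = Pp (B y y) + (Pp (B y z) + Pp (B z y) + Pp (B z z)).
  have -> : B x x = B (y + z) (y + z) by rewrite -xE.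
  by rewrite !(bilinDl bB) !(bilinDr bB) !(linD lPp); apply/rowP => k; rewrite !mxE; ring.
rewrite GP QF PF Lx Bx GH !(bilinDr bG) (bilinZr bG) (linB lH z (G y y)) (linB lPp (H z) (H (G y y))).
set t1 := Pp (H z); set t2 := Pp (B y y); set t3 := G y b; set t4 := Pp (H (G y y)).
have -> : t1 + 2^-1 *: (t2 + (Pp (B y z) + Pp (B z y) + Pp (B z z))) + u *: (2 *: t3 + Pp (L z)) +
    (2^-1 * u ^+ 2) *: Pp q + Pp Rm -
    (G y (H y) + G y (P (H z)) + u *: t3 + G y (P O) +
     (G y (H y) + G y (P (H z)) + u *: t3 + G y (P O))) -
    (t1 - t4 + (2^-1 * u ^+ 2) *: Pp q + (2^-1 *: t2 + t4 - G y (H y) - G y (H y))) =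
    2^-1 *: (Pp (B y z) + Pp (B z y) + Pp (B z z)) + u *: Pp (L z) + Pp Rm
    - 2 *: G y (P (H z)) - 2 *: G y (P O).
  by apply/rowP => k; rewrite !mxE; ring.
have m0 : 0 <= m by rewrite addr_ge0.
have xm : `|x| <= m by rewrite lerDl.
have um : `|u| <= m by rewrite lerDr.
have ym : `|y| <= cP * m by apply: le_trans hy _; rewrite ler_wpM2l// ltW.
have zm : `|z| <= cQ * m by apply: le_trans hz _; rewrite ler_wpM2l// ltW.
have Z0 := normr_ge0 z; have [X0 U0] : 0 <= `|x| /\ 0 <= `|u| by [].
have zz : `|z| * `|z| <= cQ * m * `|z| by rewrite ler_wpM2r.
have yz : `|y| * `|z| <= cP * m * `|z| by rewrite ler_wpM2r.
have b1 : `|Pp (B y z)| <= cQ * cB * (cP * (m * `|z|)).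
  apply: le_trans (hQ _) _; rewrite -[leRHS]mulrA ler_wpM2l ?(ltW cQ0)//.
  by apply: le_trans (hB _ _) _; rewrite -[leLHS]mulrA ler_wpM2l ?(ltW cB0)// mulrA.
have b2 : `|Pp (B z y)| <= cQ * cB * (cP * (m * `|z|)).
  apply: le_trans (hQ _) _; rewrite -[leRHS]mulrA ler_wpM2l ?(ltW cQ0)//.
  by apply: le_trans (hB _ _) _; rewrite -[leLHS]mulrA ler_wpM2l ?(ltW cB0)// mulrA [leLHS]mulrC.
have b3 : `|Pp (B z z)| <= cQ * cB * (cQ * (m * `|z|)).
  apply: le_trans (hQ _) _; rewrite -[leRHS]mulrA ler_wpM2l ?(ltW cQ0)//.
  by apply: le_trans (hB _ _) _; rewrite -[leLHS]mulrA ler_wpM2l ?(ltW cB0)// mulrA.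
have b4 : `|u *: Pp (L z)| <= cQ * cL * (m * `|z|).
  rewrite normrZ; apply: (@le_trans _ _ (m * (cQ * (cL * `|z|)))); last first.
    by rewrite le_eqVlt; apply/orP; left; apply/eqP; ring.
  apply: ler_pM => //; apply: le_trans (hQ _) _.
  by rewrite ler_wpM2l ?(ltW cQ0).
have b5 : `|Pp Rm| <= cQ * CT * m ^+ 3.
  by apply: le_trans (hQ _) _; rewrite -mulrA ler_wpM2l ?(ltW cQ0).
have b6 : `|G y (P (H z))| <= cG * cP * (cP * cH) * (m * `|z|).
  apply: le_trans (hG _ _) _.
  apply: (@le_trans _ _ (cG * (cP * m) * (cP * (cH * `|z|)))); last first.
    by rewrite le_eqVlt; apply/orP; left; apply/eqP; ring.
  apply: ler_pM => //; first by rewrite mulr_ge0 ?(ltW cG0).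
    by rewrite ler_wpM2l ?(ltW cG0).
  by apply: le_trans (hP _) _; rewrite ler_wpM2l ?(ltW cP0).
have b7 : `|G y (P O)| <= cG * cP * (cP * cF) * m ^+ 3.
  apply: le_trans (hG _ _) _.
  apply: (@le_trans _ _ (cG * (cP * m) * (cP * (cF * m ^+ 2)))); last first.
    by rewrite le_eqVlt; apply/orP; left; apply/eqP; ring.
  apply: ler_pM => //; first by rewrite mulr_ge0 ?(ltW cG0).
    by rewrite ler_wpM2l ?(ltW cG0).
  by apply: le_trans (hP _) _; rewrite ler_wpM2l ?(ltW cP0).
have mz0 : 0 <= m * `|z| by rewrite mulr_ge0.
have m30 : 0 <= m ^+ 3 by rewrite exprn_ge0.
apply: (@le_trans _ _ (c1 * (m * `|z|) + c2 * m ^+ 3)); last first.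
  rewrite [leRHS]mulrDl; apply: lerD; apply: ler_wpM2l; rewrite ?lerDl ?lerDr //; exact: ltW.
move: b1 b2 b3 b4 b5 b6 b7 mz0 m30.
set M1 := m * `|z|; set M3 := m ^+ 3 => b1 b2 b3 b4 b5 b6 b7 mz0 m30.
apply: le_trans (ler_normB _ _) _; apply: le_trans (lerD (ler_normB _ _) (lexx _)) _.
apply: le_trans (lerD (lerD (ler_normD _ _) (lexx _)) (lexx _)) _.
apply: le_trans (lerD (lerD (lerD (ler_normD _ _) (lexx _)) (lexx _)) (lexx _)) _.
have n1 : `|2^-1 *: (Pp (B y z) + Pp (B z y) + Pp (B z z))| <=
    `|Pp (B y z)| + `|Pp (B z y)| + `|Pp (B z z)|.
  rewrite normrZ ger0_norm ?invr_ge0//; apply: (@le_trans _ _ (`|Pp (B y z) + Pp (B z y) + Pp (B z z)|)).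
    by rewrite ler_piMl// invf_le1 ?ler1n.
  by apply: le_trans (ler_normD _ _) _; rewrite lerD2r ler_normD.
have n2 (v : V) : `|2 *: v| = 2 * `|v| by rewrite normrZ ger0_norm.
rewrite !n2.
have -> : c1 * M1 + c2 * M3 = cQ * cB * (cP * M1) + cQ * cB * (cP * M1) + cQ * cB * (cQ * M1) +
  cQ * cL * M1 + 2 * (cG * cP * (cP * cH) * M1) + (cQ * CT * M3) + 2 * (cG * cP * (cP * cF) * M3).
  by rewrite /c1 /c2; ring.
move: b1 b2 b3 b4 b5 b6 b7 n1; clear; lra.
Qed.

(** A trajectory issued from 0 that is known to stay where the Taylor estimates hold, for a control
    bounded everywhere. Smallness of the state is established separately, by continuation. *)
Definition curve (T : R) (X : R -> V) (v : R -> R) : Prop :=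
  [/\ vprim T X (fun s => F (X s) (v s)), X 0 = 0, bmf T v,
      (forall s, `|v s| <= Num.min rho 1) &
      (forall s, 0 <= s <= T -> `|X s| <= Num.min rho 1)].

Definition moment (p : nat) (T : R) (v : R -> R) : R := intg 0 T (fun s => `|v s| ^+ p).

Lemma bmf_moment p T (v : R -> R) : bmf T v -> bmf T (fun s => `|v s| ^+ p).
Proof. by move=> bv; apply: bmfX; exact: bmf_norm. Qed.

Lemma moment_ge0 p T (v : R -> R) : 0 <= moment p T v.
Proof. by apply: intg_ge0 => s _; exact: exprn_ge0. Qed.

Lemma moment_le p t T (v : R -> R) : bmf T v -> 0 <= t <= T -> moment p t v <= moment p T v.
Proof.
move=> bv /andP[t0 tT]; apply: (@intg_le_sub _ T) => //; exact: bmf_moment.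
Qed.

Lemma moment1_sqr T (v : R -> R) : bmf T v -> 0 <= T -> moment 1 T v ^+ 2 <= T * moment 2 T v.
Proof.
by move=> bv T0; have := intg_sqr_le (bmf_norm bv) (t := T); rewrite T0 lexx; exact.
Qed.

Lemma moment12 T (v : R -> R) : bmf T v -> 0 <= T -> moment 1 T v * moment 2 T v <= T * moment 3 T v.
Proof.
move=> bv T0; have := intg_cube_ge (bmf_norm bv) (t := T); rewrite T0 lexx; apply=> //.
Qed.

Variable Tmax : R.
Hypothesis Tmax0 : 0 < Tmax.

(** Gronwall's lemma is applied to |X|, then to |Pp X|, whose forcing (|X| + |v|)^2 is controlled by
    the second moment because the square of the first moment is at most T times the second. *)
Lemma curve_bounds : exists2 C : R, 0 < C & forall T X v, 0 <= T <= Tmax -> curve T X v ->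
  forall s, 0 <= s <= T ->
  `|X s| <= C * moment 1 T v /\ `|Pp (X s)| <= C * moment 2 T v.
Proof.
have [cF cF0 hF] := field_bounds; have [Cg Cg0 hg] := gronwall cF0 Tmax0.
pose a2 := 2 * cF * (Tmax ^+ 2 * (Cg * cF) ^+ 2 + 1).
have a20 : 0 < a2 by rewrite /a2 mulr_gt0 ?mulr_gt0// ltr_wpDl// mulr_ge0 ?sqr_ge0.
exists (Cg * cF + Cg * a2); first exact: addr_gt0 (mulr_gt0 Cg0 cF0) (mulr_gt0 Cg0 a20).
move=> T X v /andP[T0 TT] [vX X0 bv vb Xb].
have bX := bmf_continuous (vprim_norm_continuous vX).
have m1 := moment_ge0 1 T v; have m2 := moment_ge0 2 T v.
have B1 s : 0 <= s <= T -> `|X s| <= Cg * (cF * moment 1 T v).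
  move=> sT; apply: (hg T (fun s => `|X s|) (cF * moment 1 T v)) sT => //.
  - by rewrite T0.
  - by rewrite mulr_ge0// ltW.
  - exact: vprim_norm_continuous vX.
  move=> t tT; have /andP[t0 tT'] := tT.
  have bh : bmf T (fun s => cF * (`|X s| + `|v s|)) by apply/bmfZ/bmfD => //; exact: bmf_norm.
  have := vprim_bound vX bh _ tT; rewrite X0 subr0 => HX.
  apply: le_trans (HX _) _.
    move=> r /andP[r0 rT]; have rT' : 0 <= r <= T by rewrite !ltW.
    by have [] := hF (X r) (v r) (Xb _ rT') (vb r).
  rewrite (intgZ (lexx 0) tT'); last by apply/bmfD => //; exact: bmf_norm.
  rewrite (intgD (lexx 0) tT')//; last exact: bmf_norm.
  rewrite mulrDr addrC lerD2r ler_wpM2l ?(ltW cF0)//.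
  exact: (moment_le 1 bv tT).
have B2 s : 0 <= s <= T -> `|Pp (X s)| <= Cg * (a2 * moment 2 T v).
  have vP := vprim_lin lPp vX.
  move=> sT; apply: (hg T (fun s => `|Pp (X s)|) (a2 * moment 2 T v)) sT => //.
  - by rewrite T0.
  - by rewrite mulr_ge0// ltW.
  - exact: vprim_norm_continuous vP.
  move=> t tT; have /andP[t0 tT'] := tT.
  have bP := bmf_continuous (vprim_norm_continuous vP).
  pose c := 2 * (Cg * (cF * moment 1 T v)) ^+ 2.
  pose h s := cF * (`|Pp (X s)| + (c + 2 * `|v s| ^+ 2)).
  have bv2 := bmf_moment 2 bv.
  have bh : bmf T h by apply/bmfZ/bmfD => //; apply: bmfD; [exact: bmf_cst|exact: bmfZ].
  have := vprim_bound vP bh _ tT; rewrite X0 (lin0 lPp) subr0 => HX.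
  apply: le_trans (HX _) _.
    move=> r /andP[r0 rT]; have rT' : 0 <= r <= T by rewrite !ltW.
    have [_ _] := hF (X r) (v r) (Xb _ rT') (vb r); move/le_trans; apply.
    rewrite /h ler_wpM2l ?(ltW cF0)// lerD2l /c.
    have := B1 r rT'; set A := Cg * _; have := normr_ge0 (X r) => x0 xA.
    have xA2 : `|X r| ^+ 2 <= A ^+ 2 by rewrite ler_pXn2r ?nnegrE// (le_trans x0).
    have : 0 <= (`|X r| - `|v r|) ^+ 2 by exact: sqr_ge0.
    rewrite sqrrB sqrrD; move: xA2; lra.
  rewrite (intgZ (lexx 0) tT'); last by apply/bmfD => //; apply: bmfD; [exact: bmf_cst|exact: bmfZ].
  rewrite (intgD (lexx 0) tT')//; last by apply: bmfD; [exact: bmf_cst|exact: bmfZ].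
  rewrite (intgD (lexx 0) tT')//; [|exact: bmf_cst|exact: bmfZ].
  rewrite (intg_cst _ t0) (intgZ (lexx 0) tT')// subr0 mulrDr addrC lerD2r.
  have -> : a2 * moment 2 T v = cF * (2 * (Tmax ^+ 2 * (Cg * cF) ^+ 2) * moment 2 T v + 2 * moment 2 T v).
    by rewrite /a2; ring.
  rewrite ler_wpM2l ?(ltW cF0)//; apply: lerD; last first.
    by rewrite ler_wpM2l//; exact: (moment_le 2 bv tT).
  rewrite /c -[leLHS]mulrA -[leRHS]mulrA ler_wpM2l//.
  have S1 := moment1_sqr bv T0.
  apply: (@le_trans _ _ ((Cg * cF) ^+ 2 * (T * moment 2 T v) * Tmax)).
    apply: ler_pM => //; [exact: sqr_ge0| |exact: le_trans TT].
    by rewrite mulrA exprMn ler_wpM2l ?sqr_ge0.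
  have -> : Tmax ^+ 2 * (Cg * cF) ^+ 2 * moment 2 T v =
            (Cg * cF) ^+ 2 * (Tmax * moment 2 T v) * Tmax by ring.
  by rewrite ler_wpM2r ?(ltW Tmax0)// ler_wpM2l ?sqr_ge0// ler_wpM2r.
move=> s sT; rewrite !mulrDl; split.
  apply: le_trans (B1 s sT) _; rewrite mulrA lerDl.
  exact: mulr_ge0 (mulr_ge0 (ltW Cg0) (ltW a20)) m1.
apply: le_trans (B2 s sT) _; rewrite mulrA lerDr.
exact: mulr_ge0 (mulr_ge0 (ltW Cg0) (ltW cF0)) m2.
Qed.

Definition leading (x : V) (u : R) : V := (2^-1 * u ^+ 2) *: Pp q + resonance (P x).

Lemma curve_gapG T X v : curve T X v ->
  vprim T (fun s => gapG (X s)) (fun s => gapG_der (X s) (F (X s) (v s))).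
Proof.
move=> [vX _ _ _ _]; apply: vprimB; first exact: vprim_lin vX.
by apply: vprim_bilin => //; exact: vprim_lin vX.
Qed.

Lemma cube_le (a c : R) : 0 <= a -> 0 <= c -> (a + c) ^+ 3 <= 4 * (a ^+ 3 + c ^+ 3).
Proof.
move=> a0 c0; rewrite -subr_ge0.
have -> : 4 * (a ^+ 3 + c ^+ 3) - (a + c) ^+ 3 = 3 * ((a + c) * (a - c) ^+ 2) by ring.
by rewrite mulr_ge0// mulr_ge0 ?sqr_ge0 ?addr_ge0.
Qed.

(** Inserting [curve_bounds] into [gap_expansion] produces products of moments of total degree 3.
    They reduce to the third moment by m_1 m_2 <= T m_3 and m_1^3 <= T m_1 m_2. *)
Lemma curve_error : exists2 C : R, 0 < C & forall T X v, 0 <= T <= Tmax -> curve T X v ->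
  exists e, [/\ bmf T e, intg 0 T e <= C * moment 3 T v & forall s, 0 < s < T ->
    `|gapG_der (X s) (F (X s) (v s)) - (Pp (H (gapG (X s))) + leading (X s) (v s))| <= e s].
Proof.
have [C1 C10 h1] := curve_bounds; have [C2 C20 h2] := gap_expansion.
pose K := (C1 * C1 * Tmax + C1) * Tmax + 4 * (C1 ^+ 3 * Tmax * Tmax * Tmax + 1).
have K0 : 0 < K.
  have a1 := mulr_gt0 (mulr_gt0 (mulr_gt0 (exprn_gt0 3 C10) Tmax0) Tmax0) Tmax0.
  have a2 := mulr_gt0 (addr_gt0 (mulr_gt0 (mulr_gt0 C10 C10) Tmax0) C10) Tmax0.
  rewrite /K; move: a1 a2; lra.
exists (C2 * K); first exact: mulr_gt0.
move=> T X v TT cX; have [vX X0 bv vb Xb] := cX; have /andP[T0 TM] := TT.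
have hX := h1 T X v TT cX.
have u1 := moment_ge0 1 T v; have u2 := moment_ge0 2 T v; have u3 := moment_ge0 3 T v.
have s1 := moment1_sqr bv T0; have s2 := moment12 bv T0.
move: u1 u2 u3 s1 s2 hX.
set U1 := moment 1 T v; set U2 := moment 2 T v; set U3 := moment 3 T v => u1 u2 u3 s1 s2 hX.
pose xm := C1 * U1; pose zm := C1 * U2.
have xm0 : 0 <= xm := mulr_ge0 (ltW C10) u1.
have zm0 : 0 <= zm := mulr_ge0 (ltW C10) u2.
exists (fun s => C2 * ((xm * zm + zm * `|v s| ^+ 1) + 4 * (xm ^+ 3 + `|v s| ^+ 3))).
have b1 := bmf_moment 1 bv; have b3 := bmf_moment 3 bv.
have bA : bmf T (fun s => xm * zm + zm * `|v s| ^+ 1).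
  by apply: bmfD; [exact: bmf_cst|exact: bmfZ].
have bB' : bmf T (fun s => xm ^+ 3 + `|v s| ^+ 3) by apply: bmfD => //; exact: bmf_cst.
split.
- by apply: bmfZ; apply: bmfD => //; exact: bmfZ.
- rewrite (intgZ (lexx 0) (lexx T)); last by apply: bmfD => //; exact: bmfZ.
  rewrite -mulrA ler_wpM2l ?(ltW C20)//.
  rewrite (intgD (lexx 0) (lexx T))//; last exact: bmfZ.
  rewrite (intgZ (lexx 0) (lexx T))//.
  rewrite (intgD (lexx 0) (lexx T))//; [|exact: bmf_cst|exact: bmfZ].
  rewrite (intgD (lexx 0) (lexx T))//; last exact: bmf_cst.
  rewrite !(intg_cst _ T0) subr0 (intgZ (lexx 0) (lexx T))//.
  rewrite -[intg 0 T (fun s => `|v s| ^+ 1)]/U1 -[intg 0 T (fun s => `|v s| ^+ 3)]/U3.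
  have e1 : xm * zm * T + zm * U1 <= (C1 * C1 * Tmax + C1) * Tmax * U3.
    have -> : xm * zm * T + zm * U1 = (C1 * C1 * T + C1) * (U1 * U2) by rewrite /xm /zm; ring.
    rewrite -[leRHS]mulrA; apply: ler_pM.
    - by rewrite addr_ge0 ?(ltW C10)// mulr_ge0// mulr_ge0// ltW.
    - exact: mulr_ge0.
    - by rewrite lerD2r ler_wpM2l// mulr_ge0// ltW.
    - by apply: le_trans s2 _; rewrite ler_wpM2r.
  have e2 : xm ^+ 3 * T <= C1 ^+ 3 * Tmax * Tmax * Tmax * U3.
    have -> : xm ^+ 3 * T = C1 ^+ 3 * ((U1 ^+ 2 * U1) * T) by rewrite /xm; ring.
    have -> : C1 ^+ 3 * Tmax * Tmax * Tmax * U3 = C1 ^+ 3 * ((Tmax * (Tmax * U3)) * Tmax) by ring.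
    apply: ler_wpM2l; first by rewrite exprn_ge0// ltW.
    apply: ler_pM => //; first by rewrite mulr_ge0 ?sqr_ge0.
    apply: (@le_trans _ _ (T * U2 * U1)); first by rewrite ler_wpM2r.
    rewrite -mulrA [U2 * U1]mulrC; apply: ler_pM => //; first exact: mulr_ge0.
    by apply: le_trans s2 _; rewrite ler_wpM2r.
  have -> : K * U3 = (C1 * C1 * Tmax + C1) * Tmax * U3 +
      4 * (C1 ^+ 3 * Tmax * Tmax * Tmax * U3 + U3) by rewrite /K; ring.
  by apply: lerD e1 _; rewrite ler_wpM2l// lerD2r.
move=> s /andP[s0 sT]; have sT' : 0 <= s <= T by rewrite !ltW.
rewrite /leading addrA; apply: le_trans (h2 (X s) (v s) (Xb _ sT') (vb s)) _.
rewrite ler_wpM2l ?(ltW C20)//; have [hx hz] := hX s sT'.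
have v0 := normr_ge0 (v s); have x0 := normr_ge0 (X s).
apply: lerD.
  have -> : xm * zm + zm * `|v s| ^+ 1 = (xm + `|v s|) * zm by rewrite expr1; ring.
  by apply: ler_pM => //; rewrite ?addr_ge0// lerD2r.
apply: (@le_trans _ _ ((xm + `|v s|) ^+ 3)); last exact: cube_le.
by rewrite ler_pXn2r ?nnegrE ?addr_ge0// lerD2r.
Qed.

(** Here h bounds the leading term and k bounds from below its component along nu. Gronwall's lemma
    bounds |gap| by the integral of h plus a cubic term; in the component along nu, the linear term
    Pp(H w) then costs only T times this bound, hence the gain of a factor T. *)
Lemma curve_master : exists2 C : R, 0 < C & forall T X v h, 0 <= T <= Tmax -> curve T X v ->
  bmf T h -> (forall s, 0 < s < T -> `|leading (X s) (v s)| <= h s) ->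
  `|gapG (X T)| <= C * (intg 0 T h + moment 3 T v) /\
  forall nu k, bmf T k -> (forall s, 0 < s < T -> k s <= dot (leading (X s) (v s)) nu) ->
    intg 0 T k - C * `|nu| * (T * (intg 0 T h + moment 3 T v) + moment 3 T v) <=
    dot (gapG (X T)) nu.
Proof.
have [Ce Ce0 he] := curve_error.
have lA : linear (fun y => Pp (H y)) by move=> a x y; rewrite lH lPp.
have [cA cA0 hA] := lin_bound lA; have [Cg Cg0 hg] := gronwall cA0 Tmax0.
pose C1 := Cg * (1 + Ce); have C10 : 0 < C1 by rewrite mulr_gt0// addr_gt0.
have N0 : 0 <= n%:R :> R by [].
have cAC := mulr_gt0 cA0 C10.
exists (C1 + n%:R * (cA * C1 + Ce)).
  by rewrite ltr_pwDl// mulr_ge0// addr_ge0 ?(ltW cAC) ?(ltW Ce0).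
move=> T X v h TT cX bh hh; have /andP[T0 TM] := TT.
have [e [be ie ee]] := he T X v TT cX.
have vG := curve_gapG cX; have [_ X0 _ _ _] := cX.
have G0 : gapG (X 0) = 0.
  by rewrite /gapG X0 (lin0 lPp) (lin0 lP) (bilin0l bG) subrr.
have u3 := moment_ge0 3 T v.
move: u3 ie; set U3 := moment 3 T v => u3 ie.
have h0 s : 0 < s < T -> 0 <= h s by move=> /hh; apply: le_trans.
have e0 s : 0 < s < T -> 0 <= e s by move=> /ee; apply: le_trans.
have ih := intg_ge0 h0.
have bw := bmf_continuous (vprim_norm_continuous vG).
have bAw : bmf T (fun s => cA * `|gapG (X s)|) by exact: bmfZ.
have W s : 0 <= s <= T -> `|gapG (X s)| <= C1 * (intg 0 T h + U3).
  move=> sT; apply: (@le_trans _ _ (Cg * (intg 0 T h + Ce * U3))); last first.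
    rewrite -[leRHS]mulrA ler_wpM2l ?(ltW Cg0)// mulrDl mul1r mulrDr.
    by apply: lerD; rewrite ?lerDl ?lerDr// mulr_ge0// ltW.
  apply: (hg T (fun s => `|gapG (X s)|) (intg 0 T h + Ce * U3)) sT => //.
  - by rewrite addr_ge0// mulr_ge0// ltW.
  - exact: vprim_norm_continuous vG.
  move=> t tT; have /andP[t0 tT'] := tT.
  have bhe : bmf T (fun s => h s + e s) by exact: bmfD.
  have bsum : bmf T (fun s => (h s + e s) + cA * `|gapG (X s)|) by exact: bmfD.
  have := vprim_bound vG bsum _ tT; rewrite G0 subr0 => HX.
  apply: le_trans (HX _) _.
    move=> r rT; set d := gapG_der _ _.
    have -> : d = leading (X r) (v r) + (d - (Pp (H (gapG (X r))) + leading (X r) (v r))) + Pp (H (gapG (X r))).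
      by apply/rowP => k; rewrite !mxE; ring.
    apply: le_trans (ler_normD _ _) _; apply: lerD; last exact: hA.
    by apply: le_trans (ler_normD _ _) _; apply: lerD; [exact: hh|exact: ee].
  rewrite (intgD (lexx 0) tT')// (intgD (lexx 0) tT')// (intgZ (lexx 0) tT')// lerD2r.
  apply: lerD; first exact: (@intg_le_sub _ T).
  by apply: le_trans ie; exact: (@intg_le_sub _ T).
split.
  apply: le_trans (W T _) _; first by rewrite lexx T0.
  rewrite ler_wpM2r ?addr_ge0// lerDl mulr_ge0// addr_ge0 ?(ltW cAC) ?(ltW Ce0)//.
move=> nu k bk hk; have [bd ->] := prim_dot nu vG; last by rewrite T0 lexx.
have -> : dot (gapG (X 0)) nu = 0 by rewrite G0 -(scale0r (0 : V)) dotZl mul0r.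
rewrite add0r.
pose c := n%:R * `|nu| * (cA * (C1 * (intg 0 T h + U3))).
have M0 : 0 <= n%:R * `|nu| by rewrite mulr_ge0.
have bc : bmf T (fun s => c + (n%:R * `|nu|) * e s).
  by apply: bmfD; [exact: bmf_cst|exact: bmfZ].
apply: (@le_trans _ _ (intg 0 T (fun s => k s - (c + (n%:R * `|nu|) * e s)))); last first.
  apply: (intg_le (lexx 0) (lexx T)) => //; first exact: bmfB.
  move=> r rT; set d := gapG_der _ _.
  have rT' : 0 <= r <= T by case/andP: rT => *; rewrite !ltW.
  have -> : dot d nu = dot (leading (X r) (v r)) nu +
     dot (d - (Pp (H (gapG (X r))) + leading (X r) (v r))) nu + dot (Pp (H (gapG (X r)))) nu.
    by rewrite -!dotDl; congr (dot _ nu); apply/rowP => j; rewrite !mxE; ring.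
  have K1 := hk r rT.
  have K2 : - (n%:R * `|nu| * e r) <= dot (d - (Pp (H (gapG (X r))) + leading (X r) (v r))) nu.
    rewrite lerNl; apply: le_trans (ler_norm _) _; rewrite normrN.
    apply: le_trans (dot_bound _ _) _; rewrite mulrAC ler_wpM2l//; exact: ee.
  have K3 : - c <= dot (Pp (H (gapG (X r)))) nu.
    rewrite lerNl; apply: le_trans (ler_norm _) _; rewrite normrN.
    apply: le_trans (dot_bound _ _) _; rewrite mulrAC ler_wpM2l//.
    by apply: le_trans (hA _) _; rewrite ler_wpM2l ?(ltW cA0)// W.
  move: K1 K2 K3; set p1 := dot _ _; set p2 := dot _ _; set p3 := dot _ _; set p4 := _ * e r.
  by move=> K1 K2 K3; rewrite opprD; move: K1 K2 K3; set kr := k r; clearbody c p1 p2 p3 p4 kr; lra.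
rewrite (intgB (lexx 0) (lexx T))// (intgD (lexx 0) (lexx T))//; [|exact: bmf_cst|exact: bmfZ].
rewrite (intg_cst _ T0) (intgZ (lexx 0) (lexx T))// subr0 lerD2l lerN2.
apply: (@le_trans _ _ (n%:R * (cA * C1 + Ce) * `|nu| * (T * (intg 0 T h + U3) + U3))); last first.
  rewrite ler_wpM2r ?addr_ge0 ?mulr_ge0 ?addr_ge0//.
  by rewrite ler_wpM2r// lerDr ltW.
have -> : n%:R * (cA * C1 + Ce) * `|nu| * (T * (intg 0 T h + U3) + U3) =
  n%:R * `|nu| * ((cA * C1) * (T * (intg 0 T h + U3)) + Ce * U3 + (cA * C1 * U3 + Ce * (T * (intg 0 T h + U3)))) by ring.
rewrite /c -!mulrA -mulrDr ler_wpM2l// -mulrDr ler_wpM2l//.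
rewrite [(intg 0 T h + U3) * T]mulrC ler_wpDr//; last by rewrite lerD2l.
apply: addr_ge0; apply: mulr_ge0; rewrite ?(ltW cA0) ?(ltW Ce0)//.
  by rewrite mulr_ge0 ?(ltW Cg0)// mulr_ge0// addr_ge0// ltW.
by rewrite mulr_ge0// addr_ge0.
Qed.

Lemma curve_sqr : exists2 C : R, 0 < C & forall T X v, 0 <= T <= Tmax -> curve T X v ->
  exists h, [/\ bmf T h, intg 0 T h <= C * moment 2 T v &
    forall s, 0 < s < T -> (`|X s| + `|v s|) ^+ 2 <= h s].
Proof.
have [C1 C10 h1] := curve_bounds.
exists (2 * (C1 ^+ 2 * Tmax * Tmax + 1)).
  by rewrite mulr_gt0// ltr_wpDl// !mulr_ge0 ?sqr_ge0// ltW.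
move=> T X v TT cX; have [vX X0 bv vb Xb] := cX; have /andP[T0 TM] := TT.
have u2 := moment_ge0 2 T v; have s1 := moment1_sqr bv T0.
have b2 := bmf_moment 2 bv.
exists (fun s => 2 * ((C1 * moment 1 T v) ^+ 2 + `|v s| ^+ 2)).
have b' : bmf T (fun s => (C1 * moment 1 T v) ^+ 2 + `|v s| ^+ 2).
  by apply: bmfD => //; exact: bmf_cst.
split; first exact: bmfZ.
  rewrite (intgZ (lexx 0) (lexx T))// (intgD (lexx 0) (lexx T))//; last exact: bmf_cst.
  rewrite (intg_cst _ T0) subr0 -[leRHS]mulrA ler_wpM2l// mulrDl mul1r lerD2r.
  have -> : C1 ^+ 2 * Tmax * Tmax * moment 2 T v = C1 ^+ 2 * (Tmax * moment 2 T v) * Tmax by ring.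
  rewrite exprMn; apply: ler_pM => //; first by rewrite mulr_ge0 ?sqr_ge0.
  by rewrite ler_wpM2l ?sqr_ge0//; apply: le_trans s1 _; rewrite ler_wpM2r.
move=> s /andP[s0 sT]; have sT' : 0 <= s <= T by rewrite !ltW.
have [xA _] := h1 T X v TT cX s sT'; have x0 := normr_ge0 (X s).
have xA2 : `|X s| ^+ 2 <= (C1 * moment 1 T v) ^+ 2 by rewrite ler_pXn2r ?nnegrE// (le_trans x0).
apply: (@le_trans _ _ (2 * (`|X s| ^+ 2 + `|v s| ^+ 2))); last by rewrite ler_wpM2l// lerD2r.
rewrite -subr_ge0.
have -> : 2 * (`|X s| ^+ 2 + `|v s| ^+ 2) - (`|X s| + `|v s|) ^+ 2 = (`|X s| - `|v s|) ^+ 2 by ring.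
exact: sqr_ge0.
Qed.

(** The functions psi_j are the iterated primitives of v. Subtracting \sum_j psi_(j+1) H^j b removes
    the linear response: the remainder r solves r' = H r + psi_k H^k b + quadratic terms, so that
    only the L^1 norm of the k-th primitive enters. *)
Lemma curve_residual k : exists2 C : R, 0 < C & forall T X v psi, 0 <= T <= Tmax -> curve T X v ->
  (forall s, psi 0%N s = v s) -> bmf T (psi k) ->
  (forall j, (j < k)%N -> prim T (psi j.+1) (psi j) /\ psi j.+1 0 = 0) ->
  forall s, 0 <= s <= T -> `|X s - \sum_(j < k) psi j.+1 s *: kry H b j| <=
    C * (intg 0 T (fun s => `|psi k s|) + moment 2 T v).
Proof.
have [cF cF0 hF] := field_bounds; have [C2 C20 h2] := curve_sqr.
have [cH cH0 hH] := lin_bound lH; have [Cg Cg0 hg] := gronwall cH0 Tmax0.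
have kn0 := normr_ge0 (kry H b k); pose c := `|kry H b k| + cF * C2.
have c0 : 0 < c by rewrite ltr_wpDl// mulr_gt0.
exists (Cg * c) => [|T X v psi TT cX psi0 bk hpsi s sT]; first exact: mulr_gt0.
have [vX X0 bv vb Xb] := cX; have /andP[T0 TM] := TT.
have [h [bh ih hh]] := h2 T X v TT cX.
have u2 := moment_ge0 2 T v; set U2 := moment 2 T v in ih u2 *.
have bp := bmf_norm bk.
have I0 : 0 <= intg 0 T (fun s => `|psi k s|) by exact: intg_ge0.
have h0 r : 0 < r < T -> 0 <= h r by move=> /hh; apply: le_trans; exact: sqr_ge0.
pose r s := X s - \sum_(j < k) psi j.+1 s *: kry H b j.
have vr : vprim T r (fun s => F (X s) (v s) - \sum_(j < k) psi j s *: kry H b j).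
  by apply: vprimB => //; apply: vprim_sum => j _; apply: vprim_scal; have [] := hpsi j (ltn_ord j).
have dr t : F (X t) (v t) - \sum_(j < k) psi j t *: kry H b j =
    (F (X t) (v t) - H (X t) - v t *: b) + H (r t) + psi k t *: kry H b k.
  have -> : H (r t) = H (X t) - \sum_(j < k) psi j.+1 t *: kry H b j.+1.
    rewrite /r (linB lH (X t)); congr (_ - _); rewrite (lin_sum lH).
    by apply: eq_bigr => j _; rewrite (linZ lH).
  (* The same sum of k + 1 terms, split off at its first and at its last term. *)
  have E : \sum_(j < k) psi j.+1 t *: kry H b j.+1 + v t *: b =
           \sum_(j < k) psi j t *: kry H b j + psi k t *: kry H b k.
    have := @big_ord_recl _ (0 : V) +%R k (fun j : 'I_k.+1 => psi j t *: kry H b j).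
    by rewrite big_ord_recr/= psi0 => ->; rewrite addrC.
  have -> : \sum_(j < k) psi j.+1 t *: kry H b j.+1 =
     \sum_(j < k) psi j t *: kry H b j + psi k t *: kry H b k - v t *: b by rewrite -E addrK.
  by apply/rowP => i; rewrite !mxE; ring.
have r0 : r 0 = 0.
  rewrite /r X0 big1 ?subrr// => j _; have [_ ->] := hpsi j (ltn_ord j); exact: scale0r.
apply: (@le_trans _ _ (Cg * (c * (intg 0 T (fun s => `|psi k s|) + U2)))); last by rewrite mulrA.
apply: (hg T (fun s => `|r s|) (c * (intg 0 T (fun s => `|psi k s|) + U2))) sT => //.
- exact: mulr_ge0 (ltW c0) (addr_ge0 I0 u2).
- exact: vprim_norm_continuous vr.
move=> t tT; have /andP[t0 tT'] := tT.
have br := bmf_continuous (vprim_norm_continuous vr).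
have b1 : bmf T (fun s => cF * h s + `|kry H b k| * `|psi k s|) by apply: bmfD; exact: bmfZ.
have bsum : bmf T (fun s => (cF * h s + `|kry H b k| * `|psi k s|) + cH * `|r s|).
  by apply: bmfD => //; exact: bmfZ.
have := vprim_bound vr bsum _ tT; rewrite r0 subr0 => HX.
apply: le_trans (HX _) _.
  move=> z zT; rewrite dr addrAC; have zT' : 0 <= z <= T by case/andP: zT => *; rewrite !ltW.
  apply: le_trans (ler_normD _ _) _; apply: lerD; last exact: hH.
  apply: le_trans (ler_normD _ _) _; apply: lerD; last by rewrite normrZ mulrC.
  have [_ + _] := hF (X z) (v z) (Xb z zT') (vb z); move/le_trans; apply.
  by rewrite ler_wpM2l ?(ltW cF0)//; exact: hh.
rewrite (intgD (lexx 0) tT')//; last exact: bmfZ.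
rewrite (intgZ (lexx 0) tT' cH)// lerD2r (intgD (lexx 0) tT')//; [|exact: bmfZ|exact: bmfZ].
rewrite (intgZ (lexx 0) tT' cF)// (intgZ (lexx 0) tT' `|kry H b k|)//.
have j1 : intg 0 t h <= intg 0 T h by exact: (@intg_le_sub _ T).
have j2 : intg 0 t (fun s => `|psi k s|) <= intg 0 T (fun s => `|psi k s|) by exact: (@intg_le_sub _ T).
rewrite /c mulrDl addrC; apply: lerD.
  by rewrite ler_wpM2l//; apply: le_trans j2 _; rewrite lerDl.
rewrite -mulrA ler_wpM2l ?(ltW cF0)//; apply: le_trans j1 (le_trans ih _).
by rewrite ler_wpM2l ?(ltW C20)// lerDr.
Qed.
End GapExpansion.

(** * Measurability along trajectories and continuation of estimates *)

Section Caratheodory.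
Context {R : realType}.
Notation mu := (@lebesgue_measure R).

Lemma measurable_nat_cover (D : set R) (k : R -> nat) (g : nat -> R -> R) :
  measurable D -> (forall j, measurable (D `&` [set s | k s = j])) ->
  (forall j, measurable_fun D (g j)) -> measurable_fun D (fun s => g (k s) s).
Proof.
move=> mD mk mg _ Y mY.
have -> : D `&` (fun s => g (k s) s) @^-1` Y =
    \bigcup_j ((D `&` [set s | k s = j]) `&` (D `&` g j @^-1` Y)).
  apply/seteqP; split=> [s [Ds Ys]|s [j _ [[Ds <-] [_ Ys]]]]; last by split.
  by exists (k s).
by apply: bigcup_measurable => j _; apply: measurableI => //; exact: mg.
Qed.

(* A Caratheodory function is the pointwise limit of the functions obtained by
   freezing its first argument on the intervals of a subdivision. *)
Lemma caratheodory_measurable (T : R) (F : R -> R -> R) (u : R -> R) :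
  (forall a, continuous (F a)) -> (forall s v, 0 < s < T -> {for s, continuous (F^~ v)}) ->
  measurable_fun `]0, T[ u -> measurable_fun `]0, T[ (fun s => F s (u s)).
Proof.
move=> cF2 cF1 mu_.
pose k N (s : R) := Num.truncn (s * N.+1%:R).
pose a N s : R := (k N s)%:R / N.+1%:R.
have aP N s : 0 < s -> `|s - a N s| <= N.+1%:R^-1.
  move=> s0; have p0 : 0 < N.+1%:R :> R by [].
  have /andP[h1 h2] := truncn_itv (mulr_ge0 (ltW s0) (ltW p0)).
  have e : s - a N s = (s * N.+1%:R - (k N s)%:R) / N.+1%:R.
    by rewrite /a mulrBl mulfK// gt_eqF.
  rewrite e normrM [`|_^-1|]gtr0_norm ?invr_gt0// ler_piMl ?invr_ge0//.
  by rewrite ger0_norm ?subr_ge0// lerBlDr addrC natr1 ltW.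
apply: (@measurable_fun_cvg _ _ _ _ (fun N s => F (a N s) (u s))) => [N|s].
  apply: (@measurable_nat_cover `]0, T[ (k N) (fun j s => F (j%:R / N.+1%:R) (u s))) => // j.
    have -> : `]0, T[ `&` [set s | k N s = j] = `]0, T[ `&` `[j%:R / N.+1%:R, j.+1%:R / N.+1%:R[.
      apply/seteqP; split=> s [] /= sT; have s0 : 0 < s by move: sT; rewrite in_itv => /andP[].
        move=> <-; split=> //; rewrite in_itv/= ler_pdivrMr// ltr_pdivlMr//.
        by apply: truncn_itv; rewrite mulr_ge0// ltW.
      rewrite in_itv/= ler_pdivrMr// ltr_pdivlMr// => H; split=> //.
      by apply/eqP; rewrite truncn_eq// mulr_ge0// ltW.
    by apply: measurableI.
  apply: measurableT_comp mu_; exact: continuous_measurable_fun.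
rewrite /= in_itv/= => sT; have /andP[s0 _] := sT.
apply: (@cvg_comp _ _ _ (fun N => a N s) (F^~ (u s)) _ (nbhs s)); last exact: (cF1 s (u s) sT).
apply/cvgrPdist_le => e e0; near=> N.
apply: le_trans (aP N s s0) _; near: N.
have := near_infty_natSinv_lt (PosNum e0).
by apply: filterS => N /ltW.
Unshelve. all: end_near.
Qed.
End Caratheodory.

Section Bootstrap.
Context {R : realType}.

Lemma within_continuous_dist (T : R) (g : R -> R) s (e : R) :
  {within `[0, T], continuous g} -> 0 <= s <= T -> 0 < e ->
  exists2 d : R, 0 < d & forall t, 0 <= t <= T -> `|s - t| < d -> `|g s - g t| < e.
Proof.
move=> cg sT e0; have /cvgrPdist_lt/(_ e e0) := cg s.
have As : `[0, T]%classic s by rewrite /= in_itv.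
move=> /(nbhs_subspace_ex _ As)[U /nbhs_normP[d /= d0 HU] UE].
exists d => // t tT st; have At : `[0, T]%classic t by rewrite /= in_itv.
have : (U `&` `[0, T]) t by split=> //; exact: HU.
by rewrite -UE => -[].
Qed.

(** Continuation: the set of times up to which g <= rho is closed by continuity, and open because
    the bound becomes strict at its end. *)
Lemma bootstrap (T rho : R) (g : R -> R) : 0 < rho -> {within `[0, T], continuous g} ->
  g 0 <= rho ->
  (forall c, 0 <= c <= T -> (forall s, 0 <= s <= c -> g s <= rho) -> g c < rho) ->
  forall s, 0 <= s <= T -> g s <= rho.
Proof.
move=> rho0 cg g0 H s1 /andP[s10 s1T].
pose A := [set c | 0 <= c <= s1 /\ forall s, 0 <= s <= c -> g s <= rho].
have A0 : A 0.
  split=> [|s /andP[s0 s0']]; first by rewrite lexx.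
  by have -> : s = 0 by apply/eqP; rewrite eq_le s0' s0.
have hA : has_sup A by split; [exists 0|exists s1 => c [/andP[]]].
pose c := sup A.
have c0 : 0 <= c by apply: ub_le_sup => //; case: hA.
have cs1 : c <= s1 by apply: ge_sup; [exists 0|move=> r [/andP[]]].
have cT : 0 <= c <= T by rewrite c0 (le_trans cs1).
have below s : 0 <= s -> s < c -> g s <= rho.
  move=> s0 sc; have sc0 : 0 < c - s by rewrite subr_gt0.
  have [r [_ Hr]] := sup_adherent sc0 hA; rewrite -/c subKr => sr.
  by apply: Hr; rewrite s0 ltW.
have gc : g c <= rho.
  have [c00|cn0] := eqVneq c 0; first by rewrite c00.
  have cp : 0 < c by rewrite lt_neqAle eq_sym cn0.
  rewrite leNgt; apply/negP => gcr.
  have [|d d0 Hd] := within_continuous_dist cg cT (e := g c - rho); first by rewrite subr_gt0.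
  pose r := Num.max 0 (c - d / 2).
  have rc : r < c by rewrite /r gt_max cp/=; lra.
  have r0 : 0 <= r by rewrite /r le_max lexx.
  have rd : c - d / 2 <= r by rewrite /r le_max lexx orbT.
  have := Hd r; rewrite r0 (le_trans (ltW rc))//=; last by case/andP: cT.
  move=> /(_ isT); have -> : `|c - r| < d by rewrite ger0_norm ?subr_ge0 ?(ltW rc)//; lra.
  by move=> /(_ isT); rewrite ltr_norml => /andP[_]; have := below r r0 rc; lra.
have Ac : A c.
  split=> [|s /andP[s0]]; first by rewrite c0.
  by rewrite le_eqVlt => /orP[/eqP ->//|]; exact: below.
have [_ Hc] := Ac; have gc' := H c cT Hc.
have [cs|cns] := eqVneq c s1; first by rewrite -cs.
have cs : c < s1 by rewrite lt_neqAle cns.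
have [|d d0 Hd] := within_continuous_dist cg cT (e := rho - g c); first by rewrite subr_gt0.
pose r := Num.min s1 (c + d / 2).
have rs : r <= s1 by rewrite /r ge_min lexx.
have rd : r <= c + d / 2 by rewrite /r ge_min lexx orbT.
have cr : c < r by rewrite /r lt_min cs; lra.
have : A r.
  split=> [|s /andP[s0 sr]]; first by rewrite rs (le_trans c0 (ltW cr)).
  have [sc|cs'] := leP s c; first by apply: Hc; rewrite s0.
  have := Hd s; rewrite s0 (le_trans sr (le_trans rs s1T)) => /(_ isT).
  have -> : `|c - s| < d by rewrite ltr0_norm ?subr_lt0// ; lra.
  by move=> /(_ isT); rewrite ltr_norml => /andP[+ _]; lra.
move/(ub_le_sup (proj2 hA)); rewrite -/c; lra.
Qed.
End Bootstrap.

Section Trajectories.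
Context {R : realType} {n : nat}.
Notation V := 'rV[R]_n.
Notation mu := (@lebesgue_measure R).
Variable f : V * R -> V.
Hypothesis cf : continuous f.

Lemma within_interior_continuous (W : normedModType R) (T : R) (x : R -> W) s :
  {within `[0, T], continuous x} -> 0 < s < T -> {for s, continuous x}.
Proof.
move=> cx sT; have cx' : {within `]0, T[, continuous x}.
  by apply: continuous_subspaceW cx => r /=; rewrite !in_itv/= => /andP[? ?]; rewrite !ltW.
rewrite continuous_open_subspace in cx'; last exact: itv_open.
by apply: cx'; rewrite inE/= in_itv.
Qed.

Lemma measurable_field T (x : R -> V) (v : R -> R) i : {within `[0, T], continuous x} -> measurable_fun `]0, T[ v ->
  measurable_fun `]0, T[ (fun s => f (x s, v s) 0 i).
Proof.
move=> cx mv; apply: (@caratheodory_measurable _ T (fun a w => f (x a, w) 0 i)) => // [a w|s w sT].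
  apply: (@continuous_comp _ _ _ (fun w : R => f (x a, w)) (fun y : V => y 0 i)); last exact: coord_continuous.
  apply: (@continuous_comp _ _ _ (fun w : R => (x a, w)) f); last exact: cf.
  exact: (cvg_pair (cvg_cst (x a)) cvg_id).
apply: (@continuous_comp _ _ _ (fun a : R => f (x a, w)) (fun y : V => y 0 i)); last exact: coord_continuous.
apply: (@continuous_comp _ _ _ (fun a : R => (x a, w)) f); last exact: cf.
exact: (cvg_pair (within_interior_continuous cx sT) (cvg_cst w)).
Qed.

Lemma trajectory0 T x u : 0 <= T -> trajectory f T 0 x u -> x 0 = 0.
Proof.
move=> T0 [_ _ /(_ 0)]; rewrite in_itv/= lexx T0 => /(_ isT) ->.
by apply/rowP => i; rewrite !mxE add0r; exact: intgaa.
Qed.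

(** Passes from the control u to the representative v; the bound K makes the integrand a bounded
    function, as [prim] requires. *)
Lemma trajectory_vprim T x u v c M K : trajectory f T 0 x u -> bmf T v ->
  {ae mu, forall t, t \in `]0, T[ -> u t = v t} -> 0 <= c <= T ->
  (forall s, 0 <= s <= c -> `|x s| <= M) -> (forall s, `|v s| <= M) ->
  (forall y w, `|y| <= M -> `|w| <= M -> `|f (y, w)| <= K) ->
  vprim c x (fun s => f (x s, v s)).
Proof.
move=> tr [mv _] uv /andP[c0 cT] xM vM fK i; have [cx [mu_ _] xE] := tr.
have mS g (t : R) : t <= T -> measurable_fun `]0, T[ g -> measurable_fun `]0, t[ g.
  move=> tT; apply: measurable_funS => // r /=; rewrite !in_itv/= => /andP[-> rt].
  exact: lt_le_trans tT.
have mf := measurable_field i cx mv.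
split.
  split; first exact: mS mf.
  exists K => s /andP[s0 sc]; apply: le_trans (norm_row_coord _ _) _; apply: fK => //.
  by apply: xM; rewrite !ltW.
move=> t /andP[t0 tc]; have tT := le_trans tc cT.
have x00 := trajectory0 (le_trans c0 cT) tr.
have := xE t; rewrite in_itv/= t0 tT => /(_ isT) ->; rewrite x00 !mxE; congr (_ + _).
apply: ae_Rintegral_eq; [exact: mS (measurable_field i cx mu_)|exact: mS mf|].
apply: aeS uv => s H; rewrite in_itv/= => /andP[s0 st].
by rewrite H// in_itv/= s0 (lt_le_trans st).
Qed.
End Trajectories.

(** * Sign of the gap *)

Section GapSign.
Context {R : realType} {n : nat}.
Notation V := 'rV[R]_n.
Variables (F : V -> R -> V) (H L : V -> V) (B : V -> V -> V) (b q : V) (X0 X1 : V -> V).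
Hypotheses (lH : linear H) (lL : linear L) (bB : bilin B).
Hypothesis Bsym : forall x y, B x y = B y x.
Hypotheses (X0E : forall x, X0 x = H x + 2^-1 *: B x x) (X1E : forall x, X1 x = b + L x).
Variables (rho CT : R).
Hypotheses (rho0 : 0 < rho) (CT0 : 0 < CT).
Hypothesis taylorF : forall x u, `|x| <= rho -> `|u| <= rho ->
  `|F x u - quad_jet H L B b q x u| <= CT * (`|x| + `|u|) ^+ 3.

Notation S := (lie_space X0 X1 1).
Notation d := (\dim S).
Notation G := (nfG H L B b X0 X1).
Notation gam := (nf_gam H L B b X0 X1).
Notation xi := (krycoord H b X0 X1).
Notation P := (orthoproj S).
Notation Pp := (coproj S).
Notation lead := (leading S H B G q).
Notation w := (gapG S G).

Let bG : bilin G := bilin_nfG b lH lL bB X0 X1.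
Let HS := fun v => @lie_space_inv _ _ _ _ lH bB Bsym X0 X1 X0E v.
Let bS : b \in S. Proof. by apply: lie_space_b; [exact: lL|exact: X1E]. Qed.
Let Gsym := fun x y => @nfG_sym _ _ _ _ _ _ lH lL bB Bsym _ _ X0E X1E x y.
Let Gb := fun y => @nfG_b _ _ _ _ _ _ lH lL bB Bsym _ _ X0E X1E y.

Let bounds Tm (Tm0 : 0 < Tm) := curve_bounds lH lL bB HS bS CT0 taylorF Tm0.
Let master Tm (Tm0 : 0 < Tm) := curve_master lH lL bB bG HS bS Gsym Gb CT0 taylorF Tm0.
Let residual Tm (Tm0 : 0 < Tm) := curve_residual lH lL bB HS bS CT0 taylorF Tm0.

Lemma leadingE x u :
  lead x u = (2^-1 * u ^+ 2) *: Pp q + \sum_(i < d) xi i (P x) ^+ 2 *: gam i.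
Proof.
have [PS _] := orthoprojP S x; rewrite /leading; congr (_ + _).
have := nf_defectE lH lL bB Bsym X0E X1E PS PS; exact.
Qed.

Lemma coord_bound : exists2 C : R, 0 < C & forall i, (i < d)%N -> forall x, `|xi i (P x)| <= C * `|x|.
Proof.
have lA : linear (fun x : V => \row_(i < d) xi i (P x)).
  move=> a x y; apply/rowP => i; rewrite !mxE (linear_orthoproj S a x y).
  exact: (krycoord_linear H b X0 X1).
have [C C0 hC] := lin_bound lA; exists C => // i id x; apply: le_trans (hC x).
have := norm_row_coord (\row_(i < d) xi i (P x)) (Ordinal id); by rewrite mxE.
Qed.

Let gsum : R := \sum_(i < d) `|gam i|.
Let gsum0 : 0 <= gsum. Proof. by apply: sumr_ge0. Qed.

Lemma resonance_sum_bound (J : pred nat) (y : V) (a : R) : 0 <= a ->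
  (forall i, (i < d)%N -> J i -> gam i = 0 \/ xi i y ^+ 2 <= a) ->
  `|\sum_(i < d | J i) xi i y ^+ 2 *: gam i| <= a * gsum.
Proof.
move=> a0 ha; apply: le_trans (ler_norm_sum _ _ _) _.
apply: (@le_trans _ _ (\sum_(i < d | J i) a * `|gam i|)).
  apply: ler_sum => i Ji; rewrite normrZ ger0_norm ?sqr_ge0//.
  by have [->|xa] := ha i (ltn_ord i) Ji; [rewrite normr0 !mulr0|rewrite ler_wpM2r].
by rewrite -mulr_sumr ler_wpM2l// /gsum [leRHS](bigID (fun i : 'I_d => J i))/= lerDl sumr_ge0.
Qed.

Lemma moment3_le T (v : R -> R) (eta : R) : 0 <= T -> bmf T v -> (forall s, `|v s| <= eta) ->
  moment 3 T v <= eta * moment 2 T v.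
Proof.
move=> T0 bv ve; have b2 := bmf_moment 2 bv.
rewrite -(intgZ (lexx 0) (lexx T))//; apply: (intg_le (lexx 0) (lexx T)).
- exact: bmf_moment.
- exact: bmfZ.
by move=> s _; rewrite exprS ler_wpM2r// exprn_ge0.
Qed.

Lemma gap_cubic (Tmax : R) : 0 < Tmax -> Pp q = 0 -> (forall i, (i < d)%N -> gam i = 0) ->
  exists2 C : R, 0 < C & forall T X v, 0 <= T <= Tmax -> curve F rho T X v ->
  `|w (X T)| <= C * moment 3 T v.
Proof.
move=> Tm0 q0 g0; have [C C0 hC] := master Tm0; exists C => // T X v TT cX.
have l0 x u : lead x u = 0.
  by rewrite leadingE q0 scaler0 add0r big1// => i _; rewrite g0// scaler0.
have [||+ _] := hC T X v (fun=> 0) TT cX; first exact: bmf_cst.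
  by move=> s _; rewrite l0 normr0.
by have /andP[T0 _] := TT; rewrite (intg_cst _ T0) mul0r add0r.
Qed.

Lemma dot_ge0 (x : V) : 0 <= dot x x.
Proof. by apply: sumr_ge0 => i _; rewrite -expr2 sqr_ge0. Qed.

Lemma dot_gt0 (x : V) : x != 0 -> 0 < dot x x.
Proof.
move=> x0; rewrite lt_neqAle dot_ge0 andbT eq_sym; apply: contra x0 => /eqP/dot_eq0 ->.
exact: eqxx.
Qed.

Lemma gap_drift_quadratic : Pp q != 0 -> exists Tstar eta : R, [/\ 0 < Tstar, 0 < eta &
  forall T X v, 0 <= T <= Tstar -> curve F rho T X v -> (forall s, `|v s| <= eta) ->
  0 <= dot (w (X T)) (Pp q)].
Proof.
move=> q0; have [C1 C10 h1] := bounds ltr01; have [C C0 hC] := master ltr01.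
have [cx cx0 hx] := coord_bound.
set dl := Pp q in q0 *; pose g := dot dl dl; have g0 : 0 < g by exact: dot_gt0.
pose a := (cx * C1) ^+ 2; have a0 : 0 <= a by exact: sqr_ge0.
have D0 := normr_ge0 dl; have N0 : 0 <= n%:R :> R by [].
pose ch := `|dl| + a * gsum; have ch0 : 0 <= ch by rewrite addr_ge0// mulr_ge0.
(* Each error term below is at most one of the coefficients gathered in Q times e m_2. Taking e = g
   / (8 Q) keeps their sum under the main term g m_2 / 2. *)
pose Q := n%:R * (a * gsum) * `|dl| + C * `|dl| * (ch + 1) + 1.
have Q1 : 0 <= n%:R * (a * gsum) * `|dl| by rewrite mulr_ge0// mulr_ge0// mulr_ge0.
have Q2 : 0 <= C * `|dl| * ch by rewrite mulr_ge0// mulr_ge0// ltW.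
have Q3 : 0 <= C * `|dl| by rewrite mulr_ge0// ltW.
have Q0 : 0 < Q by rewrite /Q mulrDr mulr1; lra.
pose e := g / (8 * Q); have e0 : 0 < e by rewrite divr_gt0// mulr_gt0.
have eQ : e * Q = g / 8.
  by rewrite /e invfM mulrA -mulrA mulVf ?mulr1// gt_eqF.
exists (Num.min 1 e), (Num.min 1 e); split; rewrite ?lt_min ?ltr01//.
move=> T X v /andP[T0]; rewrite le_min => /andP[T1 Te] cX ve.
have TT : 0 <= T <= 1 by rewrite T0.
have [vX X00 bv vb Xb] := cX.
have m2 := moment_ge0 2 T v; have m3 := moment_ge0 3 T v.
have m32 := moment3_le T0 bv ve.
have s1 := moment1_sqr bv T0; have b2 := bmf_moment 2 bv.
(* The coordinates are bounded by the first moment, whose square is at most T m_2: the resonance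
   terms are smaller than \int v^2 by a power of T. *)
have hxi i s : (i < d)%N -> 0 < s < T -> xi i (P (X s)) ^+ 2 <= a * (T * moment 2 T v).
  move=> id /andP[s0 sT]; have sT' : 0 <= s <= T by rewrite !ltW.
  have [hX _] := h1 T X v TT cX s sT'.
  rewrite -real_normK ?num_real//; apply: (@le_trans _ _ ((cx * (C1 * moment 1 T v)) ^+ 2)).
    rewrite ler_pXn2r ?nnegrE//.
      by apply: le_trans (hx i id _) _; rewrite ler_wpM2l ?(ltW cx0).
    exact: mulr_ge0 (ltW cx0) (mulr_ge0 (ltW C10) (moment_ge0 1 T v)).
  by rewrite mulrA exprMn ler_wpM2l.
have aT0 : 0 <= a * (T * moment 2 T v) by rewrite mulr_ge0// mulr_ge0.
have hsum s : 0 < s < T ->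
    `|\sum_(i < d) xi i (P (X s)) ^+ 2 *: gam i| <= a * (T * moment 2 T v) * gsum.
  by move=> sT; apply: (resonance_sum_bound (J := xpredT)) => // i id _; right; exact: hxi.
pose A := a * (T * moment 2 T v) * gsum; have A0 : 0 <= A by rewrite mulr_ge0.
have [||_ hd] := hC T X v (fun s => `|dl| * `|v s| ^+ 2 + A) TT cX.
- by apply: bmfD; [exact: bmfZ|exact: bmf_cst].
- move=> s sT; rewrite leadingE; apply: le_trans (ler_normD _ _) _; apply: lerD; last exact: hsum.
  rewrite normrZ mulrC ler_wpM2l// normrM normrX ger0_norm ?invr_ge0// ler_piMl ?exprn_ge0//.
  by rewrite invf_le1 ?ler1n.
apply: le_trans (hd dl (fun s => g / 2 * `|v s| ^+ 2 - n%:R * A * `|dl|) _ _); last first.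
- move=> s sT; rewrite leadingE dotDl dotZl -/dl -/g real_normK ?num_real//; apply: lerD.
    by rewrite le_eqVlt; apply/orP; left; apply/eqP; ring.
  rewrite lerNl; apply: le_trans (ler_norm _) _; rewrite normrN.
  apply: le_trans (dot_bound _ _) _; rewrite ler_wpM2r// ler_wpM2l//; exact: hsum.
- by apply: bmfB; [exact: bmfZ|exact: bmf_cst].
rewrite (intgB (lexx 0) (lexx T)) ?(intgD (lexx 0) (lexx T)); [|exact: bmfZ|exact: bmf_cst|exact: bmfZ|exact: bmf_cst].
rewrite !(intg_cst _ T0) !(intgZ (lexx 0) (lexx T))// subr0 -[intg _ _ _]/(moment 2 T v).
move: m2 m3 m32; set U2 := moment 2 T v; set U3 := moment 3 T v => m2 m3 m32.
have U3U2 : U3 <= U2.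
  by apply: le_trans m32 _; rewrite -[leRHS]mul1r ler_wpM2r// ge_min lexx.
have U3e : U3 <= e * U2 by apply: le_trans m32 _; rewrite ler_wpM2r// ge_min lexx orbT.
set p1 := n%:R * (a * gsum) * `|dl| in Q1; set p2 := C * `|dl| * ch in Q2; set p3 := C * `|dl| in Q3.
have TU : T * U2 <= e * U2 by rewrite ler_wpM2r.
have TTU : T * (T * U2) <= T * U2 by rewrite -[leRHS]mul1r ler_wpM2r// mulr_ge0.
have z1 : n%:R * A * `|dl| * T <= p1 * (e * U2).
  have -> : n%:R * A * `|dl| * T = p1 * (T * (T * U2)) by rewrite /p1 /A -/U2; ring.
  by rewrite ler_wpM2l// (le_trans TTU).
have z2 : p3 * (T * (`|dl| * U2 + A * T)) <= p2 * (e * U2).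
  have -> : p3 * (T * (`|dl| * U2 + A * T)) = p3 * (`|dl| * (T * U2) + a * gsum * (T * (T * (T * U2)))).
    by rewrite /A -/U2; ring.
  have -> : p2 * (e * U2) = p3 * (`|dl| * (e * U2) + a * gsum * (e * U2)) by rewrite /p2 /p3 /ch; ring.
  rewrite ler_wpM2l//; apply: lerD; apply: ler_wpM2l => //; first exact: mulr_ge0.
  by apply: le_trans (ler_wpM2l T0 TTU) _; exact: le_trans TTU TU.
have z3 : p3 * (T * U3) <= p3 * (e * U2).
  by rewrite ler_wpM2l//; apply: le_trans TU; rewrite ler_wpM2l.
have z4 : p3 * U3 <= p3 * (e * U2) by rewrite ler_wpM2l.
have zQ : (p1 + p2 + p3) * (e * U2) <= g / 8 * U2.
  by rewrite -eQ -mulrA mulrCA ler_wpM2l ?(ltW e0)// ler_wpM2r// /Q mulrDr mulr1 addrA lerDl.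
have pe : p3 * (e * U2) <= (p1 + p2 + p3) * (e * U2).
  apply: ler_wpM2r; first exact: mulr_ge0 (ltW e0) m2.
  by rewrite lerDr; exact: addr_ge0.
have gU : 0 <= g * U2 by rewrite mulr_ge0// ltW.
have -> : g / 2 * U2 - n%:R * A * `|dl| * T - p3 * (T * (`|dl| * U2 + A * T + U3) + U3) =
  g * U2 / 2 - (n%:R * A * `|dl| * T) - p3 * (T * (`|dl| * U2 + A * T)) - p3 * (T * U3) - p3 * U3 by ring.
have {}zQ : (p1 + p2 + p3) * (e * U2) <= g * U2 / 8 by apply: le_trans zQ _; lra.
rewrite !mulrDl in zQ pe.
move: z1 z2 z3 z4 zQ pe gU.
set y1 := n%:R * A * `|dl| * T; set y2 := p3 * (T * _); set y3 := p3 * (T * U3); set y4 := p3 * U3.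
set y5 := p1 * _; set y6 := p2 * _; set y7 := p3 * (e * _); set y8 := g * U2.
lra.
Qed.

(** Here k counts from 0. The chain has [phi k.+1] = v, its (k+1)-th primitive [phi 0] and its
    derivative of order 2 (k+1) at index 3 (k+1). The main term is g / 2 times N = \int (phi 0)^2,
    and the interpolation inequality turns every third moment into a small multiple of N. *)
Lemma gap_drift_resonance k : Pp q = 0 -> (k < d)%N -> (forall i, (i < k)%N -> gam i = 0) ->
  gam k != 0 -> exists Tstar K0 : R, [/\ 0 < Tstar, 0 < K0 &
  forall T X v phi K, 0 < T <= Tstar -> curve F rho T X v -> prim_chain T (3 * k.+1) phi ->
    (forall s, phi k.+1 s = v s) -> (forall j, (j <= k)%N -> phi j 0 = 0) -> 0 < K <= K0 ->
    (forall s, 0 < s < T -> `|phi (3 * k.+1)%N s| <= K) ->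
    (forall s, 0 <= s <= T -> `|phi 0%N s| <= K * T ^+ (3 * k.+1)) ->
    0 <= dot (w (X T)) (gam k)].
Proof.
move=> q0 kd gk0 gkn0; have [Cr Cr0 hr] := residual ltr01 k.+1; have [C C0 hC] := master ltr01.
have [cx cx0 hx] := coord_bound; have [CG CG0 hG] := @chain_cube R k.+1 isT.
set dl := gam k in gkn0 *; pose g := dot dl dl; have g0 : 0 < g by exact: dot_gt0.
pose a := (cx * Cr) ^+ 2; have a0 : 0 <= a by exact: sqr_ge0.
have D0 := normr_ge0 dl; have N0 : 0 <= n%:R :> R by [].
pose b2 := 2 * `|dl| + gsum; have b20 : 0 <= b2 := addr_ge0 (mulr_ge0 (ler0n R 2) D0) gsum0.
pose ch := 2 * `|dl| + b2 * (2 * a); have aa0 : 0 <= 2 * a := mulr_ge0 (ler0n R 2) a0.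
have ch0 : 0 <= ch := addr_ge0 (mulr_ge0 (ler0n R 2) D0) (mulr_ge0 b20 aa0).
pose b1 := g + n%:R * gsum * `|dl|.
have b10 : 0 <= b1 := addr_ge0 (ltW g0) (mulr_ge0 (mulr_ge0 N0 gsum0) D0).
pose p1 := b1 * (2 * a); have p10 : 0 <= p1 := mulr_ge0 b10 aa0.
pose p3 := C * `|dl|; have p30 : 0 <= p3 := mulr_ge0 (ltW C0) D0.
pose p2 := p3 * ch; have p20 : 0 <= p2 := mulr_ge0 p30 ch0.
(* The errors below add up to at most 2 (p1 + p2 + p3) e N, that is g N / 4 at most by the choice of
   e, against a main term g N / 2. The second component of the witness makes CG K at most min 1
   e. *)
pose Q := p1 + p2 + p3 + 1; have Q0 : 0 < Q := ltr_wpDl (addr_ge0 (addr_ge0 p10 p20) p30) ltr01.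
pose e := g / (8 * Q); have e0 : 0 < e by rewrite divr_gt0// mulr_gt0.
have eQ : e * Q = g / 8 by rewrite /e invfM mulrA -mulrA mulVf ?mulr1// gt_eqF.
exists (Num.min 1 e), (Num.min 1 e / CG); split; rewrite ?divr_gt0 ?lt_min ?ltr01//.
move=> T X v phi K /andP[Tp]; rewrite le_min => /andP[T1 Te] cX hphi phiv phi0 /andP[Kp KK] phitop phibot.
have T0 := ltW Tp; have TT : 0 <= T <= 1 by rewrite T0.
have [vX X00 bv vb Xb] := cX.
have m3 := moment_ge0 3 T v; have m2 := moment_ge0 2 T v.
pose N := intg 0 T (fun s => phi 0%N s ^+ 2).
have Np : 0 <= N by apply: intg_ge0 => s _; exact: sqr_ge0.
have U3N : moment 3 T v <= Num.min 1 e * N.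
  have := hG T phi K Tp hphi Kp phitop phibot.
  have -> : (fun s => `|phi k.+1 s| ^+ 3) = (fun s => `|v s| ^+ 3).
    by apply/funext => s; rewrite phiv.
  move/le_trans; apply; rewrite -/N ler_wpM2r// mulrC.
  by rewrite -ler_pdivlMr.
have bphi : bmf T (phi 0%N) by apply: prim_bmf; exact: (hphi 0%N).
have bphi2 : bmf T (fun s => phi 0%N s ^+ 2) by exact: bmfX.
pose I := intg 0 T (fun s => `|phi 0%N s|).
have I0 : 0 <= I by exact: intg_ge0.
have I2 : I ^+ 2 <= T * N.
  have := intg_sqr_le (bmf_norm bphi) (t := T); rewrite T0 lexx => /(_ isT).
  have -> : (fun s => `|phi 0%N s| ^+ 2) = (fun s => phi 0%N s ^+ 2).
    by apply/funext => s; rewrite real_normK ?num_real.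
  exact.
(* Since |v| <= 1, \int v^4 is at most the third moment. *)
have V2 : moment 2 T v ^+ 2 <= T * moment 3 T v.
  have := intg_sqr_le (bmf_moment 2 bv) (t := T); rewrite T0 lexx => /(_ isT) H2.
  apply: le_trans H2 _; rewrite ler_wpM2l//; apply: (intg_le (lexx 0) (lexx T)).
  - by apply: bmfX; exact: bmf_moment.
  - exact: bmf_moment.
  move=> s _; rewrite -exprM -[(2 * 2)%N]/(3.+1) exprS ler_piMl ?exprn_ge0//.
  by have := vb s; rewrite le_min => /andP[].
(* The numbering is reversed: [psi j] is the j-th primitive of v and [psi k.+1] is [phi 0]. *)
pose psi j := phi (k.+1 - j)%N.
have hpsi j : (j < k.+1)%N -> prim T (psi j.+1) (psi j) /\ psi j.+1 0 = 0.
  move=> jk; rewrite /psi subSS; split; last by apply: phi0; exact: leq_subr.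
  have jk' : (j <= k)%N by [].
  rewrite (subSn jk'); apply: hphi; exact: leq_ltn_trans (leq_subr j k) (leq_pmull k.+1 (isT : (0 < 3)%N)).
have psik : psi k.+1 = phi 0%N by rewrite /psi subnn.
have bpsi : bmf T (psi k.+1) by rewrite psik.
have psi0 s : psi 0%N s = v s by rewrite /psi subn0.
have hres := hr T X v psi TT cX psi0 bpsi hpsi; rewrite psik -/I in hres.
(* A bound for the squared coordinates of the residual, from (I + m_2)^2 <= 2 (I^2 + m_2^2), I^2 <=
   T N and m_2^2 <= T m_3. *)
pose rb := a * (2 * (T * N + T * moment 3 T v)).
have rb0 : 0 <= rb by rewrite mulr_ge0// mulr_ge0// addr_ge0// mulr_ge0.
pose r s := X s - \sum_(j < k.+1) psi j.+1 s *: kry H b j.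
have rbP i s : (i < d)%N -> 0 < s < T -> xi i (P (r s)) ^+ 2 <= rb.
  move=> id /andP[s0 sT]; have sT' : 0 <= s <= T by rewrite !ltW.
  rewrite -real_normK ?num_real//.
  apply: (@le_trans _ _ ((cx * (Cr * (I + moment 2 T v))) ^+ 2)).
    rewrite ler_pXn2r ?nnegrE//; last by rewrite mulr_ge0 ?(ltW cx0)// mulr_ge0 ?(ltW Cr0)// addr_ge0.
    by apply: le_trans (hx i id _) _; rewrite ler_wpM2l ?(ltW cx0)//; exact: hres.
  rewrite mulrA exprMn ler_wpM2l//.
  apply: (@le_trans _ _ (2 * (I ^+ 2 + moment 2 T v ^+ 2))); last by rewrite ler_wpM2l// lerD.
  rewrite -subr_ge0.
  have -> : 2 * (I ^+ 2 + moment 2 T v ^+ 2) - (I + moment 2 T v) ^+ 2 = (I - moment 2 T v) ^+ 2 by ring.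
  exact: sqr_ge0.
(* The explicit part only involves H^j b for j <= k. It contributes [phi 0] to the coordinate k and
   nothing to the coordinates above k; those below k are not small, but their gam vanish. *)
have PX s i : (i < d)%N -> xi i (P (X s)) =
    xi i (P (r s)) + \sum_(j < k.+1) psi j.+1 s * xi i (kry H b j).
  move=> id; have -> : X s = r s + \sum_(j < k.+1) psi j.+1 s *: kry H b j by rewrite /r subrK.
  have lP := linear_orthoproj S; have lx := krycoord_linear H b X0 X1 i.
  rewrite (linD lP) [xi i (_ + _)](linD lx) (lin_sum lP) (lin_sum lx); congr (_ + _).
  apply: eq_bigr => j _; rewrite (linZ lP) orthoproj_in; first exact: (linZ lx).
  exact: (kry_in lH lL bB Bsym X0E X1E).
have xik s : xi k (P (X s)) = phi 0%N s + xi k (P (r s)).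
  rewrite (PX s k kd) addrC; congr (_ + _); rewrite (bigD1 ord_max)//= big1.
    by rewrite (krycoord_kry lH lL bB Bsym X0E X1E)// eqxx mulr1 addr0 psik.
  move=> j jk; have jk' : (j < k)%N.
    by rewrite ltn_neqAle -ltnS ltn_ord andbT; apply: contra jk => /eqP jk; apply/eqP/val_inj.
  by rewrite (krycoord_kry lH lL bB Bsym X0E X1E)// ?(ltn_trans jk')// gtn_eqF// mulr0.
have xii s i : (i < d)%N -> (k < i)%N -> xi i (P (X s)) = xi i (P (r s)).
  move=> id ki; rewrite (PX s i id) big1 ?addr0// => j _; have ji : (j < i)%N by rewrite (leq_trans (ltn_ord j)).
  by rewrite (krycoord_kry lH lL bB Bsym X0E X1E)// ?(ltn_trans ji)// gtn_eqF// mulr0.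
pose rest s := \sum_(i < d | i != k :> nat) xi i (P (X s)) ^+ 2 *: gam i.
have leadE s : lead (X s) (v s) = xi k (P (X s)) ^+ 2 *: dl + rest s.
  rewrite leadingE q0 scaler0 add0r (bigD1 (Ordinal kd))//=.
have hrest s : 0 < s < T -> `|rest s| <= rb * gsum.
  move=> sT; apply: (resonance_sum_bound (J := fun i => i != k)) => // i id.
  rewrite neq_ltn => /orP[ik|ki]; [by left; exact: gk0|right].
  by rewrite xii//; exact: rbP.
have sq_up (x y : R) : (x + y) ^+ 2 <= 2 * x ^+ 2 + 2 * y ^+ 2.
  rewrite -subr_ge0; have -> : 2 * x ^+ 2 + 2 * y ^+ 2 - (x + y) ^+ 2 = (x - y) ^+ 2 by ring.
  exact: sqr_ge0.
have sq_lo (x y : R) : x ^+ 2 / 2 - y ^+ 2 <= (x + y) ^+ 2.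
  rewrite -subr_ge0; have -> : (x + y) ^+ 2 - (x ^+ 2 / 2 - y ^+ 2) = (x + 2 * y) ^+ 2 / 2 by field.
  by rewrite divr_ge0 ?sqr_ge0.
have [||_ hd] := hC T X v (fun s => 2 * `|dl| * phi 0%N s ^+ 2 + b2 * rb) TT cX.
- by apply: bmfD; [exact: bmfZ|exact: bmf_cst].
- move=> s sT; rewrite leadE; apply: le_trans (ler_normD _ _) _.
  apply: le_trans (lerD (lexx _) (hrest s sT)) _.
  have -> : 2 * `|dl| * phi 0%N s ^+ 2 + b2 * rb = (2 * phi 0%N s ^+ 2 + 2 * rb) * `|dl| + rb * gsum.
    by rewrite /b2; ring.
  rewrite lerD2r normrZ ger0_norm ?sqr_ge0// ler_wpM2r//.
  rewrite xik; apply: le_trans (sq_up _ _) _; rewrite lerD2l ler_wpM2l//; exact: rbP.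
apply: le_trans (hd dl (fun s => g / 2 * phi 0%N s ^+ 2 - b1 * rb) _ _); last first.
- move=> s sT; rewrite leadE dotDl dotZl -/g xik.
  have -> : g / 2 * phi 0%N s ^+ 2 - b1 * rb = (phi 0%N s ^+ 2 / 2 - rb) * g - n%:R * (rb * gsum) * `|dl|.
    by rewrite /b1; ring.
  apply: lerD.
    rewrite ler_wpM2r ?(ltW g0)//; apply: le_trans (sq_lo _ _); rewrite lerD2l lerN2; exact: rbP.
  rewrite lerNl; apply: le_trans (ler_norm _) _; rewrite normrN.
  by apply: le_trans (dot_bound _ _) _; rewrite ler_wpM2r// ler_wpM2l//; exact: hrest.
- by apply: bmfB; [exact: bmfZ|exact: bmf_cst].
rewrite (intgB (lexx 0) (lexx T)) ?(intgD (lexx 0) (lexx T)); [|exact: bmfZ|exact: bmf_cst|exact: bmfZ|exact: bmf_cst].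
rewrite !(intg_cst _ T0) !(intgZ (lexx 0) (lexx T))// subr0 -[intg _ _ _]/N.
set U3 := moment 3 T v in m3 U3N rb rb0 hd rbP hrest *.
have U3U2 : U3 <= N by apply: le_trans U3N _; rewrite -[leRHS]mul1r ler_wpM2r// ge_min lexx.
have U3e : U3 <= e * N by apply: le_trans U3N _; rewrite ler_wpM2r// ge_min lexx orbT.
have TN0 : 0 <= T * N by rewrite mulr_ge0.
have TN : T * N <= e * N by rewrite ler_wpM2r.
have eN0 : 0 <= e * N := le_trans TN0 TN.
have TTN : T * (T * N) <= T * N by rewrite -[leRHS]mul1r ler_wpM2r.
have TU : T * U3 <= T * N by rewrite ler_wpM2l.
have z0 : rb <= 2 * a * (2 * (T * N)).
  rewrite /rb [leLHS]mulrCA -[leRHS]mulrA ler_wpM2l// ler_wpM2l//; move: TU; lra.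
have z01 : rb * T <= 2 * a * (2 * (T * N)).
  by apply: le_trans z0; rewrite ler_piMr.
have z1 : b1 * rb * T <= 2 * (p1 * (e * N)).
  have -> : 2 * (p1 * (e * N)) = b1 * (2 * a * (2 * (e * N))) by rewrite /p1; ring.
  rewrite -mulrA ler_wpM2l//; apply: le_trans z01 _; rewrite ler_wpM2l// ler_wpM2l//.
have z2 : p3 * (T * (2 * `|dl| * N + b2 * rb * T)) <= 2 * (p2 * (e * N)).
  have -> : 2 * (p2 * (e * N)) = p3 * (2 * `|dl| * (2 * (e * N)) + b2 * (2 * a * (2 * (e * N)))).
    by rewrite /p2 /ch; ring.
  rewrite ler_wpM2l//.
  have -> : T * (2 * `|dl| * N + b2 * rb * T) = 2 * `|dl| * (T * N) + b2 * (T * (rb * T)) by ring.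
  apply: lerD.
    rewrite ler_wpM2l ?mulr_ge0//; move: TN eN0; lra.
  rewrite ler_wpM2l//; apply: (@le_trans _ _ (rb * T)).
    by rewrite ler_piMl// mulr_ge0.
  by apply: le_trans z01 _; rewrite ler_wpM2l// ler_wpM2l.
have z3 : p3 * (T * U3) <= p3 * (e * N) by rewrite ler_wpM2l// (le_trans TU).
have z4 : p3 * U3 <= p3 * (e * N) by rewrite ler_wpM2l.
have {}zQ : (p1 + p2 + p3) * (e * N) <= g * N / 8.
  have -> : g * N / 8 = e * Q * N by rewrite eQ; ring.
  rewrite -mulrA mulrCA ler_wpM2l ?(ltW e0)// ler_wpM2r// /Q lerDl//.
have gU : 0 <= g * N by rewrite mulr_ge0// ltW.
have -> : g / 2 * N - b1 * rb * T - p3 * (T * (2 * `|dl| * N + b2 * rb * T + U3) + U3) =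
  g * N / 2 - (b1 * rb * T) - p3 * (T * (2 * `|dl| * N + b2 * rb * T)) - p3 * (T * U3) - p3 * U3 by ring.
rewrite !mulrDl in zQ.
move: z1 z2 z3 z4 zQ gU.
set y1 := b1 * rb * T; set y2 := p3 * (T * (_ + _)); set y3 := p3 * (T * U3); set y4 := p3 * U3.
set y5 := p1 * _; set y6 := p2 * _; set y7 := p3 * (e * _); set y8 := g * N.
lra.
Qed.
End GapSign.

(** * From controls to chains of primitives *)

Section ControlNorms.
Context {R : realType}.
Notation mu := (@lebesgue_measure R).

Lemma moment3_Lpnorm (T : R) (u v : R -> R) : measurable_fun `]0, T[ u -> bmf T v ->
  {ae mu, forall t, t \in `]0, T[ -> u t = v t} ->
  ((moment 3 T v)%:E = Lpnorm 3%:E T u ^+ 3)%E.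
Proof.
move=> mu_ [mv [M vM]] uv; have bv : bmf T v by split=> //; exists M.
have E : (Lpnorm 3%:E T u `^ 3%:R = (moment 3 T v)%:E)%E.
  rewrite /Lpnorm poweR_Lnorm ?pnatr_eq0//.
  rewrite /moment /intg /Rintegral fineK; last first.
    by apply: integrable_fin_num => //; apply: (bmf_integrable (bmf_moment 3 bv)).
  rewrite [in RHS]integral_mkcond; apply: ae_eq_integral => //.
  - apply: (@measurableT_comp _ _ _ _ _ _ (fun x : \bar R => (x `^ 3)%E)); first exact: measurable_poweR.
    apply: measurableT_comp => //; apply/measurable_EFinP.
    exact/(measurable_restrictT _ _).1.
  - apply/(measurable_restrictT _ _).1 => //; apply/measurable_EFinP.
    by have [] := bmf_moment 3 bv.
  - apply: aeS uv => t uvt _ /=; rewrite !patchE; case: ifPn => tT.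
      rewrite inE/= in tT; rewrite uvt// powR_mulrn//.
    by rewrite /= normr0 powR0// pnatr_eq0.
have := Lpnorm_ge0 3%:E T u; move: E; case: (Lpnorm 3%:E T u) => [r|//|//] /=.
  move=> [E] r0; rewrite lee_fin in r0.
  by rewrite -E powR_mulrn// -!EFinM exprS expr2.
by rewrite pnatr_eq0.
Qed.

Lemma chain_bound T N (phi : nat -> R -> R) (K : R) : 0 <= K -> prim_chain T N phi ->
  (forall j, (j < N)%N -> phi j 0 = 0) -> (forall s, 0 < s < T -> `|phi N s| <= K) ->
  forall i, (0 < i <= N)%N -> forall s, 0 <= s <= T -> `|phi (N - i)%N s| <= K * s ^+ i.
Proof.
move=> K0 ph ph0 phK; elim=> [//|i IH] /andP[_ iN] s /andP[s0 sT].
have ji : ((N - i.+1).+1 = N - i)%N by rewrite subnSK.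
have jN : (N - i.+1 < N)%N by rewrite -subn_gt0 subKn.
have [bg E] := ph _ jN; rewrite E ?s0// ph0// add0r ji exprSr mulrA.
rewrite ji in bg; have := intg_bound bg (lexx 0) s0 sT (M := K * s ^+ i).
rewrite subr0; apply=> r /andP[r0 rs].
have rT : 0 < r < T by rewrite r0 (lt_le_trans rs).
case: i IH iN {ji jN E bg} => [|i] IH iN; first by rewrite subn0 expr0 mulr1 phK.
have rT' : 0 <= r <= T by case/andP: rT => *; rewrite !ltW.
have iN' : (0 < i.+1 <= N)%N by rewrite /= ltnW.
apply: le_trans (IH iN' r rT') _.
by rewrite ler_wpM2l// ler_pXn2r ?nnegrE ?(ltW r0) ?(ltW rs).
Qed.

(** Prolongs a chain on the integrated side by k primitives vanishing at 0, with a shift of the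
    indices by k. *)
Lemma extend_chain T m k (g : nat -> R -> R) : 0 <= T -> prim_chain T m g -> bmf T (g 0%N) ->
  exists phi : nat -> R -> R, [/\ prim_chain T (k + m) phi, forall i s, phi (k + i)%N s = g i s &
    forall j, (j < k)%N -> phi j 0 = 0].
Proof.
move=> T0 pg bg; pose psi := fix psi j := if j is j'.+1 then (fun t => intg 0 t (psi j')) else g 0%N.
have bpsi j : bmf T (psi j).
  by elim: j => [//|j IH] /=; exact: prim_bmf (prim0 T0 IH).
pose phi j := if (j <= k)%N then psi (k - j)%N else g (j - k)%N.
exists phi; split=> [j jk|i s|j jk].
- rewrite /phi; have [jlt|jge] := ltnP j k.
    by rewrite ltnW// -(subnSK jlt) /=; exact: prim0.
  have [-> |jk'] := eqVneq j k.
    by rewrite leqnn subnn subSnn; apply: pg; lia.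
  have kj : (k < j)%N by rewrite ltn_neqAle eq_sym jk'.
  by rewrite leqNgt kj/= subSn//; apply: pg; lia.
- rewrite /phi; case: i => [|i]; first by rewrite addn0 leqnn subnn.
  by rewrite leqNgt addnS ltnS leq_addr/= -addnS addKn.
by rewrite /phi ltnW// -(subnSK jk) /= intgaa.
Qed.
End ControlNorms.

Section TrajectoryCurve.
Context {R : realType} {n : nat}.
Notation V := 'rV[R]_n.
Notation mu := (@lebesgue_measure R).
Variable f : V * R -> V.
Hypothesis cf : continuous f.

Lemma trajectory_curve (rho cF C Tmax : R) : 0 < rho -> 0 <= cF -> 0 < C -> 0 < Tmax ->
  (forall x u, `|x| <= Num.min rho 1 -> `|u| <= Num.min rho 1 -> `|f (x, u)| <= cF * (`|x| + `|u|)) ->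
  (forall T X v, 0 <= T <= Tmax -> curve (fun x u => f (x, u)) rho T X v ->
    forall s, 0 <= s <= T -> `|X s| <= C * moment 1 T v) ->
  exists2 eta : R, 0 < eta & forall T x u v, 0 < T <= Tmax -> trajectory f T 0 x u -> bmf T v ->
    {ae mu, forall t, t \in `]0, T[ -> u t = v t} -> (forall s, `|v s| <= eta) ->
    forall t, 0 <= t <= T -> curve (fun x u => f (x, u)) rho t x v.
Proof.
move=> rho0 cF0 C0 Tm0 fF hC; set r1 := Num.min rho 1 in fF *.
have r10 : 0 < r1 by rewrite lt_min rho0 ltr01.
pose eta := Num.min r1 (r1 / (2 * (C * Tmax))).
have CT0 : 0 < 2 * (C * Tmax) by rewrite mulr_gt0// mulr_gt0.
exists eta; first by rewrite lt_min r10 divr_gt0.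
move=> T x u v /andP[T0 TM] tr bv uv ve t tT.
have vr s : `|v s| <= r1 by apply: le_trans (ve s) _; rewrite ge_min lexx.
have [cx _ _] := tr.
have cnx : {within `[0, T], continuous (fun s => `|x s|)}.
  by move=> s; apply: continuous_comp; [exact: cx|exact: norm_continuous].
have x00 := trajectory0 (ltW T0) tr.
have K y w : `|y| <= r1 -> `|w| <= r1 -> `|f (y, w)| <= cF * (r1 + r1).
  by move=> yr wr; apply: le_trans (fF y w yr wr) _; rewrite ler_wpM2l// lerD.
have cu c : 0 <= c <= T -> (forall s, 0 <= s <= c -> `|x s| <= r1) ->
    curve (fun x u => f (x, u)) rho c x v.
  move=> cT xr; split=> //; last by apply: bmfS bv; case/andP: cT.
  exact: (trajectory_vprim cf tr bv uv cT xr vr K).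
have xr : forall s, 0 <= s <= T -> `|x s| <= r1.
  apply: (bootstrap r10 cnx); first by rewrite x00 normr0 ltW.
  move=> c cT xr; have /andP[c0 cT'] := cT; have cc := cu c cT xr.
  have cM : 0 <= c <= Tmax by rewrite c0 (le_trans cT').
  apply: le_lt_trans (hC c x v cM cc c _) _; first by rewrite c0 lexx.
  have m1 : moment 1 c v <= eta * Tmax.
    have b1 := bmf_moment 1 (bmfS cT' bv).
    apply: (@le_trans _ _ (intg 0 c (fun=> eta))).
      by apply: (intg_le (lexx 0) (lexx c)) => [||s _]; [|exact: bmf_cst|exact: ve].
    rewrite intg_cst// subr0 ler_wpM2l//; last exact: le_trans TM.
    by rewrite le_min (ltW r10) divr_ge0// ltW.
  apply: (@le_lt_trans _ _ (r1 / 2)); last by rewrite ltr_pdivrMr// ltr_pMr// ltr1n.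
  apply: le_trans (ler_wpM2l (ltW C0) m1) _.
  have -> : C * (eta * Tmax) = eta * (2 * (C * Tmax)) / 2 by field.
  by rewrite ler_pM2r ?invr_gt0// -ler_pdivlMr// ge_min lexx orbT.
apply: cu => // s /andP[s0 st]; apply: xr; rewrite s0 (le_trans st)//; by case/andP: tT.
Qed.
End TrajectoryCurve.

(** * Estimates for trajectories and obstruction to controllability *)

Section Alternative.
Context {R : realType} {n : nat}.
Notation V := 'rV[R]_n.
Notation mu := (@lebesgue_measure R).
Variables (f : V * R -> V) (H L : V -> V) (B : V -> V -> V) (b q : V) (X0 X1 : V -> V).
Hypothesis cf : continuous f.
Hypotheses (lH : linear H) (lL : linear L) (bB : bilin B).
Hypothesis Bsym : forall x y, B x y = B y x.
Hypotheses (X0E : forall x, X0 x = H x + 2^-1 *: B x x) (X1E : forall x, X1 x = b + L x).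
Variables (rho CT : R).
Hypotheses (rho0 : 0 < rho) (CT0 : 0 < CT).
Hypothesis taylorF : forall x u, `|x| <= rho -> `|u| <= rho ->
  `|f (x, u) - quad_jet H L B b q x u| <= CT * (`|x| + `|u|) ^+ 3.

Notation S := (lie_space X0 X1 1).
Notation d := (\dim S).
Notation G := (nfG H L B b X0 X1).
Notation gam := (nf_gam H L B b X0 X1).
Notation Pp := (coproj S).
Notation w := (gapG S G).

Let HS := fun v => @lie_space_inv _ _ _ _ lH bB Bsym X0 X1 X0E v.
Let bS : b \in S. Proof. by apply: lie_space_b; [exact: lL|exact: X1E]. Qed.

Lemma small_curve (Tmax : R) : 0 < Tmax ->
  exists2 eta : R, 0 < eta & forall T x u v, 0 < T <= Tmax -> trajectory f T 0 x u -> bmf T v ->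
    {ae mu, forall t, t \in `]0, T[ -> u t = v t} -> (forall s, `|v s| <= eta) ->
    forall t, 0 <= t <= T -> curve (fun x u => f (x, u)) rho t x v.
Proof.
move=> Tm0; have [cF cF0 hF] := field_bounds lH lL bB HS bS CT0 taylorF.
have [C C0 hC] := curve_bounds lH lL bB HS bS CT0 taylorF Tm0.
apply: (@trajectory_curve _ _ f cf rho cF C Tmax rho0 (ltW cF0) C0 Tm0).
- by move=> x u xr ur; have [] := hF x u xr ur.
- by move=> T X v TT cX s sT; have [] := hC T X v TT cX s sT.
Qed.

Lemma clamped_curve (Tmax : R) : 0 < Tmax ->
  exists2 eta0 : R, 0 < eta0 & forall eta T x u, 0 < T <= Tmax -> eta <= eta0 ->
    trajectory f T 0 x u -> (Lpnorm +oo T u <= eta%:E)%E ->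
    exists v, [/\ bmf T v, {ae mu, forall t, t \in `]0, T[ -> u t = v t},
      forall s, `|v s| <= eta &
      forall t, 0 <= t <= T -> curve (fun x u => f (x, u)) rho t x v].
Proof.
move=> Tm0; have [eta0 e0 h] := small_curve Tm0.
exists eta0 => // eta T x u TT ee tr ue; have [_ [mu_ _] _] := tr.
have [v [bv ve uv]] := clamp_exists mu_ ue.
exists v; split=> //; apply: (h T x u v TT tr bv uv) => s.
exact: le_trans (ve s) ee.
Qed.

Lemma gapG_eq0 x : x = 0 -> w x = 0.
Proof.
move=> ->; rewrite /gapG (lin0 (linear_coproj S)) (lin0 (linear_orthoproj S)).
by rewrite (bilin0l (bilin_nfG b lH lL bB X0 X1)) subrr.
Qed.

Lemma trajectory_cubic : Pp q = 0 -> (forall i, (i < d)%N -> gam i = 0) ->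
  forall T : R, 0 < T -> exists C eta : R, [/\ 0 < C, 0 < eta &
    forall x u, trajectory f T 0 x u -> (Lpnorm +oo T u <= eta%:E)%E ->
    forall t, 0 <= t <= T -> ((`|w (x t)|)%:E <= C%:E * Lpnorm 3%:E T u ^+ 3)%E].
Proof.
move=> q0 g0 T T0; have [eta e0 h] := clamped_curve T0.
have [C C0 hC] := gap_cubic lH lL bB Bsym X0E X1E CT0 taylorF T0 q0 g0.
exists C, eta; split=> // x u tr ue t tT.
have TT : 0 < T <= T by rewrite T0 lexx.
have [v [bv uv ve cv]] := h eta T x u TT (lexx _) tr ue.
have [_ [mu_ _] _] := tr; rewrite -(moment3_Lpnorm mu_ bv uv) -EFinM lee_fin.
apply: le_trans (hC t x v tT (cv t tT)) _; rewrite ler_wpM2l ?(ltW C0)//.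
exact: moment_le.
Qed.

Lemma trajectory_drift_quadratic : Pp q != 0 -> exists Tstar eta : R, [/\ 0 < Tstar, 0 < eta &
  forall T x u, 0 < T <= Tstar -> trajectory f T 0 x u -> (Lpnorm +oo T u <= eta%:E)%E ->
  forall t, 0 <= t <= T -> 0 <= dot (w (x t)) (Pp q)].
Proof.
move=> q0; have [Tstar [eta1 [Ts0 e10 h1]]] := gap_drift_quadratic lH lL bB Bsym X0E X1E CT0 taylorF q0.
have [eta2 e20 h2] := clamped_curve Ts0.
exists Tstar, (Num.min eta1 eta2); split=> //; first by rewrite lt_min e10.
move=> T x u TT tr ue t tT.
have m2 : Num.min eta1 eta2 <= eta2 by rewrite ge_min lexx orbT.
have [v [bv uv ve cv]] := h2 _ T x u TT m2 tr ue.
apply: (h1 t x v _ (cv t tT)) => [|s].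
  by have /andP[t0 tT'] := tT; have /andP[_ TM] := TT; rewrite t0 (le_trans tT').
by apply: le_trans (ve s) _; rewrite ge_min lexx.
Qed.

(** One chain with u at index k: k primitives of u below it and its 2k derivatives above. The
    primitives vanish at 0 by construction; u and its derivatives do only for controls in
    [Sobolev0]. *)
Lemma sobolev_phi k T u (eta : R) : 0 < T -> (0 < k)%N -> Sobolev (2 * k) T u ->
  (Sobolev_norm (2 * k) T u <= eta%:E)%E -> exists phi : nat -> R -> R,
  [/\ prim_chain T (3 * k) phi /\ bmf T (phi k),
      {ae mu, forall t, t \in `]0, T[ -> u t = phi k t},
      (forall s, `|phi k s| <= eta) /\ (forall s, `|phi (3 * k)%N s| <= eta),
      forall j, (j < k)%N -> phi j 0 = 0 &
      Sobolev0 (2 * k) T u -> forall j, (j < 3 * k)%N -> phi j 0 = 0].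
Proof.
move=> T0 k0 uS ue; have m0 : (0 < 2 * k)%N by rewrite muln_gt0.
have [g [pg gm ug gw ge]] := sobolev_chain T0 m0 uS ue.
have e0 : 0 <= eta := le_trans (normr_ge0 _) (gm 0).
(* The bound on [g 0] is known on [0, T] only, while a [curve] asks for a control bounded at all
   times: it is set to 0 outside. *)
pose g' j := if j is 0%N then (fun s => if 0 <= s <= T then g 0%N s else 0) else g j.
have pg' : prim_chain T (2 * k) g'.
  move=> [|j] jm; last exact: pg.
  by apply: (prim_eq (pg 0%N jm)) => // t /= tT; rewrite tT.
have bg' : bmf T (g' 0%N) by exact: prim_bmf (pg' 0%N m0).
have [phi [pphi phig phi0]] := extend_chain k (ltW T0) pg' bg'.
have k3 : (k + 2 * k = 3 * k)%N by rewrite -mulSn.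
have phik : phi k = g' 0%N by apply/funext => s; rewrite -(phig 0%N) addn0.
exists phi; split=> //.
- by rewrite -k3 phik.
- apply: aeS ug => t + tT => /(_ tT) ->; rewrite phik /=.
  by move: tT; rewrite in_itv/= => /andP[t0 tT]; rewrite !ltW.
- split=> s.
    by rewrite phik /=; case: ifP => sT; [exact: ge|rewrite normr0].
  by rewrite -k3 phig; case: (2 * k)%N m0 gm => // m _; exact.
- move=> uS0 j jk; have [jk'|kj] := ltnP j k; first exact: phi0.
  rewrite -(subnKC kj) phig; have jm : (j - k < 2 * k)%N by rewrite ltn_subLR// k3.
  have := sobolev0_chain T0 uS0 jm pg (gw _ (ltnW jm)).
  by case: (j - k)%N => [|i] //=; rewrite lexx ltW.
Qed.

Lemma trajectory_drift_resonance k : Pp q = 0 -> (k < d)%N -> (forall i, (i < k)%N -> gam i = 0) ->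
  gam k != 0 -> exists2 Tstar : R, 0 < Tstar &
  (exists2 eta : R, 0 < eta & forall T x u, 0 < T <= Tstar -> trajectory f T 0 x u ->
    Sobolev0 (2 * k.+1) T u -> (Sobolev_norm (2 * k.+1) T u <= eta%:E)%E ->
    forall t, 0 <= t <= T -> 0 <= dot (w (x t)) (gam k)) /\
  (forall T : R, 0 < T <= Tstar -> exists2 eta : R, 0 < eta & forall x u,
    trajectory f T 0 x u -> Sobolev (2 * k.+1) T u ->
    (Sobolev_norm (2 * k.+1) T u <= eta%:E)%E -> 0 <= dot (w (x T)) (gam k)).
Proof.
move=> q0 kd gk0 gk; have [Tstar [K0 [Ts0 K00 h1]]] :=
  gap_drift_resonance lH lL bB Bsym X0E X1E CT0 taylorF q0 kd gk0 gk.
have [eta1 e10 h2] := small_curve Ts0.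
exists Tstar => //; split.
  exists (Num.min K0 eta1); first by rewrite lt_min K00.
  set eta := Num.min K0 eta1; have e0 : 0 < eta by rewrite lt_min K00.
  move=> T x u TT tr uS0 ue t tT; have /andP[T0 TM] := TT.
  have [phi [[pphi bphi] uphi [phik phi3] phi0 phi00]] := sobolev_phi T0 (ltn0Sn k) uS0.1 ue.
  have cv := h2 T x u _ TT tr bphi uphi (fun s => le_trans (phik s) _) t tT.
  (* The sign is obtained on [0, t] with t as final time, which requires t > 0; the gap vanishes at
     time 0. *)
  have /andP[t0 tT'] := tT; move: t0; rewrite le_eqVlt => /orP[/eqP <-|t0].
    rewrite (gapG_eq0 (trajectory0 (ltW T0) tr)) -(scale0r (0 : V)) dotZl mul0r//.
  have pt : prim_chain t (3 * k.+1) phi by move=> j jk; exact: primS tT' (pphi j jk).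
  apply: (h1 t x (phi k.+1) phi eta) => //.
  - by rewrite t0 (le_trans tT').
  - by apply: cv; rewrite ge_min lexx orbT.
  - by rewrite e0 ge_min lexx.
  (* All the functions of the chain below the top one vanish at 0, so 3 (k+1) integrations give |phi
     0| <= eta s^(3(k+1)), uniformly in the final time. *)
  move=> s /andP[s0 st]; have k30 : (0 < 3 * k.+1 <= 3 * k.+1)%N by rewrite leqnn muln_gt0.
  have := chain_bound (ltW e0) pt (phi00 uS0) (fun s _ => phi3 s) k30 (s := s).
  rewrite s0 st subnn => /(_ isT) /le_trans; apply.
  by rewrite ler_wpM2l ?(ltW e0)// ler_pXn2r ?nnegrE// ltW.
move=> T TT; have /andP[T0 TM] := TT.
(* Without conditions on u at 0, only the k + 1 primitives vanish there, and |phi 0| <= eta T^(k+1).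
   Enlarging K to eta M with M >= T^(-2(k+1)) restores the bound K T^(3(k+1)), at the price of an
   eta that depends on T. *)
pose M := Num.max 1 (T ^- (2 * k.+1)).
have M1 : 1 <= M by rewrite le_max lexx.
have M0 : 0 < M := lt_le_trans ltr01 M1.
exists (Num.min (K0 / M) eta1); first by rewrite lt_min divr_gt0.
set eta := Num.min (K0 / M) eta1; have e0 : 0 < eta by rewrite lt_min divr_gt0.
move=> x u tr uS ue.
have [phi [[pphi bphi] uphi [phik phi3] phi0 _]] := sobolev_phi T0 (ltn0Sn k) uS ue.
have tT : 0 <= T <= T by rewrite lexx ltW.
have cv := h2 T x u _ TT tr bphi uphi (fun s => le_trans (phik s) _) T tT.
apply: (h1 T x (phi k.+1) phi (eta * M)) => //.
- by apply: cv; rewrite ge_min lexx orbT.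
- by rewrite mulr_gt0// -ler_pdivlMr// ge_min lexx.
- by move=> s _; apply: le_trans (phi3 s) _; rewrite ler_peMr// ltW.
move=> s /andP[s0 st].
have pk : prim_chain T k.+1 phi.
  by move=> j jk; apply: pphi; rewrite (leq_trans jk)// leq_pmull.
have k0 : (0 < k.+1 <= k.+1)%N by rewrite leqnn.
have := chain_bound (ltW e0) pk phi0 (fun s _ => phik s) k0 (s := s).
rewrite s0 st subnn => /(_ isT) /le_trans; apply.
rewrite -mulrA ler_wpM2l ?(ltW e0)//.
apply: (@le_trans _ _ (T ^+ k.+1)); first by rewrite ler_pXn2r ?nnegrE ?(ltW T0).
have -> : (3 * k.+1 = 2 * k.+1 + k.+1)%N by rewrite mulSn addnC.
rewrite exprD mulrA ler_peMl// ?exprn_ge0 ?(ltW T0)//.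
by rewrite -ler_pdivrMr ?exprn_gt0// div1r le_max lexx orbT.
Qed.

(** The target -c nu is orthogonal to S, so the gap there is -c nu itself, with a negative component
    along nu: no trajectory issued from 0 with a small control can end at it. *)
Lemma not_stlc (E : R -> set (R -> R)) (N : R -> (R -> R) -> \bar R) (T eta : R) (nu : V) :
  0 < T -> 0 < eta -> nu != 0 -> Pp nu = nu ->
  (forall x u, trajectory f T 0 x u -> E T u -> (N T u <= eta%:E)%E -> 0 <= dot (w (x T)) nu) ->
  ~ stlc f E N.
Proof.
move=> T0 e0 nu0 nuP h /(_ T eta T0 e0)[dl dl0 st].
have en0 : 0 <= enorm nu by exact: sqrtr_ge0.
(* The added 1 avoids dividing by the norm of nu while keeping the norm of the target at most dl. *)
pose c := dl / (enorm nu + 1); have p0 : 0 < enorm nu + 1 by rewrite ltr_wpDl.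
have c0 : 0 < c by rewrite divr_gt0.
have enZ (a : R) (y : V) : 0 <= a -> enorm (a *: y) = a * enorm y.
  move=> a0; rewrite /enorm dotZl.
  have -> : dot y (a *: y) = a * dot y y.
    by rewrite /dot mulr_sumr; apply: eq_bigr => i _; rewrite mxE; ring.
  by rewrite mulrA -expr2 sqrtrM ?sqr_ge0// sqrtr_sqr ger0_norm.
have enN (y : V) : enorm (- y) = enorm y.
  by rewrite /enorm /dot; congr Num.sqrt; apply: eq_bigr => i _; rewrite !mxE mulrNN.
have [] := st 0 (- (c *: nu)).
  rewrite enN -(scale0r (0 : V)) !enZ ?(ltW c0)// mul0r add0r /c -mulrA ler_piMr ?(ltW dl0)//.
  by rewrite mulrC ler_pdivrMr// mul1r lerDl.
move=> x [u [tr Eu Nu xT]]; have := h x u tr Eu Nu; rewrite xT.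
have lPp := linear_coproj S; have lP := linear_orthoproj S.
have P0 : orthoproj S nu = 0 by have := nuP; rewrite /coproj => /eqP; rewrite subr_eq addrC -subr_eq subrr eq_sym => /eqP.
have -> : w (- (c *: nu)) = - c *: nu.
  rewrite /gapG -scaleNr (linZ lPp) nuP (linZ lP) P0 scaler0.
  by rewrite (bilin0l (bilin_nfG b lH lL bB X0 X1)) subr0.
rewrite dotZl mulNr oppr_ge0 leNgt mulr_gt0//; exact: dot_gt0.
Qed.
End Alternative.

(** * The graph as a map between subspaces, and the final statement *)

Section Graph.
Context {R : realType} {n : nat}.
Notation V := 'rV[R]_n.
Variables (S : {vspace V}) (B : V -> V -> V).
Hypotheses (bB : bilin B) (BC : forall x y, B x y \in ortho_compl S).

Definition quad_graph (s : subvs_of S) : subvs_of (ortho_compl S) :=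
  vsproj (ortho_compl S) (B (vsval s) (vsval s)).

Let pr (y : V) : V := vsval (vsproj S y).
Let lpr : linear pr. Proof. by move=> a x y; rewrite /pr linearP. Qed.

Let bBpr : bilin (fun x y => B (pr x) (pr y)).
Proof.
by split=> [x|y] a u v; rewrite lpr ?(bilinDl bB) ?(bilinDr bB) ?(bilinZl bB) ?(bilinZr bB).
Qed.

Let ambientE : ambient quad_graph = (fun y => B (pr y) (pr y)).
Proof. by apply/funext => y; rewrite /ambient /quad_graph vsprojK. Qed.

Lemma smooth_quad_graph : smooth (ambient quad_graph).
Proof. by rewrite ambientE; exact: (smooth_bilin bBpr). Qed.

Lemma quad_graph0 : quad_graph 0 = 0.
Proof. by rewrite /quad_graph linear0 (bilin0l bB) linear0. Qed.

Lemma diff_quad_graph v : 'd (ambient quad_graph) 0 v = 0.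
Proof.
rewrite ambientE; apply: (eq_trans (diff_bilin_diag 0 v bBpr)).
by rewrite (lin0 lpr) (bilin0l bB) (bilin0r bB) addr0.
Qed.

Lemma gap_quad_graph y : gap quad_graph y = gapG S B y.
Proof.
rewrite /gap /gapG /quad_graph vsprojK// vsprojK//.
by have [] := orthoprojP S y.
Qed.
End Graph.

Lemma enorm_le (R : realType) (n : nat) (x : 'rV[R]_n) : (0 < n)%N -> enorm x <= n%:R * `|x|.
Proof.
move=> n0; have h0 : 0 <= n%:R * `|x| by rewrite mulr_ge0.
rewrite /enorm -(ger0_norm h0) -sqrtr_sqr ler_wsqrtr//.
apply: le_trans (ler_norm _) _; apply: le_trans (dot_bound _ _) _.
by rewrite [leRHS]expr2 ler_wpM2l// ler_peMl ?ler1n.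
Qed.

Lemma dotC (R : realType) (n : nat) (x y : 'rV[R]_n) : dot x y = dot y x.
Proof. by apply: eq_bigr => i _; rewrite mulrC. Qed.

Lemma dot_coproj (R : realType) (n : nat) (S : {vspace 'rV[R]_n}) x y :
  coproj S x = x -> dot x y = dot x (coproj S y).
Proof.
move=> xE; rewrite ![dot x _]dotC /coproj dotDl.
have xC : x \in ortho_compl S by rewrite -xE coproj_compl.
have /mem_ortho_compl xO := xC.
by rewrite -scaleN1r dotZl [dot (orthoproj S y) x]dotC xO ?mulr0 ?addr0//; have [] := orthoprojP S y.
Qed.

Lemma system_jets (R : realType) (n : nat) (f : 'rV[R]_n * R -> 'rV[R]_n) :
  Ck 3 f -> f (0, 0) = 0 -> exists H L B b,
  [/\ linear H, linear L, bilin B & forall x y : 'rV[R]_n, B x y = B y x] /\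
  [/\ forall x, drift_hat f x = H x + 2^-1 *: B x x, forall x, ctrl_hat f x = b + L x &
  exists rho CT : R, [/\ 0 < rho, 0 < CT & forall x u, `|x| <= rho -> `|u| <= rho ->
    `|f (x, u) - quad_jet H L B b (ctrl_second f) x u| <= CT * (`|x| + `|u|) ^+ 3]].
Proof.
move=> fC3 f00; exists (fun v => 'd (drift f) 0 v), (fun v => 'd (ctrl_field f) 0 v).
exists (drift_bil f), (ctrl_field f 0).
split; first split.
- by move=> a x y; exact: linearP.
- by move=> a x y; exact: linearP.
- exact: bilin_drift_bil.
- exact: drift_bil_sym.
split.
- by move=> x; exact: drift_hatE.
- by [].
- exact: taylor_system.
Qed.

Theorem corollary2 (R : realType) (n : nat) (f : 'rV[R]_n * R -> 'rV[R]_n)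
    (n_ge1 : (1 <= n)%N) (fC3 : Ck 3 f) (f00 : f (0, 0) = 0) :
  let S1 := Slie f 1 in
  let S2 := Slie f 2 in
  let d := \dim S1 in
  let d0 := ctrl_second f in
  let c := fun k : nat => lie (ad_hat f k.-1) (ad_hat f k) 0 in
  exists G : subvs_of S1 -> subvs_of (ortho_compl S1),
  [/\ smooth (ambient G), G 0 = 0, (forall v, 'd (ambient G) 0 v = 0) &
  [/\
    ((S2 + <[d0]>)%VS = S1 ->
      forall T : R, 0 < T ->
      exists C eta : R, [/\ 0 < C, 0 < eta &
        forall x u, trajectory f T 0 x u -> (Lpnorm +oo T u <= eta%:E)%E ->
        forall t, t \in `[0, T] ->
          ((enorm (gap G (x t)))%:E <= C%:E * Lpnorm 3%:E T u ^+ 3)%E]),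
    (d0 \notin S1 ->
      ~ stlc f (@Linfty R) (Lpnorm +oo) /\
      exists2 Tstar : R, 0 < Tstar & forall Tau : R, 0 < Tau < Tstar ->
        exists2 eta : R, 0 < eta & forall T : R, 0 < T <= Tau ->
        forall x u, trajectory f T 0 x u -> (Lpnorm +oo T u <= eta%:E)%E ->
        forall t, t \in `[0, T] -> 0 <= dot (gap G (x t)) d0) &
    (d0 \in S1 -> ~ (S2 <= S1)%VS ->
      exists k : nat,
      let dk := - (c k - orthoproj S1 (c k)) in
      [/\ (1 <= k <= d)%N,
          (forall j, (1 <= j < k)%N -> c j \in S1) /\ c k \notin S1,
          dk != 0,
          ~ stlc f (Sobolev (2 * k)) (Sobolev_norm (2 * k)) &
          exists2 Tstar : R, 0 < Tstar & forall Tau : R, 0 < Tau < Tstar ->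
            exists2 eta : R, 0 < eta & forall T : R, 0 < T <= Tau ->
            forall x u, trajectory f T 0 x u ->
            Sobolev0 (2 * k) T u -> (Sobolev_norm (2 * k) T u <= eta%:E)%E ->
            forall t, t \in `[0, T] -> 0 <= dot (gap G (x t)) dk])]].
Proof.
move=> S1 S2 d d0 c.
have cf : continuous f := Ck_continuous fC3.
have [H [L [B [b [[lH lL bB Bsym] [X0E X1E [rho [CT [rho0 CT0 taylorF]]]]]]]]] := system_jets fC3 f00.
pose Gb := nfG H L B b (drift_hat f) (ctrl_hat f).
pose gam := nf_gam H L B b (drift_hat f) (ctrl_hat f).
have bG : bilin Gb := bilin_nfG b lH lL bB (drift_hat f) (ctrl_hat f).
have GC x y : Gb x y \in ortho_compl S1 by exact: nfG_compl.
have gapE := gap_quad_graph GC.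
have gapC y : coproj S1 (gapG S1 Gb y) = gapG S1 Gb y.
  by apply: coproj_id; rewrite /gapG memvB ?coproj_compl ?GC.
have gamP k : coproj S1 (gam k) = gam k by apply: coproj_id; exact: nf_gam_compl.
have cE k : (k < d)%N -> (forall i, (i < k)%N -> gam i = 0) -> coproj S1 (c k.+1) = - 2 *: gam k.
  by move=> kd gk; exact: (coproj_ad_bracket lH lL bB Bsym X0E X1E kd gk).
exists (quad_graph Gb); split; [exact: smooth_quad_graph|exact: quad_graph0|exact: diff_quad_graph|].
split.
- move=> SE T T0.
  have q0 : coproj S1 d0 = 0.
    have sub : (<[d0]> <= S1)%VS by rewrite -SE addvSr.
    by apply/coproj_in/(subvP sub)/memv_line.
  have S21 : (S2 <= S1)%VS by rewrite -SE addvSl.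
  (* By strong induction: if the previous gam vanish, -2 gam k is the projection of a bracket that
     lies in S2, hence in S1, and is therefore 0. *)
  have g0 k : (k < d)%N -> gam k = 0.
    elim/ltn_ind: k => k IH kd.
    have gk i : (i < k)%N -> gam i = 0 by move=> ik; apply: IH => //; exact: ltn_trans kd.
    have ckS : c k.+1 \in S1.
      exact: (subvP S21 _ (ad_bracket_lie_space2 _ _ k)).
    have /eqP := cE k kd gk; rewrite coproj_in// eq_sym scaler_eq0 oppr_eq0 pnatr_eq0/=.
    by move/eqP.
  have [C [eta [C0 e0 h]]] := trajectory_cubic cf lH lL bB Bsym X0E X1E rho0 CT0 taylorF q0 g0 T0.
  (* The factor n compares the Euclidean norm with the sup norm of the estimates. *)
  exists (n%:R * C), eta; split=> //; first by rewrite mulr_gt0// ltr0n.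
  move=> x u tr ue t; rewrite in_itv/= => tT; rewrite gapE.
  apply: (@le_trans _ _ (n%:R%:E * (`|gapG S1 Gb (x t)|)%:E)%E).
    by rewrite -EFinM lee_fin; exact: enorm_le.
  rewrite EFinM -muleA; apply: lee_wpmul2l; first by rewrite lee_fin.
  exact: (h x u tr ue t tT).
- move=> d0S.
  have q0 : coproj S1 d0 != 0 by apply: contra d0S => /eqP/coproj_eq0.
  have [Tstar [eta [Ts0 e0 h]]] :=
    trajectory_drift_quadratic cf lH lL bB Bsym X0E X1E rho0 CT0 taylorF q0.
  split.
    apply: (@not_stlc _ _ f H L B b _ _ lH lL bB _ _ Tstar eta (coproj S1 d0)) => //.
      by apply: coproj_id; exact: coproj_compl.
    move=> x u tr uL ue; apply: (h Tstar x u _ tr ue Tstar); first by rewrite Ts0 lexx.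
    by rewrite lexx ltW.
  exists Tstar => // Tau /andP[Tau0 TauT]; exists eta => // T /andP[T0 TT] x u tr ue t.
  (* The gap is orthogonal to S1, so its pairings with d0 and with the projection of d0 agree. *)
  rewrite in_itv/= => tT; rewrite gapE (dot_coproj _ (gapC (x t))).
  by apply: (h T x u _ tr ue t tT); rewrite T0 (le_trans TT)// ltW.
move=> d0S nS2.
have q0 : coproj S1 d0 = 0 by exact: coproj_in.
(* Contrapositive of [lie_space2_sub]; the least such index also gives the condition on the previous
   brackets. *)
have exk : exists k, (k < d)%N && (gam k != 0).
  apply: contra_notP nS2 => nk; apply: (lie_space2_sub lH lL bB Bsym X0E X1E) => i id.
  by apply/eqP/negPn/negP => gi; apply: nk; exists i; rewrite id.
case: (ex_minnP exk) => k /andP[kd gk] kmin.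
have gk0 i : (i < k)%N -> gam i = 0.
  move=> ik; apply/eqP/negPn/negP => gi.
  by have := kmin i; rewrite (ltn_trans ik kd) gi leqNgt ik => /(_ isT).
have [Tstar Ts0 [h1 h2]] :=
  trajectory_drift_resonance cf lH lL bB Bsym X0E X1E rho0 CT0 taylorF q0 kd gk0 gk.
(* The integer of the statement is [k.+1], since gam is indexed from 0, and the sign in its
   definition makes d_k a positive multiple of [gam k]. *)
have dkE : - (c k.+1 - orthoproj S1 (c k.+1)) = 2 *: gam k.
  by rewrite -[_ - _]/(coproj S1 _) cE// scaleNr opprK.
exists k.+1; rewrite dkE; split=> //.
- split.
    move=> [//|j] /andP[_ jk1]; have jk : (j < k)%N by []; apply: coproj_eq0.
    have gj i : (i < j)%N -> gam i = 0 by move=> ij; apply: gk0; exact: ltn_trans jk.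
    by rewrite cE ?gk0 ?scaler0//; exact: ltn_trans jk kd.
  apply/negP => /coproj_in; rewrite cE// => /eqP.
  by rewrite scaler_eq0 oppr_eq0 pnatr_eq0/= (negPf gk).
- by rewrite scaler_eq0 pnatr_eq0.
- have TT : 0 < Tstar <= Tstar by rewrite Ts0 lexx.
  have [eta e0 h] := h2 Tstar TT.
  exact: (@not_stlc _ _ f H L B b _ _ lH lL bB _ _ Tstar eta (gam k) Ts0 e0 gk (gamP k) h).
have [eta e0 h] := h1.
exists Tstar => // Tau /andP[Tau0 TauT]; exists eta => // T /andP[T0 TT] x u tr uS ue t.
rewrite in_itv/= => tT; rewrite gapE dotC dotZl mulr_ge0// dotC.
by apply: (h T x u _ tr uS ue t tT); rewrite T0 (le_trans TT)// ltW.
Qed.
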